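(* Let $[X_{n,i}]_{n\ge1,i\in I}$ be a partially $\mathcal G$-c.i.d. array of real-valued, square-integrable random variables, and for $n\ge1$, $i\in I$ let $$\tilde S_{n,i}=\sqrt n\big(\overline X_{n,i}-\mathbb E[X_{n+1,i}\mid\mathcal G_n]\big),\quad \overline X_{n,i}=\frac1n\sum_{k=1}^nX_{k,i},$$ $U_{n,i}=X_{n,i}-\mathbb E[X_{n,i}\mid\mathcal G_{n-1}]$, $\Delta E_{n,i}=\mathbb E[X_{n+1,i}\mid\mathcal G_n]-\mathbb E[X_{n,i}\mid\mathcal G_{n-1}]$ and $V_{n,i}=U_{n,i}-n\Delta E_{n,i}$. Assume that $\sup_n\mathbb E[\tilde S_{n,i}^2]<\infty$ for every $i\in I$, and that there are random variables $\tilde\Sigma(e_i,e_j)$, $i,j\in I$, such that $\frac1n\sum_{k=1}^nV_{k,i}V_{k,j}\to\tilde\Sigma(e_i,e_j)$ $\mathbb P$-a.s. for every $i,j\in I$. Then $(\tilde{\mathbf S}_n^I)_{n\ge1}=((\tilde S_{n,i})_{i\in I})_{n\ge1}$ converges stably with representing measure $\mathcal N(0,\tilde\Sigma)$.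
   Context: All random elements live on $(\Omega,\mathcal F,\mathbb P)$; $I$ is finite or countable; here $\mathbb X=\mathbb R$. For a filtration $\mathcal G=(\mathcal G_n)_{n\ge0}$ and $j\in I$, $\mathcal G_n^j=\mathcal G_n\vee\sigma(X_{n+1,i}:i\ne j)$. The array is partially $\mathcal G$-c.i.d. if it is adapted to $\mathcal G$ and $\mathbb E[f(X_{n+1,j})\mid\mathcal G_n^j]=\mathbb E[f(X_{n+k,j})\mid\mathcal G_n^j]$ a.s. for all $j\in I$, $k\ge1$, $n\ge0$ and bounded measurable $f$. $(e_i)_{i\in I}$ is the canonical basis of $\mathbb R^I$ ($\mathbb R^I$ with the product topology). For a (random) symmetric positive semidefinite form $\Sigma$ on $\mathbb R^I$, $\mathcal N(0,\Sigma)$ is the centered Gaussian measure on $\mathbb R^I$ whose marginal on $\mathbb R^J$ ($J$ finite) is centered Gaussian with covariance matrix $(\Sigma(e_i,e_j))_{i,j\in J}$. A sequence $(Z_n)$ of random elements of a Polish space converges stably with representing random measure $\beta(\cdot;\omega)$ if for every $A\in\mathcal F$ and every bounded continuous $g$, $\mathbb E[\mathbf 1_A g(Z_n)]\to\int_A\int g\,d\beta(\cdot;\omega)\,\mathbb P(d\omega)$. *)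

(* Defs.v *)
From HB Require Import structures.
From mathcomp Require Import all_boot all_order all_algebra.
From mathcomp Require Import all_classical all_reals all_analysis.
Set Implicit Arguments. Unset Strict Implicit. Unset Printing Implicit Defensive.
Import Order.TTheory GRing.Theory Num.Theory.
Import numFieldNormedType.Exports.
Local Open Scope classical_set_scope.
Local Open Scope ring_scope.

Definition sub_sigma_field {d} {T : measurableType d} (H : set (set T)) :=
  sigma_algebra setT H /\ H `<=` measurable.

Definition H_measurable {T : Type} {R : realType} (H : set (set T)) (Y : T -> R) :=
  forall B : set R, measurable B -> H (Y @^-1` B).

Definition cond_exp_version {d} {T : measurableType d} {R : realType}
  (P : probability T R) (H : set (set T)) (Z Y : T -> R) :=
  [/\ H_measurable H Y, P.-integrable setT (EFin \o Y) &
      forall A, H A -> (\int[P]_(x in A) (Y x)%:E = \int[P]_(x in A) (Z x)%:E)%E].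

Definition Gnj {d} {T : measurableType d} {R : realType} {I : eqType}
  (G : nat -> set (set T)) (X : nat -> I -> T -> R) (n : nat) (j : I) : set (set T) :=
  <<s [set A | G n A \/
        exists i (B : set R), [/\ i != j, measurable B & A = X n.+1 i @^-1` B]] >>.

Definition partially_cid {d} {T : measurableType d} {R : realType} {I : eqType}
  (P : probability T R) (G : nat -> set (set T)) (X : nat -> I -> T -> R) :=
  (forall n i, (1 <= n)%N -> H_measurable (G n) (X n i)) /\
  forall (j : I) (k n : nat) (f : R -> R), (1 <= k)%N ->
    measurable_fun setT f -> (exists M : R, forall x, `|f x| <= M) ->
    exists Y : T -> R,
      cond_exp_version P (Gnj G X n j) (f \o X n.+1 j) Y /\
      cond_exp_version P (Gnj G X n j) (f \o X (n + k)%N j) Y.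

Definition cylinders (I : Type) (R : realType) : set (set (I -> R)) :=
  [set A | exists i (B : set R), measurable B /\ A = (fun x => x i) @^-1` B].

Definition RI (I : Type) (R : realType) := g_sigma_algebraType (@cylinders I R).

Definition centered_normal {R : realType} (v : R) : set R -> \bar R :=
  if v == 0 then \d_(0 : R) else normal_prob 0 (Num.sqrt v).

Definition centered_gaussian {I : Type} {R : realType}
  (Sigma : I -> I -> R) (mu : probability (RI I R) R) :=
  forall s : seq (I * R),
    let v := \sum_(p <- s) \sum_(q <- s) p.2 * q.2 * Sigma p.1 q.1 in
    0 <= v /\
    forall B : set R, measurable B ->
      mu ((fun x : I -> R => \sum_(p <- s) p.2 * x p.1) @^-1` B) = centered_normal v B.

Definition stably_converges {d} {T : measurableType d} {R : realType} {I : Type}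
  (P : probability T R) (Z : nat -> T -> (I -> R)) (beta : T -> probability (RI I R) R) :=
  forall (A : set T) (g : {ptws I -> R} -> R), measurable A -> continuous g ->
    (exists M : R, forall x, `|g x| <= M) ->
    (fun n => \int[P]_(w in A) (g (Z n w))%:E)%E @ \oo -->
      (\int[P]_(w in A) (\int[beta w]_y (g y)%:E))%E.

(* Main.v *)
(* Testing the c.i.d. property on truncations shows that n |-> E[X_(n+1,i) | G_n] is a martingale. Hence the
   V_(k,i) are martingale differences, and as V_1 + ... + V_n = X_1 + ... + X_n - n M_n = sqrt n Stilde_n, every
   finite linear combination of the coordinates of Stilde_n is a normalized martingale L_n / sqrt n, with
   E[L_n^2] = O(n) and Cesaro-convergent squared increments.
   McLeish's product argument replaces e^{i L_n / sqrt n} by e^{-v/2} times the product of the 1 + i D_k / sqrt n,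
   stopped when the sum of squares exceeds K. The centered products are bounded and asymptotically orthogonal
   in L^2, hence weakly null; so E[1_A cos(theta + L_n / sqrt n)] tends to E[1_A cos(theta) e^{-v/2}].
   Stable convergence in R^I follows from these limits: trigonometric polynomials approximate, on boxes,
   bumps depending on finitely many coordinates, second moments control the complement of the box, and a
   nonnegative continuous function is a countable supremum of bumps.
   The measure N(0, Sigma) is realized by a Gram factorization of Sigma applied to independent normal
   variables, themselves quantiles of the numbers formed from disjoint sets of binary digits of a uniform
   variable. *)
Require Import Defs.
From HB Require Import structures.
From mathcomp Require Import all_boot all_order all_algebra.
From mathcomp Require Import all_classical all_reals all_analysis.
From mathcomp Require Import measurable_realfun ring lra.
Import Order.TTheory GRing.Theory Num.Theory.
Import numFieldNormedType.Exports.
Local Open Scope classical_set_scope.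
Local Open Scope ring_scope.
Set Implicit Arguments.
Unset Strict Implicit.
Unset Printing Implicit Defensive.

(** * Trigonometric bounds and McLeish products *)

Section trig_bounds.
Context {R : realType}.
Implicit Types x y z : R.

(** No conditional variance is assumed to converge, and the limit [v] of the mean squares is random,
    possibly measurable with respect to no [F n]. McLeish's product suits this case: [e^{-v/2}] can
    be moved into the fixed test variable of a weak limit, which is also what makes the convergence
    stable. Stopping is forced by the modulus of the product, which is bounded only through the
    exponential of the sum of squares, whereas only the expectation of that sum is under control.
    Complex numbers are avoided: a free phase [theta] lets one cosine stand for real and imaginary
    parts alike. The random measure is chosen pointwise, with no measurability known in advance;
    measurability of its integrals is read off the explicit cosine integrals and inherited by
    limits. A Gaussian measure is specified by the laws of finite linear combinations, so
    constructing it requires a uniqueness theorem for cosine transforms; that theorem is again the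
    stable convergence criterion, applied to a constant sequence. *)

Lemma sin_le_id x : 0 <= x -> sin x <= x.
Proof.
rewrite le_eqVlt => /predU1P[<-|x0]; first by rewrite sin0.
have dS (z : R) : z \in `]0, x[%R -> is_derive z 1 (@sin R) (cos z) by move=> _; exact: is_derive_sin.
have [|c _] := MVT x0 dS; first by apply: continuous_subspaceT; exact: continuous_sin.
rewrite sin0 !subr0 => ->; rewrite -[leRHS]mul1r ler_wpM2r ?cos_le1// ltW//.
Qed.

Lemma cos_ge_quadratic x : 1 - x ^+ 2 / 2 <= cos x.
Proof.
wlog x0 : x / 0 <= x.
  move=> h; have [/h//|/ltW xN] := leP 0 x.
  by rewrite -cosN -sqrrN; apply: h; rewrite oppr_ge0.
have s0 : sin (x / 2) ^+ 2 <= (x / 2) ^+ 2.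
  rewrite -[leLHS]real_normK ?num_real// lerXn2r ?nnegrE//; first by lra.
  have [s|/ltW s] := leP 0 (sin (x / 2)); first by rewrite ger0_norm// sin_le_id; lra.
  rewrite ler0_norm//.
  have [x2|x2] := leP x 2.
    have [->|xn] := eqVneq x 0; first by rewrite mul0r sin0 oppr0.
    have : 0 < sin (x / 2) by apply: sin2_gt0; apply/andP; split; lra.
    by lra.
  have := sin_geN1 (x / 2); lra.
have -> : cos x = 1 - 2 * sin (x / 2) ^+ 2.
  have -> : x = (x / 2) *+ 2 by rewrite mulr2n; lra.
  rewrite cos_mulr2n cos2sin2 -mulr_natl.
  have -> : ((x / 2) *+ 2) / 2 = x / 2 by rewrite mulr2n; lra.
  lra.
nra.
Qed.

(** By the mean value theorem sin x = x cos c with 0 < c < x. The constant 1/2 instead of the sharp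
    1/6 suffices, since only the order of the remainder matters below. *)
Lemma sin_ge_cubic x : 0 <= x -> x - x ^+ 3 / 2 <= sin x.
Proof.
rewrite le_eqVlt => /predU1P[<-|x0]; first by rewrite sin0 expr0n/= mul0r subr0.
have dS (z : R) : z \in `]0, x[%R -> is_derive z 1 (@sin R) (cos z) by move=> _; exact: is_derive_sin.
have [|c] := MVT x0 dS; first by apply: continuous_subspaceT; exact: continuous_sin.
rewrite in_itv/= => /andP[c0 cx]; rewrite sin0 !subr0 => ->.
have := cos_ge_quadratic c => h.
rewrite (_ : x - x ^+ 3 / 2 = (1 - x ^+ 2 / 2) * x); last by ring.
apply: ler_wpM2r; first exact: ltW.
apply: (le_trans _ h); rewrite lerD2l lerN2 ler_pM2r ?invr_gt0//.
by rewrite lerXn2r ?nnegrE ?ltW.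
Qed.

Lemma sin_cubic_bound x : `|sin x - x| <= `|x| ^+ 3 / 2.
Proof.
wlog x0 : x / 0 <= x.
  move=> h; have [/h//|/ltW xN] := leP 0 x.
  have := h (- x); rewrite oppr_ge0 sinN normrN opprK => /(_ xN).
  by rewrite addrC distrC.
have h1 := sin_le_id x0; have h2 := sin_ge_cubic x0.
rewrite (ger0_norm x0) ler_norml; apply/andP; split; lra.
Qed.

(** Half-angle formula and the square of the cubic lower bound for the sine. Squaring requires that
    bound to be nonnegative, whence the split at 2, beyond which the right-hand side is at least
    1. *)
Lemma cos_le_quartic x : cos x <= 1 - x ^+ 2 / 2 + x ^+ 4 / 8.
Proof.
wlog x0 : x / 0 <= x.
  move=> h; have [/h//|/ltW xN] := leP 0 x.
  have := h (- x); rewrite cosN sqrrN oppr_ge0 => /(_ xN).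
  by rewrite (_ : (- x) ^+ 4 = x ^+ 4)//; ring.
have [x2|x2] := leP 2 x.
  apply: (le_trans (cos_le1 _)).
  have : 4 <= x ^+ 2 by nra.
  have -> : x ^+ 4 = x ^+ 2 * x ^+ 2 by ring.
  nra.
have -> : cos x = 1 - 2 * sin (x / 2) ^+ 2.
  have {1}-> : x = (x / 2) *+ 2 by rewrite mulr2n; lra.
  rewrite cos_mulr2n cos2sin2 -mulr_natl; lra.
have z0 : 0 <= x / 2 by lra.
have h := sin_ge_cubic z0.
set z := x / 2 in z0 h *.
have -> : x = 2 * z by rewrite /z; lra.
have z1 : z < 1 by rewrite /z; lra.
have p : 0 <= z - z ^+ 3 / 2.
  by rewrite (_ : _ - _ = z * (1 - z ^+ 2 / 2)); [apply: mulr_ge0; nra|ring].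
have : (z - z ^+ 3 / 2) ^+ 2 <= sin z ^+ 2 by rewrite lerXn2r// nnegrE (le_trans p).
have -> : (2 * z) ^+ 4 / 8 = 2 * z ^+ 4 by field.
have -> : (2 * z) ^+ 2 / 2 = 2 * z ^+ 2 by field.
have -> : (z - z ^+ 3 / 2) ^+ 2 = z ^+ 2 - z ^+ 4 + z ^+ 6 / 4 by field.
have : 0 <= z ^+ 6 by rewrite exprn_ge0.
lra.
Qed.

Lemma expRN_le y : 0 <= y -> expR (- y) <= 1 - y + y ^+ 2.
Proof.
move=> y0; rewrite expRN.
have h := expR_ge1Dx y.
have h1 : (1 + y)^-1 <= 1 - y + y ^+ 2.
  rewrite -div1r ler_pdivrMr ?ltr_pwDl//.
  have : 0 <= y ^+ 3 by rewrite exprn_ge0.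
  rewrite (_ : (1 - y + y ^+ 2) * (1 + y) = 1 + y ^+ 3); [lra|ring].
by apply: le_trans h1; rewrite lef_pV2 ?posrE ?expR_gt0// ltr_pwDl.
Qed.

(* |(1 + ix) e^{-x^2/2} - e^{ix}|^2 *)
Lemma mcleish_factor_bound x :
  (expR (- (x ^+ 2 / 2)) - cos x) ^+ 2 +
  (x * expR (- (x ^+ 2 / 2)) - sin x) ^+ 2 <= (2 * `|x| ^+ 3) ^+ 2.
Proof.
wlog x0 : x / 0 <= x.
  move=> h; have [/h//|/ltW xN] := leP 0 x.
  have := h (- x); rewrite oppr_ge0 => /(_ xN).
  rewrite sqrrN cosN sinN mulNr normrN.
  by rewrite (_ : - (x * expR (- (x ^+ 2 / 2))) - - sin x = - (x * expR (- (x ^+ 2 / 2)) - sin x));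
   [rewrite sqrrN|ring].
rewrite ger0_norm//.
have y0 : 0 <= x ^+ 2 / 2 by rewrite divr_ge0// sqr_ge0.
have e1 := expRN_le y0; have := expR_ge1Dx (- (x ^+ 2 / 2)) => e2.
have c1 := cos_ge_quadratic x; have c2 := cos_le_quartic x.
have s1 := sin_le_id x0; have s2 := sin_ge_cubic x0.
have e3 : expR (- (x ^+ 2 / 2)) <= 1 by rewrite expR_le1 oppr_le0.
have e4 := expR_ge0 (- (x ^+ 2 / 2)).
set e := expR _ in e1 e2 e3 e4 *.
have x3 : 0 <= x ^+ 3 by rewrite exprn_ge0.
have [x1|x1] := leP x 1.
  have x43 : x ^+ 4 <= x ^+ 3 by rewrite exprS ler_piMl.
  have yy : (x ^+ 2 / 2) ^+ 2 = x ^+ 4 / 4 by field.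
  have A : `|e - cos x| <= x ^+ 3 by rewrite ler_norml; apply/andP; split; lra.
  have xe : x * e >= x - x ^+ 3 / 2.
    rewrite (_ : x - x ^+ 3 / 2 = x * (1 - x ^+ 2 / 2)); last by ring.
    by rewrite ler_wpM2l//; lra.
  have xe2 : x * e <= x by rewrite ler_piMr.
  have B : `|x * e - sin x| <= x ^+ 3 by rewrite ler_norml; apply/andP; split; lra.
  rewrite -(real_normK (num_real (e - cos x))) -(real_normK (num_real (x * e - sin x))).
  have := normr_ge0 (e - cos x); have := normr_ge0 (x * e - sin x); nra.
have cs := cos2Dsin2 x.
have x32 : x ^+ 2 <= x ^+ 3 by rewrite [leRHS]exprS ler_peMl ?sqr_ge0// ltW.
have u : e ^+ 2 + (x * e) ^+ 2 <= 1.
  have := expR_ge1Dx (x ^+ 2).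
  have -> : e ^+ 2 + (x * e) ^+ 2 = e ^+ 2 * (1 + x ^+ 2) by ring.
  have -> : e ^+ 2 = expR (- x ^+ 2).
    by rewrite expr2 /e -expRD; congr expR; field.
  move=> h; rewrite expRN mulrC ler_pdivrMr ?expR_gt0// mul1r//.
have : (e - cos x) ^+ 2 + (x * e - sin x) ^+ 2 <= 4.
  have := sqr_ge0 (e + cos x); have := sqr_ge0 (x * e + sin x); nra.
have : 1 <= x ^+ 3 by rewrite exprn_ege1// ltW.
nra.
Qed.

End trig_bounds.

Section mcleish.
Context {R : realType}.
Variable theta : R.

(* Real and imaginary part of e^{i theta} (1 + i x_0) ... (1 + i x_{n-1}) *)
Fixpoint mcleish (x : nat -> R) (n : nat) : R * R :=
  if n is k.+1 then
    let p := mcleish x k in (p.1 - x k * p.2, p.2 + x k * p.1)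
  else (cos theta, sin theta).

Implicit Type x : nat -> R.

Lemma mcleish_normS x n :
  (mcleish x n.+1).1 ^+ 2 + (mcleish x n.+1).2 ^+ 2 =
  ((mcleish x n).1 ^+ 2 + (mcleish x n).2 ^+ 2) * (1 + x n ^+ 2).
Proof. by rewrite /=; ring. Qed.

Lemma mcleish_norm_le x n :
  (mcleish x n).1 ^+ 2 + (mcleish x n).2 ^+ 2 <= expR (\sum_(k < n) x k ^+ 2).
Proof.
elim: n => [|n ih]; first by rewrite /= cos2Dsin2 big_ord0 expR0.
rewrite mcleish_normS big_ord_recr/= expRD ler_pM ?addr_ge0 ?sqr_ge0//.
exact: expR_ge1Dx.
Qed.

(** Triangle inequality of the Euclidean plane, in squared form so that no square root occurs;
    Cauchy-Schwarz comes from Lagrange's identity. *)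
Lemma minkowski2 (a1 a2 f1 f2 D d : R) : 0 <= D -> 0 <= d ->
  a1 ^+ 2 + a2 ^+ 2 <= D ^+ 2 -> f1 ^+ 2 + f2 ^+ 2 <= d ^+ 2 ->
  (a1 + f1) ^+ 2 + (a2 + f2) ^+ 2 <= (D + d) ^+ 2.
Proof.
move=> D0 d0 ha hf.
have h : a1 * f1 + a2 * f2 <= D * d.
  apply: (le_trans (ler_norm _)).
  rewrite -(@ler_pXn2r _ 2%N)// ?nnegrE ?mulr_ge0// real_normK ?num_real//.
  apply: (@le_trans _ _ ((a1 ^+ 2 + a2 ^+ 2) * (f1 ^+ 2 + f2 ^+ 2))).
    have := sqr_ge0 (a1 * f2 - a2 * f1); nra.
  by rewrite exprMn ler_pM// addr_ge0// sqr_ge0.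
nra.
Qed.

(** Factors are exchanged one at a time. Both [(1 + i x) e^{-x^2/2}] and [e^{i x}] have modulus at
    most 1, so an error made at one index is not amplified later and the errors of the single
    factors add up. *)
Lemma mcleish_approx x n :
  let Q := \sum_(k < n) x k ^+ 2 in let S := \sum_(k < n) x k in
  ((mcleish x n).1 * expR (- (Q / 2)) - cos (theta + S)) ^+ 2 +
  ((mcleish x n).2 * expR (- (Q / 2)) - sin (theta + S)) ^+ 2 <=
  (\sum_(k < n) 2 * `|x k| ^+ 3) ^+ 2.
Proof.
elim: n => [|n /= ih].
  by rewrite /= !big_ord0 mul0r oppr0 expR0 addr0 !mulr1 !subrr expr0n/= addr0.
rewrite !big_ord_recr/=.
set Q := \sum_(k < n) x k ^+ 2 in ih *.
set S := \sum_(k < n) x k in ih *.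
set c := (mcleish x n).1 in ih *; set s := (mcleish x n).2 in ih *.
set D := \sum_(i < n) _ in ih *.
have D0 : 0 <= D by apply: sumr_ge0 => i _; rewrite mulr_ge0// exprn_ge0.
set E := expR (- (Q / 2)) in ih *.
have -> : expR (- ((Q + x n ^+ 2) / 2)) = E * expR (- (x n ^+ 2 / 2)).
  by rewrite /E -expRD; congr expR; field.
have := mcleish_factor_bound (x n).
set y := x n; set e := expR _ => hf.
have -> : theta + (S + y) = (theta + S) + y by ring.
rewrite (cosD (theta + S)) (sinD (theta + S)).
have tt := cos2Dsin2 (theta + S).
set u := cos (theta + S) in ih tt *; set w := sin (theta + S) in ih tt *.
set a := c * E - u in ih *; set b := s * E - w in ih *.
(* The old error [(a, b)] multiplied by the new factor, plus the error of the new factor rotated by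
   the unit vector [(u, w)]. *)
rewrite (_ : (c - y * s) * (E * e) - _ =
  e * (a - y * b) + ((e - cos y) * u - (y * e - sin y) * w)); last by rewrite /a /b; ring.
rewrite (_ : (s + y * c) * (E * e) - _ =
  e * (b + y * a) + ((e - cos y) * w + (y * e - sin y) * u)); last by rewrite /a /b; ring.
apply: minkowski2 => //.
  apply: le_trans ih.
  rewrite (_ : (e * _) ^+ 2 + _ = (a ^+ 2 + b ^+ 2) * (e ^+ 2 * (1 + y ^+ 2))); last by ring.
  rewrite ler_piMr ?addr_ge0 ?sqr_ge0//.
  have -> : e ^+ 2 = expR (- y ^+ 2) by rewrite expr2 /e -expRD; congr expR; field.
  by rewrite expRN mulrC ler_pdivrMr ?expR_gt0// mul1r expR_ge1Dx.
apply: le_trans hf.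
rewrite (_ : _ + _ = ((e - cos y) ^+ 2 + (y * e - sin y) ^+ 2) * (u ^+ 2 + w ^+ 2)); last by ring.
by rewrite tt mulr1.
Qed.

(* Only the last nonzero factor can make the sum of squares exceed K. *)
Lemma mcleish_stopped_bound x (K : R) n : 0 <= K ->
  let Q k := \sum_(j < k) x j ^+ 2 in
  let y k := x k * (Q k <= K)%R%:R in
  let N := (mcleish y n).1 ^+ 2 + (mcleish y n).2 ^+ 2 in
  N <= expR K * (1 + Q n) /\ (Q n <= K -> N <= expR K).
Proof.
move=> K0 Q y /=.
have QS k : Q k.+1 = Q k + x k ^+ 2 by rewrite /Q big_ord_recr.
have Q0 k : 0 <= Q k by apply: sumr_ge0 => i _; rewrite sqr_ge0.
(* The second bound is strengthened to the exponent [Q n], which gains exactly [x n ^+ 2] at each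
   step of the induction. *)
suff : (mcleish y n).1 ^+ 2 + (mcleish y n).2 ^+ 2 <= expR K * (1 + Q n) /\
  (Q n <= K -> (mcleish y n).1 ^+ 2 + (mcleish y n).2 ^+ 2 <= expR (Q n)).
  move=> [h1 h2]; split => // h; apply: (le_trans (h2 h)).
  by rewrite ler_expR.
elim: n => [|n [ih1 ih2]].
  rewrite /= cos2Dsin2 /Q big_ord0 expR0 addr0 mulr1; split => //.
  by rewrite -expR0 ler_expR.
rewrite mcleish_normS QS /y; have [h|h] := leP (Q n) K; last first.
  rewrite mulr0 expr0n/= addr0 mulr1; split.
    apply: (le_trans ih1); rewrite ler_wpM2l ?expR_ge0// lerD2l lerDl sqr_ge0//.
  move=> h'; exfalso; have := sqr_ge0 (x n); lra.
have {}ih2 := ih2 h; rewrite mulr1; split.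
  apply: (@le_trans _ _ (expR K * (1 + x n ^+ 2))).
    rewrite ler_wpM2r// ?addr_ge0 ?sqr_ge0//; apply: (le_trans ih2).
    by rewrite ler_expR.
  by rewrite ler_wpM2l ?expR_ge0// lerD2l lerDr.
move=> _; rewrite expRD ler_pM ?addr_ge0 ?sqr_ge0//.
exact: expR_ge1Dx.
Qed.

End mcleish.

(** * Square-integrable random variables *)

Section expectation_lemmas.
Context d {T : measurableType d} {R : realType} (P : probability T R).
Implicit Types f g : T -> R.

Lemma bounded_integrable f (B : R) : measurable_fun setT f ->
  (forall w, `|f w| <= B) -> P.-integrable setT (EFin \o f).
Proof.
move=> mf fB; apply: measurable_bounded_integrable => //.
  exact: (le_lt_trans (probability_le1 P measurableT) (ltry 1)).
exists B; split; first exact: num_real.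
by move=> x Bx w _; apply: (le_trans (fB w)); exact: ltW.
Qed.

Lemma cst_integrable (c : R) : P.-integrable setT (EFin \o (fun=> c)).
Proof. by apply: (@bounded_integrable _ `|c|). Qed.

Lemma le_integrable_real f g : measurable_fun setT f ->
  P.-integrable setT (EFin \o g) -> (forall w, `|f w| <= g w) ->
  P.-integrable setT (EFin \o f).
Proof.
move=> mf ig fg; apply: le_integrable ig => //; first exact/measurable_EFinP.
by move=> w _; rewrite /= lee_fin (le_trans (fg w))// ler_norm.
Qed.

Lemma integrable_measurable f : P.-integrable setT (EFin \o f) -> measurable_fun setT f.
Proof. by case/integrableP => /measurable_EFinP. Qed.

Lemma integrable_addr f g : P.-integrable setT (EFin \o f) ->
  P.-integrable setT (EFin \o g) -> P.-integrable setT (EFin \o (fun w => f w + g w)).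
Proof. by move=> If Ig; exact: (integrableD measurableT If Ig). Qed.

Lemma integrable_subr f g : P.-integrable setT (EFin \o f) ->
  P.-integrable setT (EFin \o g) -> P.-integrable setT (EFin \o (fun w => f w - g w)).
Proof. by move=> If Ig; exact: (integrableB measurableT If Ig). Qed.

Lemma integrable_scaler (c : R) f : P.-integrable setT (EFin \o f) ->
  P.-integrable setT (EFin \o (fun w => c * f w)).
Proof. by move=> If; exact: (integrableZl measurableT c If). Qed.

Lemma integrable_mul_bounded f g (B : R) : measurable_fun setT g ->
  (forall w, `|g w| <= B) -> P.-integrable setT (EFin \o f) ->
  P.-integrable setT (EFin \o (fun w => g w * f w)).
Proof.
move=> mg gB If.
have B0 (w : T) : 0 <= B by exact: le_trans (gB w).
apply: (@le_integrable_real _ (fun w => B * `|f w|)).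
- by apply: measurable_funM => //; exact: integrable_measurable.
- exact/integrable_scaler/integrable_norm.
- by move=> w; rewrite normrM ler_wpM2r.
Qed.

Lemma integrable_sumr (I : Type) (s : seq I) (F : I -> T -> R) :
  (forall i, P.-integrable setT (EFin \o F i)) ->
  P.-integrable setT (EFin \o (fun w => \sum_(i <- s) F i w)).
Proof.
move=> IF; elim: s => [|i s ih].
  rewrite (_ : (fun w => _) = fun=> 0); first exact: cst_integrable.
  by apply/funext => w; rewrite big_nil.
rewrite (_ : (fun w => _) = fun w => F i w + \sum_(i <- s) F i w).
  exact: integrable_addr.
by apply/funext => w; rewrite big_cons.
Qed.

Lemma Rintegral_sum (I : Type) (s : seq I) (F : I -> T -> R) :
  (forall i, P.-integrable setT (EFin \o F i)) ->
  \int[P]_w (\sum_(i <- s) F i w) = \sum_(i <- s) \int[P]_w F i w.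
Proof.
move=> IF; elim: s => [|i s ih].
  under eq_Rintegral do rewrite big_nil.
  by rewrite big_nil Rintegral_cst// mul0r.
under eq_Rintegral do rewrite big_cons.
by rewrite big_cons RintegralD// ?ih//; exact: integrable_sumr.
Qed.

Lemma Rintegral_dominated_cvg (f_ : nat -> T -> R) f g :
  (forall n, measurable_fun setT (f_ n)) -> measurable_fun setT f ->
  P.-integrable setT (EFin \o g) ->
  {ae P, forall w, f_ ^~ w @ \oo --> f w} ->
  (forall n w, `|f_ n w| <= g w) ->
  (fun n => \int[P]_w f_ n w) @ \oo --> \int[P]_w f w.
Proof.
move=> mf_ mf ig fc fg.
have [| | | | |If _ h] := @dominated_convergence _ T R P setT measurableT
  (fun n => EFin \o f_ n) (EFin \o f) (EFin \o g).
- by move=> n; exact/measurable_EFinP.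
- exact/measurable_EFinP.
- by apply: filterS fc => w fw _; apply: cvg_EFin => //; exact: nearW.
- exact: ig.
- by apply: aeW => w n _; rewrite /= lee_fin fg.
apply: fine_cvg => /=; rewrite fineK//.
exact: integrable_fin_num.
Qed.

Lemma Rintegral_bounded_cvg (f_ : nat -> T -> R) f (B : R) :
  (forall n, measurable_fun setT (f_ n)) -> measurable_fun setT f ->
  {ae P, forall w, f_ ^~ w @ \oo --> f w} ->
  (forall n w, `|f_ n w| <= B) ->
  (fun n => \int[P]_w f_ n w) @ \oo --> \int[P]_w f w.
Proof.
move=> mf_ mf fc fB.
exact: (@Rintegral_dominated_cvg _ _ _ mf_ mf (cst_integrable B)).
Qed.

Lemma Rintegral_bounded_cst (c : R) : \int[P]_w c = c.
Proof.
rewrite Rintegral_cst//; transitivity (c * fine (1%E : \bar R)); last exact: mulr1.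
by congr (_ * fine _); exact: probability_setT.
Qed.

Lemma Rintegral_norm_le f (B : R) : measurable_fun setT f ->
  (forall w, `|f w| <= B) -> `|\int[P]_w f w| <= B.
Proof.
move=> mf fB; have If := bounded_integrable mf fB.
apply: (le_trans (le_normr_Rintegral _ If)) => //.
rewrite -[leRHS]Rintegral_bounded_cst; apply: le_Rintegral => //.
  exact: integrable_norm.
exact: cst_integrable.
Qed.

Definition sq_integrable f :=
  measurable_fun setT f /\ P.-integrable setT (EFin \o (fun w => f w ^+ 2)).

Lemma sq_integrable_mul f g : sq_integrable f -> sq_integrable g ->
  P.-integrable setT (EFin \o (fun w => f w * g w)).
Proof.
move=> [mf f2] [mg g2].
apply: (le_integrable_real _ (integrable_addr f2 g2)); first exact: measurable_funM.
move=> w; rewrite normrM -(real_normK (num_real (f w))) -(real_normK (num_real (g w))).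
have := normr_ge0 (f w); have := normr_ge0 (g w); set a := Num.norm _; set b := Num.norm _ => a0 b0.
by have := sqr_ge0 (a - b); nra.
Qed.

Lemma sq_integrable_bounded f (B : R) : measurable_fun setT f ->
  (forall w, `|f w| <= B) -> sq_integrable f.
Proof.
move=> mf fB; split => //; apply: (@bounded_integrable _ (B ^+ 2)).
  exact: measurable_funX.
by move=> w; rewrite normrX lerXn2r// nnegrE (le_trans _ (fB w)).
Qed.

Lemma sq_integrable1 f : sq_integrable f -> P.-integrable setT (EFin \o f).
Proof.
move=> hf.
have h1 : sq_integrable (fun=> 1) by apply: (@sq_integrable_bounded _ 1) => // w; rewrite normr1.
by have := sq_integrable_mul hf h1; under [X in EFin \o X]eq_fun do rewrite mulr1.
Qed.

Lemma sq_integrable_le f g : measurable_fun setT f -> sq_integrable g ->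
  (forall w, `|f w| <= `|g w|) -> sq_integrable f.
Proof.
move=> mf [mg g2] fg; split => //.
apply: (le_integrable_real _ g2); first exact: measurable_funX.
move=> w; rewrite normrX -[leRHS]real_normK ?num_real// lerXn2r// nnegrE//.
Qed.

Lemma sq_integrableZ (c : R) f : sq_integrable f -> sq_integrable (fun w => c * f w).
Proof.
move=> [mf f2]; split; first exact: measurable_funM.
rewrite (_ : (fun w => _) = fun w => c ^+ 2 * f w ^+ 2); first exact: integrable_scaler.
by apply/funext => w; rewrite exprMn.
Qed.

Lemma sq_integrableD f g : sq_integrable f -> sq_integrable g ->
  sq_integrable (fun w => f w + g w).
Proof.
move=> hf hg; split; first by apply: measurable_funD; [case: hf|case: hg].
rewrite (_ : (fun w => _) = fun w => (f w ^+ 2 + g w ^+ 2) + 2 * (f w * g w)).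
  apply: integrable_addr; first by apply: integrable_addr; [case: hf|case: hg].
  exact/integrable_scaler/sq_integrable_mul.
by apply/funext => w; ring.
Qed.

Lemma sq_integrableB f g : sq_integrable f -> sq_integrable g ->
  sq_integrable (fun w => f w - g w).
Proof.
move=> hf hg; have := sq_integrableD hf (sq_integrableZ (-1) hg).
by under eq_fun do rewrite mulN1r.
Qed.

Lemma sq_integrable_sum (I : Type) (s : seq I) (F : I -> T -> R) :
  (forall i, sq_integrable (F i)) -> sq_integrable (fun w => \sum_(i <- s) F i w).
Proof.
move=> IF; elim: s => [|i s ih].
  apply: (@sq_integrable_bounded _ 0) => [|w]; last by rewrite big_nil normr0.
  by rewrite (_ : (fun w => _) = cst 0)//; apply/funext => w; rewrite big_nil.
rewrite (_ : (fun w => _) = fun w => F i w + \sum_(i <- s) F i w); first exact: sq_integrableD.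
by apply/funext => w; rewrite big_cons.
Qed.

(* A form of Cauchy-Schwarz without square roots. *)
Lemma Rintegral_mul_le f g (a : R) : 0 < a -> sq_integrable f -> sq_integrable g ->
  `|\int[P]_w (f w * g w)| <= a * (\int[P]_w f w ^+ 2) + a^-1 * \int[P]_w g w ^+ 2.
Proof.
move=> a0 hf hg; have Ifg := sq_integrable_mul hf hg.
apply: (le_trans (le_normr_Rintegral _ Ifg)) => //.
rewrite -RintegralZl//; last by case: hf.
rewrite -RintegralZl//; last by case: hg.
rewrite -RintegralD//; [|by apply: integrable_scaler; case: hf|by apply: integrable_scaler; case: hg].
apply: le_Rintegral => //; first exact: integrable_norm.
  by apply: integrable_addr; apply: integrable_scaler; [case: hf|case: hg].
move=> w _; rewrite normrM -(real_normK (num_real (f w))) -(real_normK (num_real (g w))).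
have := normr_ge0 (f w); have := normr_ge0 (g w); set x := Num.norm _; set y := Num.norm _ => x0 y0.
have ai : 0 < a^-1 by rewrite invr_gt0.
rewrite -subr_ge0 (_ : _ - _ = a^-1 * ((a * y - x) ^+ 2 + a * y * x)); last by field; lra.
by apply: mulr_ge0; [exact: ltW|rewrite addr_ge0 ?sqr_ge0 ?mulr_ge0//; exact: ltW].
Qed.

(* An asymptotically orthogonal bounded sequence of L^2 is weakly null: otherwise sums of m terms of a
   sparse subsequence would have norm O(sqrt m) and pairing with Y of order m. *)
Lemma weakly_null (W : nat -> T -> R) (B : R) Y :
  (forall n, sq_integrable (W n)) -> (forall n, \int[P]_w W n w ^+ 2 <= B) ->
  (forall j, (fun n => \int[P]_w (W n w * W j w)) @ \oo --> 0) ->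
  sq_integrable Y ->
  (fun n => \int[P]_w (W n w * Y w)) @ \oo --> 0.
Proof.
move=> hW WB Wj hY; apply: contrapT => ncvg.
have [e e0 he] : exists2 e : R, 0 < e &
    forall N, exists n, (N <= n)%N /\ e <= `|\int[P]_w (W n w * Y w)|.
  apply: contrapT => h; apply: ncvg; apply/cvgr0Pnorm_lt => e e0.
  apply: contrapT => h'; apply: h; exists e => // N; apply: contrapT => h''.
  apply: h'; exists N => // n /= Nn; rewrite ltNge; apply/negP => le_e.
  by apply: h''; exists n.
have B0 : 0 <= B by apply: le_trans (WB 0%N); apply: Rintegral_ge0 => w _; exact: sqr_ge0.
(* [U] is a signed sum of m of the [W n], built greedily. The next index is taken so far out that
   its pairing with [U] is below 1/2; the cross term then costs at most 1, so the squared norm grows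
   by at most [B + 1]. *)
have step m : exists U, [/\ sq_integrable U,
    (fun n => \int[P]_w (W n w * U w)) @ \oo --> 0,
    m%:R * e <= \int[P]_w (U w * Y w) & \int[P]_w U w ^+ 2 <= m%:R * (B + 1)].
  elim: m => [|m [U [hU U0 UY U2]]].
    exists (fun=> 0); split.
    - by apply: (@sq_integrable_bounded _ 0) => // w; rewrite normr0.
    - under eq_fun do under eq_Rintegral do rewrite mulr0.
      under eq_fun do rewrite Rintegral_bounded_cst.
      exact: cvg_cst.
    - by under eq_Rintegral do rewrite mul0r; rewrite Rintegral_bounded_cst mul0r.
    - by under eq_Rintegral do rewrite expr0n/=; rewrite Rintegral_bounded_cst mul0r.
  have [N _ hN] : \forall n \near \oo, `|\int[P]_w (W n w * U w)| < 1 / 2.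
    by move/cvgr0Pnorm_lt : U0; apply; lra.
  have [n [Nn en]] := he N.
  pose sg : R := Num.sg (\int[P]_w (W n w * Y w)).
  have sg2 : sg ^+ 2 = 1.
    rewrite /sg sqr_sg; case: eqVneq en => //= ->; rewrite normr0 => ?; lra.
  have sgle : `|sg| <= 1 by rewrite -(@ler_pXn2r _ 2%N)// ?nnegrE// real_normK ?num_real// sg2 expr1n.
  exists (fun w => U w + sg * W n w).
  have hsW := sq_integrableZ sg (hW n).
  split.
  - exact: sq_integrableD.
  - rewrite (_ : (fun k => _) = (fun k => \int[P]_w (W k w * U w)
        + sg * \int[P]_w (W k w * W n w))).
      rewrite [X in _ --> X](_ : 0 = 0 + sg * 0); last by rewrite mulr0 addr0.
      by apply: cvgD => //; apply: cvgM; [exact: cvg_cst|exact: Wj].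
    apply/funext => k; rewrite -RintegralZl//; last exact: sq_integrable_mul.
    rewrite -RintegralD//; last 2 first.
      exact: sq_integrable_mul.
      exact/integrable_scaler/sq_integrable_mul.
    by apply: eq_Rintegral => w _; ring.
  - under eq_Rintegral => w _ do rewrite mulrDl -mulrA.
    rewrite RintegralD//; last 2 first.
      exact: sq_integrable_mul.
      exact/integrable_scaler/sq_integrable_mul.
    rewrite RintegralZl//; last exact: sq_integrable_mul.
    by move: en; rewrite /sg -normrEsg -[m.+1%:R]natr1; lra.
  - rewrite (_ : (fun w => _) = fun w => U w ^+ 2 + (2 * sg) * (W n w * U w)
        + W n w ^+ 2); last first.
      by apply/funext => w; rewrite sqrrD exprMn sg2; ring.
    rewrite RintegralD//; last 2 first.
      apply: integrable_addr; first by case: hU.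
      exact/integrable_scaler/sq_integrable_mul.
      by case: (hW n).
    rewrite RintegralD//; last 2 first.
      by case: hU.
      exact/integrable_scaler/sq_integrable_mul.
    rewrite RintegralZl//; last exact: sq_integrable_mul.
    have := hN n Nn => /=; set x := Rintegral _ _ _ => hx.
    have : sg * x <= 1 / 2.
      apply: (le_trans (ler_norm _)); rewrite normrM; have := normr_ge0 x.
      have := normr_ge0 sg; nra.
    have := WB n; rewrite -[m.+1%:R]natr1; lra.
set y := \int[P]_w Y w ^+ 2.
(* With this weight the share of [U] in Cauchy-Schwarz is exactly half of the lower bound [m * e];
   the other half stays below a bound that does not depend on m. *)
pose a := 2 * (B + 1) / e.
have a0 : 0 < a by rewrite /a divr_gt0//; lra.
have B10 : B + 1 != 0 by lra.
have key m : m%:R * (e / 2) <= a * y.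
  have [U [hU _ UY U2]] := step m.
  have := Rintegral_mul_le a0 hY hU; under eq_Rintegral do rewrite mulrC.
  have ai : 0 < a^-1 by rewrite invr_gt0.
  have : a^-1 * \int[P]_w U w ^+ 2 <= a^-1 * (m%:R * (B + 1)) by rewrite ler_pM2l.
  have -> : a^-1 * (m%:R * (B + 1)) = m%:R * (e / 2).
    by rewrite /a; field; rewrite B10; lra.
  rewrite -/y => h1 h2; have := le_trans (le_trans UY (ler_norm _)) h2; lra.
have e2 : 0 < e / 2 by lra.
have [m hm] : exists m : nat, a * y / (e / 2) < m%:R.
  by exists (Num.truncn (a * y / (e / 2))).+1; exact: truncnS_gt.
have := key m; rewrite -ler_pdivlMr// leNgt hm//.
Qed.

End expectation_lemmas.

(** * Sub-sigma-fields and orthogonality *)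

Section sub_sigma_fields.
Context d {T : measurableType d} {R : realType}.
Implicit Types (H : set (set T)) (Y : T -> R).

(** Gives access to the closure properties of measurable functions, on the space whose events are
    generated by [H]; as [H] is already a sigma-algebra, generation adds no event. *)
Lemma H_measurableP H Y : sigma_algebra setT H ->
  H_measurable H Y <-> measurable_fun (setT : set (g_sigma_algebraType H)) Y.
Proof.
move=> sH; have HE : @measurable _ (g_sigma_algebraType H) = H.
  exact: sigma_algebra_id.
split=> [h _ B mB|h B mB].
  by rewrite setTI; change (<<s H>> (Y @^-1` B)); rewrite (sigma_algebra_id sH); exact: h.
by rewrite -HE -[_ @^-1` _]setTI; exact: h.
Qed.

Lemma H_measurable_measurable H Y : sub_sigma_field H -> H_measurable H Y ->
  measurable_fun setT Y.
Proof. by move=> [_ Hm] h _ B mB; rewrite setTI; apply: Hm; exact: h. Qed.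

Lemma H_measurable_sub H H' Y : H `<=` H' -> H_measurable H Y -> H_measurable H' Y.
Proof. by move=> HH' h B mB; apply: HH'; exact: h. Qed.

End sub_sigma_fields.

Section orthogonality.
Context d {T : measurableType d} {R : realType} (P : probability T R).
Variables (H : set (set T)) (V : T -> R).
Hypothesis hH : sub_sigma_field H.
Hypothesis IV : P.-integrable setT (EFin \o V).
Hypothesis V0 : forall A, H A -> \int[P]_(w in A) V w = 0.

Import HBNNSimple.
Local Notation TH := (g_sigma_algebraType H).

Let mH (A : set TH) : measurable A -> H A.
Proof. by case: hH => sH _; change (<<s H>> A -> H A); rewrite (sigma_algebra_id sH). Qed.

Lemma orthogonal_indic A : H A -> \int[P]_w (\1_A w * V w) = 0.
Proof.
move=> HA; rewrite -[RHS](V0 HA) [RHS]Rintegral_mkcond patch_indic.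
by apply: eq_Rintegral => w _ /=; rewrite mulrC.
Qed.

(** Simple functions of the coarse space increase to [Y], and [|Y V|] dominates; neither [Y] nor [V]
    has to be bounded or square-integrable. *)
Lemma orthogonal_nneg (Y : T -> R) : H_measurable H Y -> (forall w, 0 <= Y w) ->
  P.-integrable setT (EFin \o (fun w => Y w * V w)) ->
  \int[P]_w (Y w * V w) = 0.
Proof.
move=> hY Y0 IYV.
have mY : measurable_fun (setT : set TH) (EFin \o Y).
  by apply/measurable_EFinP; apply/H_measurableP => //; case: hH.
pose g := nnsfun_approx measurableT mY.
have Hsub := proj2 hH.
(* [TH] has the points of [T] but only the events of [H]; the approximants are built on it and then
   read on [T], where [P] lives. *)
pose gf n : T -> R := fun w : TH => g n w.
have mg n : measurable_fun setT (gf n).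
  apply: (@H_measurable_measurable _ _ _ H) => //.
  by apply/H_measurableP; [case: hH|exact: measurable_funPT].
have gf0 n w : 0 <= gf n w by exact: fun_ge0.
have gY n w : gf n w <= Y w.
  rewrite -lee_fin /gf nnsfun_approxE; apply: le_approx => // x _.
  by rewrite /= lee_fin.
have gc w : gf ^~ w @ \oo --> Y w.
  have := @cvg_nnsfun_approx _ TH R setT measurableT _ mY (fun x _ => Y0 x) w Logic.I.
  by move=> /fine_cvg.
have Eg n : \int[P]_w (gf n w * V w) = 0.
  under eq_Rintegral => w _ do rewrite /gf fimfunE fsbig_finite//= mulr_suml.
  have mi (r : R) : H (gf n @^-1` [set r]).
    by apply: mH; rewrite -[_ @^-1` _]setTI; exact: measurable_funPT.
  have Ii (r : R) : P.-integrable setT (EFin \o (fun w => \1_(gf n @^-1` [set r]) w * V w)).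
    apply: (@integrable_mul_bounded _ _ _ _ _ _ 1) => //.
      by apply: measurable_indic; apply: Hsub.
    by move=> w; rewrite indicE; case: (_ \in _); rewrite ?normr1 ?normr0.
  rewrite Rintegral_sum; last first.
    move=> r; under [X in EFin \o X]eq_fun do rewrite -mulrA.
    exact: integrable_scaler.
  rewrite big1_seq// => r _.
  under eq_Rintegral => w _ do rewrite -mulrA.
  by rewrite RintegralZl// orthogonal_indic// mulr0.
have cv : (fun n => \int[P]_w (gf n w * V w)) @ \oo --> \int[P]_w (Y w * V w).
  apply: (@Rintegral_dominated_cvg _ _ _ _ _ _ (fun w => `|Y w * V w|)).
  - by move=> n; apply: measurable_funM => //; exact: integrable_measurable IV.
  - exact: integrable_measurable IYV.
  - exact: integrable_norm.
  - by apply: aeW => w; apply: cvgM => //; exact: cvg_cst.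
  - by move=> n w; rewrite !normrM ler_wpM2r// ger0_norm ?gf0// ger0_norm.
by move: cv; under eq_fun do rewrite Eg; move/cvg_lim => <- //; rewrite lim_cst.
Qed.

Lemma orthogonal (Y : T -> R) : H_measurable H Y ->
  P.-integrable setT (EFin \o (fun w => Y w * V w)) ->
  \int[P]_w (Y w * V w) = 0.
Proof.
move=> hY IYV; have sH := proj1 hH.
have mYH : measurable_fun (setT : set TH) Y by apply/H_measurableP.
have mY := H_measurable_measurable hH hY.
have mV := integrable_measurable IV.
have Hp (s : bool) : H_measurable H (fun w => Num.max ((-1) ^+ s * Y w) 0).
  apply/H_measurableP => //; apply: measurable_maxr => //.
  exact: measurable_funM.
have Ip (s : bool) : P.-integrable setT (EFin \o (fun w => Num.max ((-1) ^+ s * Y w) 0 * V w)).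
  apply: (@le_integrable_real _ _ _ P _ (fun w => `|Y w * V w|)); last 2 first.
  - exact: integrable_norm.
  - move=> w /=; rewrite !normrM ler_wpM2r//.
    rewrite ger0_norm ?le_max ?lexx ?orbT// ge_max normr_ge0 andbT.
    by rewrite (le_trans (ler_norm _))// normrM normrX normrN1 expr1n mul1r.
  by apply: measurable_funM => //; exact: H_measurable_measurable (Hp s).
rewrite (_ : \int[P]_w (Y w * V w) = \int[P]_w
   (Num.max ((-1) ^+ false * Y w) 0 * V w - Num.max ((-1) ^+ true * Y w) 0 * V w)).
  have E0 (s : bool) : \int[P]_w (Num.max ((-1) ^+ s * Y w) 0 * V w) = 0.
    by apply: orthogonal_nneg => // w; rewrite le_max lexx orbT.
  by rewrite RintegralB// !E0 subrr.
apply: eq_Rintegral => w _; rewrite -mulrBl; congr (_ * _).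
rewrite expr0 expr1 mul1r mulN1r; have [h|/ltW h] := lerP 0 (Y w).
  by rewrite max_r ?oppr_le0// subr0.
by rewrite max_l ?oppr_ge0// sub0r opprK.
Qed.

End orthogonality.

(** * Cesaro means of squares *)

Section deterministic_limits.
Context {R : realType}.

Lemma cvg_inv_sqrt_nat : (fun n : nat => (Num.sqrt n%:R)^-1 : R) @ \oo --> (0 : R).
Proof.
apply/cvgr0Pnorm_lt => e e0.
exists (Num.truncn (e ^- 2)).+1 => // n /= hn.
have h1 : e ^- 2 < n%:R by apply: (lt_le_trans (truncnS_gt _)); rewrite ler_nat.
have n0 : 0 < n%:R :> R by rewrite (le_lt_trans _ h1)// invr_ge0 exprn_ge0// ltW.
rewrite ger0_norm ?invr_ge0 ?sqrtr_ge0// -[ltRHS]invrK ltf_pV2 ?posrE ?invr_gt0 ?sqrtr_gt0//.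
rewrite -(@ltr_pXn2r _ 2%N)// ?nnegrE ?sqrtr_ge0 ?invr_ge0 ?(ltW e0)//.
by rewrite sqr_sqrtr ?(ltW n0)// exprVn.
Qed.

Lemma cvg_inv_nat : (fun n : nat => (n%:R)^-1 : R) @ \oo --> (0 : R).
Proof.
rewrite [X in _ --> X](_ : 0 = 0 * 0); last by rewrite mulr0.
rewrite (_ : (fun n => _) = fun n : nat => (Num.sqrt n%:R)^-1 * (Num.sqrt n%:R)^-1).
  by apply: cvgM; exact: cvg_inv_sqrt_nat.
by apply/funext => n; rewrite -invfM -expr2 sqr_sqrtr.
Qed.

Variables (a : nat -> R) (q : R).
Hypothesis aq : (fun n => n%:R^-1 * \sum_(k < n) a k ^+ 2) @ \oo --> q.

(* A single term of a convergent Cesaro mean is negligible. *)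
Lemma cesaro_term_small (e : R) : 0 < e ->
  exists N, forall n, (N <= n)%N -> forall k, (k < n)%N -> `|a k| <= e * Num.sqrt n%:R.
Proof.
move=> e0.
pose m n := n%:R^-1 * \sum_(k < n) a k ^+ 2.
(* The recursion of the means solved for the newest term: convergence of [m] makes the right-hand
   side vanish in the limit. *)
have aS n : a n ^+ 2 / n.+1%:R = m n.+1 - m n + m n / n.+1%:R.
  rewrite /m big_ord_recr/=; case: n => [|n].
    by rewrite big_ord0 mulr0 add0r subr0 mul0r addr0 mulrC.
  set S := \sum_(k < _) _; have h1 : n.+1%:R != 0 :> R by rewrite pnatr_eq0.
  have h2 : n.+2%:R != 0 :> R by rewrite pnatr_eq0.
  have e2 : n.+2%:R = n.+1%:R + 1 :> R by rewrite natr1.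
  rewrite e2 in h2 *; move: h1 h2; move: (n.+1%:R : R) => x h1 h2.
  by field; rewrite h1 h2.
have c0 : (fun n => a n ^+ 2 / n.+1%:R) @ \oo --> 0.
  rewrite (funext aS) -[0](_ : q - q + q * 0 = 0); last by rewrite subrr mulr0 addr0.
  apply: cvgD; first by apply: cvgB => //; rewrite (cvg_shiftS m).
  by apply: cvgM => //; rewrite (cvg_shiftS (fun n : nat => (n%:R)^-1 : R)); exact: cvg_inv_nat.
have e2 : 0 < e ^+ 2 by rewrite exprn_gt0.
have [N _ hN] : \forall n \near \oo, `|a n ^+ 2 / n.+1%:R| < e ^+ 2 by move/cvgr0Pnorm_lt : c0; exact.
pose M := \sum_(k < N) a k ^+ 2.
(* The finitely many terms with k < N are bounded by their total [M], which [e ^+ 2 * n] outgrows;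
   the later ones satisfy [a k ^+ 2 < e ^+ 2 * k.+1 <= e ^+ 2 * n]. *)
exists (Num.truncn (M / e ^+ 2)).+1 => n hn k kn.
have n0 : 0 <= n%:R :> R by rewrite ler0n.
rewrite -(@ler_pXn2r _ 2%N)// ?nnegrE ?mulr_ge0 ?sqrtr_ge0 ?(ltW e0)//.
rewrite real_normK ?num_real// exprMn sqr_sqrtr//.
have [kN|Nk] := ltnP k N.
  apply: (@le_trans _ _ M).
    rewrite /M (bigD1 (Ordinal kN))//= lerDl sumr_ge0// => i _; exact: sqr_ge0.
  rewrite mulrC -ler_pdivrMr// ltW// (lt_le_trans (truncnS_gt _))//.
  by rewrite ler_nat.
have := hN k Nk; rewrite /= ger0_norm ?divr_ge0 ?sqr_ge0// ltr_pdivrMr// => /ltW h.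
by apply: (le_trans h); rewrite ler_wpM2l ?(ltW e2)// ler_nat.
Qed.

(** The sum of cubes is at most the largest scaled term, which tends to 0, times the mean of
    squares, which converges. This is the error bound of [mcleish_approx], so no separate Lindeberg
    condition is required. *)
Lemma cesaro_cubes_cvg0 :
  (fun n => \sum_(k < n) 2 * `|(Num.sqrt n%:R)^-1 * a k| ^+ 3) @ \oo --> 0.
Proof.
apply/cvgr0Pnorm_lt => e e0.
have q0 : 0 <= q.
  have := cvg_lim (@Rhausdorff R) aq => <-; apply: limr_ge; first by apply/cvg_ex; exists q.
  by apply: nearW => n; rewrite mulr_ge0 ?invr_ge0// sumr_ge0// => i _; exact: sqr_ge0.
(* The mean of squares is eventually below q + 1, and [2 * (q + 1)] times this value is below e. *)
have d0 : 0 < e / (2 * (q + 2)) by rewrite divr_gt0//; lra.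
have [N hN] := cesaro_term_small d0.
have [N' _ hN'] : \forall n \near \oo, `|q - n%:R^-1 * \sum_(k < n) a k ^+ 2| < 1.
  by move/cvgrPdist_lt : aq; apply; lra.
exists (maxn N N').+1 => // n /= hn.
have n0 : 0 < n%:R :> R by rewrite ltr0n (leq_trans _ hn).
have s0 : 0 < Num.sqrt n%:R :> R by rewrite sqrtr_gt0.
rewrite ger0_norm; last by apply: sumr_ge0 => i _; rewrite mulr_ge0// exprn_ge0.
apply: (@le_lt_trans _ _ (2 * (e / (2 * (q + 2))) * (n%:R^-1 * \sum_(k < n) a k ^+ 2))).
  rewrite !mulr_sumr; apply: ler_sum => k _.
  rewrite -mulrA ler_wpM2l//.
  have -> : `|(Num.sqrt n%:R)^-1 * a k| ^+ 3 = `|(Num.sqrt n%:R)^-1 * a k| * (n%:R^-1 * a k ^+ 2).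
    by rewrite exprS real_normK ?num_real// exprMn exprVn sqr_sqrtr// ltW.
  apply: ler_wpM2r; first by rewrite mulr_ge0 ?sqr_ge0// invr_ge0 ltW.
  rewrite normrM ger0_norm ?invr_ge0 ?(ltW s0)// mulrC ler_pdivrMr//.
  by apply: hN => //; rewrite (leq_trans _ hn)// (leq_trans (leq_maxl N N')).
have /= : `|q - n%:R^-1 * \sum_(k < n) a k ^+ 2| < 1.
  by apply: hN'; rewrite /= (leq_trans _ hn)// (leq_trans (leq_maxr N N')).
rewrite ltr_norml => /andP[h _].
have -> : 2 * (e / (2 * (q + 2))) = e / (q + 2) by field; lra.
rewrite mulrAC ltr_pdivrMr; last by lra.
by rewrite ltr_pM2l//; lra.
Qed.

End deterministic_limits.

(** * Stable martingale central limit theorem *)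

Lemma cvg_eqr (R : realType) (u u' : nat -> R) (l : R) :
  (forall n, u n = u' n) -> u' @ \oo --> l -> u @ \oo --> l.
Proof. by move/funext => ->. Qed.

Section martingale_clt.
Context d {T : measurableType d} {R : realType} (P : probability T R).
Variables (F : nat -> set (set T)) (D : nat -> T -> R).
Hypothesis hF : forall n, sub_sigma_field (F n).
Hypothesis F_incr : forall n, F n `<=` F n.+1.
Hypothesis D_adapted : forall n, H_measurable (F n.+1) (D n).
Hypothesis D_sq : forall n, sq_integrable P (D n).
Hypothesis D_centered : forall n A, F n A -> \int[P]_(w in A) D n w = 0.

Let F_mono m n : (m <= n)%N -> F m `<=` F n.
Proof.
move=> mn; rewrite -(subnK mn); elim: (n - m)%N => // k ih A /ih.
by rewrite addSn; exact: F_incr.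
Qed.

Let sF n : sigma_algebra setT (F n). Proof. exact: (proj1 (hF n)). Qed.

Let mD n : measurable_fun setT (D n). Proof. by case: (D_sq n). Qed.

Let D_orth n (Y : T -> R) : H_measurable (F n) Y -> sq_integrable P Y ->
  \int[P]_w (Y w * D n w) = 0.
Proof.
move=> hY sY; apply: (orthogonal (hF n)) => //.
- exact: sq_integrable1.
- exact: D_centered.
- exact: sq_integrable_mul.
Qed.

Let sum_adapted n : H_measurable (F n) (fun w => \sum_(k < n) D k w).
Proof.
apply/H_measurableP => //; apply: measurable_sum => k.
by apply/H_measurableP => //; apply: H_measurable_sub (D_adapted k); exact: F_mono.
Qed.

(** Orthogonality of the increments. It converts the bound on the second moment of the sum into a
    bound on the expected sum of squares, which is what dominates the stopped product. *)
Lemma martingale_sum_sq n :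
  \int[P]_w (\sum_(k < n) D k w) ^+ 2 = \int[P]_w (\sum_(k < n) D k w ^+ 2).
Proof.
elim: n => [|n ih].
  by apply: eq_Rintegral => w _; rewrite !big_ord0 expr0n.
have sS : sq_integrable P (fun w => \sum_(k < n) D k w) by exact: sq_integrable_sum.
under eq_Rintegral => w _ do rewrite big_ord_recr/= sqrrD -mulr_natl.
rewrite RintegralD//; last 2 first.
- apply: integrable_addr; first by case: sS.
  exact/integrable_scaler/sq_integrable_mul.
- by case: (D_sq n).
rewrite RintegralD//; last 2 first.
- by case: sS.
- exact/integrable_scaler/sq_integrable_mul.
rewrite RintegralZl//; last exact: sq_integrable_mul.
rewrite D_orth// mulr0 addr0 ih -RintegralD//; last 2 first.
- by apply: integrable_sumr => k; case: (D_sq k).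
- by case: (D_sq n).
by apply: eq_Rintegral => w _; rewrite big_ord_recr.
Qed.

Variable C : R.
Hypothesis C0 : 0 <= C.
Hypothesis sum_sq_le : forall n, \int[P]_w (\sum_(k < n) D k w) ^+ 2 <= n%:R * C.

(** * The stopped McLeish product on an event *)

Section stopped.
Variables (theta K : R).
Hypothesis K0 : 0 <= K.

Let x n k w : R := (Num.sqrt n%:R)^-1 * D k w.
Let Q n k w : R := \sum_(j < k) x n j w ^+ 2.
(** The indicator looks only at the increments before k, so the truncation is predictable and the
    product of the factors remains a martingale. *)
Let y n k w : R := x n k w * (Q n k w <= K)%R%:R.
Let c n k w := (mcleish theta (y n ^~ w) k).1.
Let s n k w := (mcleish theta (y n ^~ w) k).2.

Let QE n w : Q n n w = n%:R^-1 * \sum_(k < n) D k w ^+ 2.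
Proof.
rewrite /Q mulr_sumr; apply: eq_bigr => k _.
by rewrite /x exprMn exprVn sqr_sqrtr.
Qed.

Let xH n k : H_measurable (F k.+1) (x n k).
Proof. by apply/H_measurableP => //; apply: measurable_funM => //; exact/H_measurableP. Qed.

Let QH n k : H_measurable (F k) (Q n k).
Proof.
apply/H_measurableP => //; apply: measurable_sum => j.
apply: measurable_funX; apply/H_measurableP => //.
by apply: H_measurable_sub (xH n j); exact: F_mono.
Qed.

Let iH n k : H_measurable (F k) (fun w => (Q n k w <= K)%R%:R : R).
Proof.
apply/H_measurableP => //.
rewrite (_ : (fun w => _) = fun w => if Q n k w <= K then 1 else 0); last first.
  by apply/funext => w; case: (_ <= _).
apply: measurable_fun_ifT => //; apply: measurable_fun_ler => //.
exact/H_measurableP.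
Qed.

Let csH n k : H_measurable (F k) (c n k) /\ H_measurable (F k) (s n k).
Proof.
elim: k => [|k [ihc ihs]].
  by split; apply/H_measurableP => //; rewrite /c /s/=; exact: measurable_cst.
have up : forall Y : T -> R, H_measurable (F k) Y -> measurable_fun (setT : set (g_sigma_algebraType (F k.+1))) Y.
  by move=> Y h; apply/H_measurableP => //; exact: H_measurable_sub h.
have my : measurable_fun (setT : set (g_sigma_algebraType (F k.+1))) (y n k).
  by apply: measurable_funM; [exact/H_measurableP|exact: up].
have hc := up _ ihc; have hs := up _ ihs.
split; apply/H_measurableP => //; rewrite /c /s/=.
- by apply: measurable_funB; [exact: hc|apply: measurable_funM => //; exact: hs].
- by apply: measurable_funD; [exact: hs|apply: measurable_funM => //; exact: hc].
Qed.

Let mc n k : measurable_fun setT (c n k).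
Proof. by apply: (H_measurable_measurable (hF k)); case: (csH n k). Qed.

Let my n k : measurable_fun setT (y n k).
Proof.
apply: measurable_funM; first by apply: (H_measurable_measurable (hF k.+1)).
exact: (H_measurable_measurable (hF k)).
Qed.

Let cs_bound n k w : c n k w ^+ 2 + s n k w ^+ 2 <= expR K * (1 + Q n k w) /\
  (Q n k w <= K -> c n k w ^+ 2 + s n k w ^+ 2 <= expR K).
Proof. exact: (mcleish_stopped_bound theta (x n ^~ w)). Qed.

Let I_Q n k : P.-integrable setT (EFin \o Q n k).
Proof.
apply: integrable_sumr => j.
by have [] := sq_integrableZ ((Num.sqrt n%:R)^-1) (D_sq j).
Qed.

Let E_Q n : \int[P]_w Q n n w <= C.
Proof.
under eq_Rintegral => w _ do rewrite QE.
rewrite RintegralZl//; last by apply: integrable_sumr => j; case: (D_sq j).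
rewrite -martingale_sum_sq; case: n => [|n]; first by rewrite invr0 mul0r.
by rewrite mulrC ler_pdivrMr ?ltr0n// mulrC.
Qed.

Let c_sq n k : sq_integrable P (c n k).
Proof.
split; first exact: mc.
apply: (@le_integrable_real _ _ _ P _ (fun w => expR K * (1 + Q n k w))).
- exact: measurable_funX.
- by apply: integrable_scaler; apply: integrable_addr => //; exact: cst_integrable.
- move=> w; rewrite ger0_norm ?sqr_ge0//; apply: le_trans (proj1 (cs_bound n k w)).
  by rewrite lerDl sqr_ge0.
Qed.

Let E_c_sq n : \int[P]_w c n n w ^+ 2 <= expR K * (1 + C).
Proof.
apply: (@le_trans _ _ (\int[P]_w (expR K * (1 + Q n n w)))).
  apply: le_Rintegral => //; first by case: (c_sq n n).
    by apply: integrable_scaler; apply: integrable_addr => //; exact: cst_integrable.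
  move=> w _; apply: le_trans (proj1 (cs_bound n n w)).
  by rewrite lerDl sqr_ge0.
rewrite RintegralZl//; last by apply: integrable_addr => //; exact: cst_integrable.
rewrite RintegralD//; last exact: cst_integrable.
by rewrite Rintegral_bounded_cst ler_wpM2l ?expR_ge0// lerD2l.
Qed.

(* Increment of the product martingale, as a multiple of D k. *)
Let a n k w : R := - ((Num.sqrt n%:R)^-1 * ((Q n k w <= K)%R%:R * s n k w)).

Let W n w : R := c n n w - cos theta.

(** The real part can be followed alone: it is a martingale transform of [D], the imaginary part
    entering only through the predictable coefficients. *)
Let cE n k w : c n k w - cos theta = \sum_(j < k) a n j w * D j w.
Proof.
elim: k => [|k ih]; first by rewrite big_ord0 subrr.
rewrite big_ord_recr/= -ih /c/= -/(c n k w) -/(s n k w) /a /y /x; ring.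
Qed.

Let aH n k : H_measurable (F k) (a n k).
Proof.
apply/H_measurableP => //; apply: measurableT_comp => //.
apply: measurable_funM => //; apply: measurable_funM; first exact/H_measurableP.
by apply/H_measurableP => //; case: (csH n k).
Qed.

Let a_bound n k w : `|a n k w| <= (Num.sqrt n%:R)^-1 * expR K.
Proof.
rewrite normrN normrM ger0_norm ?invr_ge0// ler_wpM2l ?invr_ge0//.
have [h|h] := leP (Q n k w) K; last by rewrite mul0r normr0 expR_ge0.
(* The natural bound is the square root of [expR K]; since [expR K] is at least 1, it exceeds its
   own root. *)
have eK : 1 <= expR K by rewrite -expR0 ler_expR.
rewrite mul1r -(@ler_pXn2r _ 2%N)// ?nnegrE ?expR_ge0// real_normK ?num_real//.
apply: (@le_trans _ _ (expR K)).
  by apply: le_trans (proj2 (cs_bound n k w) h); rewrite lerDr sqr_ge0.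
by rewrite expr2 ler_peMl// expR_ge0.
Qed.

Let W_sq n : sq_integrable P (W n).
Proof.
apply: sq_integrableB; first exact: c_sq.
by apply: (@sq_integrable_bounded _ _ _ _ _ `|cos theta|).
Qed.

Let W_bounded n : \int[P]_w W n w ^+ 2 <= 2 * (expR K * (1 + C)) + 2.
Proof.
apply: (@le_trans _ _ (\int[P]_w (2 * c n n w ^+ 2 + 2))).
  apply: le_Rintegral => //.
  - by case: (W_sq n).
  - apply: integrable_addr; last exact: cst_integrable.
    by apply: integrable_scaler; case: (c_sq n n).
  - move=> w _; rewrite /W; have : cos theta ^+ 2 <= 1.
      by rewrite -(cos2Dsin2 theta) lerDl sqr_ge0.
    have := sqr_ge0 (c n n w + cos theta); nra.
have I1 : P.-integrable setT (EFin \o (fun w => c n n w ^+ 2)) by case: (c_sq n n).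
rewrite RintegralD//; [|exact: integrable_scaler|exact: cst_integrable].
by rewrite RintegralZl// Rintegral_bounded_cst lerD2r ler_wpM2l.
Qed.

(** In the expansion of [W n] the terms with index at least j vanish against [W j], which is known
    at time j. The j terms left carry a factor [(Num.sqrt n%:R)^-1], and j is fixed. *)
Let W_orth j : (fun n => \int[P]_w (W n w * W j w)) @ \oo --> 0.
Proof.
pose M := expR K * \sum_(k < j) \int[P]_w `|D k w * W j w|.
have IDW k : P.-integrable setT (EFin \o (fun w => D k w * W j w)).
  by apply: sq_integrable_mul.
have IaDW n k : P.-integrable setT (EFin \o (fun w => a n k w * (D k w * W j w))).
  apply: (@integrable_mul_bounded _ _ _ _ _ _ ((Num.sqrt n%:R)^-1 * expR K)) => //.
  by apply: (H_measurable_measurable (hF k)).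
have WE n : \int[P]_w (W n w * W j w) =
    \sum_(k < n) \int[P]_w (a n k w * (D k w * W j w)).
  rewrite -Rintegral_sum//; apply: eq_Rintegral => w _.
  by rewrite /W cE mulr_suml; apply: eq_bigr => k _; rewrite mulrA.
have W_bd n : (j <= n)%N -> `|\int[P]_w (W n w * W j w)| <= (Num.sqrt n%:R)^-1 * M.
  move=> jn; rewrite WE -(big_mkord xpredT (fun k => \int[P]_w (a n k w * (D k w * W j w)))).
  rewrite (@big_cat_nat _ _ _ j)//= [X in _ + X]big1_seq ?addr0; last first.
    move=> k; rewrite mem_index_iota => /andP[_ /andP[jk kn]].
    under eq_Rintegral => w _ do rewrite mulrCA mulrC.
    apply: D_orth.
      apply/H_measurableP => //; apply: measurable_funM; first exact/H_measurableP.
      apply: measurable_funB => //; apply/H_measurableP => //.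
      apply: H_measurable_sub (F_mono jk) _.
      by case: (csH j j).
    apply: (@sq_integrable_le _ _ _ _ _ (fun w => ((Num.sqrt n%:R)^-1 * expR K) * W j w)).
    - apply: measurable_funM; first exact: (H_measurable_measurable (hF k)).
      by case: (W_sq j).
    - exact: sq_integrableZ.
    - move=> w; rewrite !normrM ler_wpM2r// -normrM (le_trans (a_bound n k w))//.
      exact: ler_norm.
  rewrite big_mkord (le_trans (ler_norm_sum _ _ _))// /M !mulr_sumr.
  apply: ler_sum => k _; apply: (le_trans (le_normr_Rintegral _ _)) => //.
  rewrite mulrA -RintegralZl//; last exact: integrable_norm.
  apply: le_Rintegral => //; first exact: integrable_norm.
    exact/integrable_scaler/integrable_norm.
  by move=> w _; rewrite normrM ler_wpM2r.
apply/cvgr0Pnorm_lt => e e0.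
have : (fun n : nat => (Num.sqrt n%:R)^-1 * M) @ \oo --> 0.
  by rewrite -(mul0r M); apply: cvgM; [exact: cvg_inv_sqrt_nat|exact: cvg_cst].
move/cvgr0Pnorm_lt => /(_ _ e0)[N _ hN].
exists (maxn N j) => // n /= hn.
apply: (le_lt_trans (W_bd n _)); first by rewrite (leq_trans _ hn)// leq_maxr.
apply: (le_lt_trans (ler_norm _)); apply: hN => /=.
by rewrite (leq_trans _ hn)// leq_maxl.
Qed.

Variable v : T -> R.
Hypothesis mv : measurable_fun setT v.
Hypothesis v0 : forall w, 0 <= v w.
Hypothesis cv : {ae P, forall w,
  (fun n => n%:R^-1 * \sum_(k < n) D k w ^+ 2) @ \oo --> v w}.

Variable A : set T.
Hypothesis mA : measurable A.
Hypothesis AK : forall w, A w -> v w < K.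

Let S n w := cos (theta + (Num.sqrt n%:R)^-1 * \sum_(k < n) D k w).
Let Q' n w := \sum_(k < n) y n k w ^+ 2.

Let mS n : measurable_fun setT (S n).
Proof.
apply: measurableT_comp; first exact: (continuous_measurable_fun (@continuous_cos R)).
by apply: measurable_funD => //; apply: measurable_funM => //; exact: measurable_sum.
Qed.

Let mQ' n : measurable_fun setT (Q' n).
Proof. by apply: measurable_sum => k; exact: measurable_funX. Qed.

Let mE (f : T -> R) : measurable_fun setT f -> measurable_fun setT (fun w => expR (- (f w / 2))).
Proof.
move=> mf; apply: measurableT_comp => //; apply: measurableT_comp => //.
exact: measurable_funM.
Qed.

Let m1 : measurable_fun setT (\1_A : T -> R). Proof. exact: measurable_indic. Qed.

(** The strict inequality of [AK] keeps the full sum of squares below [K] for large n; the partial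
    sums are smaller still, so no factor is stopped. *)
Let eventually_unstopped w : A w ->
  (fun n => n%:R^-1 * \sum_(k < n) D k w ^+ 2) @ \oo --> v w ->
  \forall n \near \oo, (forall k, (k < n)%N -> y n k w = x n k w) /\ Q' n w = Q n n w.
Proof.
move=> Aw cw.
have : \forall n \near \oo, Q n n w < K.
  by under eq_near do rewrite QE; apply: cvgr_lt cw _ _; exact: AK.
apply: filterS => n hQ.
have yx k : (k < n)%N -> y n k w = x n k w.
  move=> kn; rewrite /y; suff -> : Q n k w <= K by rewrite mulr1.
  apply: le_trans (ltW hQ); rewrite /Q -(big_mkord xpredT (fun j => x n j w ^+ 2)).
  rewrite -(big_mkord xpredT (fun j => x n j w ^+ 2)) (@big_cat_nat _ _ _ k 0 n)//=; last exact: ltnW.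
  rewrite lerDl.
  by rewrite sumr_ge0// => j _; exact: sqr_ge0.
split => //; rewrite /Q' /Q; apply: eq_bigr => k _; rewrite yx//.
Qed.

(** The stopped product is paired with the stopped sum of squares, so the bound holds everywhere and
    not only where nothing is stopped; it supplies the dominating constant of [term1]. *)
Let factor_bound n w : `|c n n w * expR (- (Q' n w / 2))| <= 1.
Proof.
rewrite -(@ler_pXn2r _ 2%N)// ?nnegrE// real_normK ?num_real// expr1n exprMn.
have -> : expR (- (Q' n w / 2)) ^+ 2 = expR (- Q' n w).
  by rewrite expr2 -expRD; congr expR; field.
rewrite expRN ler_pdivrMr ?expR_gt0// mul1r.
apply: le_trans (mcleish_norm_le theta (y n ^~ w) n).
by rewrite lerDl sqr_ge0.
Qed.

(** Exchanges the exponential for the product, by bounded convergence: the error is almost surely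
    controlled by sums of cubes. *)
Let term1 : (fun n => \int[P]_w (\1_A w * (S n w - c n n w * expR (- (Q' n w / 2))))) @ \oo --> 0.
Proof.
rewrite -[0](_ : \int[P]_w (fun=> 0) w = 0); last exact: Rintegral_bounded_cst.
apply: (@Rintegral_bounded_cvg _ _ _ _ _ _ 2).
- move=> n; apply: measurable_funM => //; apply: measurable_funB => //.
  by apply: measurable_funM => //; exact: mE.
- exact: measurable_cst.
- apply: filterS cv => w cw; rewrite indicE; case: (boolP (w \in A)) => wA; last first.
    by under eq_fun do rewrite mul0r; exact: cvg_cst.
  under eq_fun do rewrite mul1r.
  apply/cvgr0Pnorm_lt => e e0.
  have cub := @cesaro_cubes_cvg0 R (fun k => D k w) (v w) cw.
  move/cvgr0Pnorm_lt : cub => /(_ _ e0) cub.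
  have := eventually_unstopped (set_mem wA) cw.
  apply: filterS2 cub => n cub [yx _].
  apply: le_lt_trans cub; rewrite [leRHS]ger0_norm; last first.
    by apply: sumr_ge0 => i _; rewrite mulr_ge0// exprn_ge0.
  have := mcleish_approx theta (y n ^~ w) n => /=.
  have -> : \sum_(k < n) y n k w = (Num.sqrt n%:R)^-1 * \sum_(k < n) D k w.
    by rewrite mulr_sumr; apply: eq_bigr => k _; rewrite yx.
  have -> : \sum_(k < n) 2 * `|y n k w| ^+ 3 = \sum_(k < n) 2 * `|(Num.sqrt n%:R)^-1 * D k w| ^+ 3.
    by apply: eq_bigr => k _; rewrite yx.
  rewrite -/(Q' n w) -/(c n n w) -/(S n w) => h.
  have s0 : 0 <= \sum_(k < n) 2 * `|(Num.sqrt n%:R)^-1 * D k w| ^+ 3.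
    by apply: sumr_ge0 => i _; rewrite mulr_ge0// exprn_ge0.
  rewrite distrC -(@ler_pXn2r _ 2%N)// ?nnegrE// real_normK ?num_real//.
  by apply: le_trans h; rewrite lerDl sqr_ge0.
- move=> n w; rewrite -[leRHS]mul1r normrM ler_pM//.
    by rewrite indicE; case: (_ \in _); rewrite ?normr1 ?normr0.
  apply: (le_trans (ler_normB _ _)).
  by have := cos_max (theta + (Num.sqrt n%:R)^-1 * \sum_(k < n) D k w); have := factor_bound n w; rewrite /S; lra.
Qed.

(** Exchanges the random exponent [Q'] for its limit [v]. The product is bounded only in L^2, so the
    other factor has to tend to 0 in L^2. *)
Let term2 : (fun n => \int[P]_w (c n n w *
  (\1_A w * (expR (- (Q' n w / 2)) - expR (- (v w / 2)))))) @ \oo --> 0.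
Proof.
pose g n w := \1_A w * (expR (- (Q' n w / 2)) - expR (- (v w / 2))).
have mg n : measurable_fun setT (g n).
  by apply: measurable_funM => //; apply: measurable_funB; exact: mE.
have e1 (q : R) : 0 <= q -> 0 <= expR (- (q / 2)) <= 1.
  by move=> q0; rewrite expR_ge0 expR_le1 oppr_le0 divr_ge0.
have Q'0 n w : 0 <= Q' n w by apply: sumr_ge0 => k _; exact: sqr_ge0.
have g1 n w : `|g n w| <= 1.
  rewrite /g indicE; case: (_ \in _); rewrite ?mul0r ?mul1r ?normr0//.
  have /andP[? ?] := e1 _ (Q'0 n w); have /andP[? ?] := e1 _ (v0 w).
  by rewrite ler_norml; apply/andP; split; lra.
have gs n : sq_integrable P (g n) by exact: sq_integrable_bounded (mg n) (g1 n).
have g0 : (fun n => \int[P]_w g n w ^+ 2) @ \oo --> 0.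
  rewrite -[0](_ : \int[P]_w (fun=> 0) w = 0); last exact: Rintegral_bounded_cst.
  apply: (@Rintegral_bounded_cvg _ _ _ _ _ _ 1).
  - by move=> n; exact: measurable_funX.
  - exact: measurable_cst.
  - apply: filterS cv => w cw.
    suff : g ^~ w @ \oo --> 0.
      move=> h; rewrite -[0](_ : 0 * 0 = 0); last exact: mulr0.
      by under eq_fun do rewrite expr2; exact: cvgM.
    rewrite /g indicE; case: (boolP (w \in A)) => wA; last first.
      by under eq_fun do rewrite mul0r; exact: cvg_cst.
    under eq_fun do rewrite mul1r.
    rewrite -[0](subrr (expR (- (v w / 2)))); apply: cvgB; last exact: cvg_cst.
    apply: (@continuous_cvg _ _ _ _ _ (fun n => - (Q' n w / 2)) expR); first exact: continuous_expR.
    apply: cvgN; apply: cvgM; last exact: cvg_cst.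
    apply: cvg_trans (cw); apply: near_eq_cvg.
    apply: filterS (eventually_unstopped (set_mem wA) cw) => n [_ ->].
    by rewrite QE.
  - move=> n w; rewrite normrX exprn_ile1//.
apply/cvgr0Pnorm_lt => e e0.
have B0 : 0 <= expR K * (1 + C) by rewrite mulr_ge0 ?expR_ge0// addr_ge0.
(* Weight for [Rintegral_mul_le]: the term of [c] stays below e / 2, and that of [g] does too once
   its squared norm is below [b * (e / 2)]. *)
pose b := e / (2 * (expR K * (1 + C) + 1)).
have b0 : 0 < b by rewrite divr_gt0//; lra.
have eb : 0 < b * (e / 2) by rewrite mulr_gt0// divr_gt0.
move/cvgr0Pnorm_lt : g0 => /(_ _ eb); apply: filterS => n hg.
apply: (le_lt_trans (Rintegral_mul_le b0 (c_sq n n) (gs n))).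
have h1 : b * \int[P]_w c n n w ^+ 2 <= b * (expR K * (1 + C)).
  by rewrite ler_pM2l.
have h2 : b * (expR K * (1 + C)) + b = e / 2 by rewrite /b; field; lra.
have h3 : b^-1 * \int[P]_w g n w ^+ 2 < e / 2.
  rewrite mulrC ltr_pdivrMr// mulrC; apply: le_lt_trans hg; exact: ler_norm.
lra.
Qed.

(** Exchanges the product for its constant expectation. Neither [A] nor [v] has to be known at any
    finite time, so the martingale property alone does not suffice and weak nullness takes over. *)
Let term3 : (fun n => \int[P]_w (W n w * (\1_A w * expR (- (v w / 2))))) @ \oo --> 0.
Proof.
apply: (weakly_null W_sq W_bounded W_orth).
apply: (@sq_integrable_bounded _ _ _ _ _ 1).
  by apply: measurable_funM => //; exact: mE.
move=> w; rewrite indicE; case: (_ \in _); rewrite ?mul0r ?mul1r ?normr0//.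
by rewrite ger0_norm ?expR_ge0// expR_le1 oppr_le0 divr_ge0.
Qed.

(** The three exchanges telescope pointwise to the integrand. *)
Lemma martingale_clt_localized :
  (fun n => \int[P]_w (\1_A w * (S n w - cos theta * expR (- (v w / 2))))) @ \oo --> 0.
Proof.
have e1 (q : R) : 0 <= q -> 0 <= expR (- (q / 2)) <= 1.
  by move=> q0; rewrite expR_ge0 expR_le1 oppr_le0 divr_ge0.
have Q'0 n w : 0 <= Q' n w by apply: sumr_ge0 => k _; exact: sqr_ge0.
have mEv := mE mv.
have H := cvgD (cvgD term1 term2) term3; rewrite !addr0 in H; apply: cvg_eqr (H _ _) => n /=.
have Ic : P.-integrable setT (EFin \o c n n) by exact: sq_integrable1.
have I1 (f : T -> R) : P.-integrable setT (EFin \o f) ->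
    P.-integrable setT (EFin \o (fun w => \1_A w * f w)).
  apply: (@integrable_mul_bounded _ _ _ _ _ _ 1) => // w.
  by rewrite indicE; case: (_ \in _); rewrite ?normr1 ?normr0.
have IE (f : T -> R) (q : T -> R) : measurable_fun setT q -> (forall w, 0 <= q w) ->
    P.-integrable setT (EFin \o f) ->
    P.-integrable setT (EFin \o (fun w => f w * expR (- (q w / 2)))).
  move=> mq q0 If; under eq_fun do rewrite mulrC.
  apply: (@integrable_mul_bounded _ _ _ _ _ _ 1) => //; first exact: mE.
  by move=> w; rewrite ger0_norm ?expR_ge0//; case/andP: (e1 _ (q0 w)).
have IS : P.-integrable setT (EFin \o S n).
  by apply: (@bounded_integrable _ _ _ _ _ 1) => // w; exact: cos_max.
have J1 : P.-integrable setT (EFin \o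
    (fun w => \1_A w * (S n w - c n n w * expR (- (Q' n w / 2))))).
  by apply: I1; apply: integrable_subr => //; exact: IE.
have J2 : P.-integrable setT (EFin \o
    (fun w => c n n w * (\1_A w * (expR (- (Q' n w / 2)) - expR (- (v w / 2)))))).
  rewrite (_ : (fun w => _) = (fun w => \1_A w * (c n n w * expR (- (Q' n w / 2)))
     - \1_A w * (c n n w * expR (- (v w / 2))))); last by apply/funext => w; ring.
  by apply: integrable_subr; apply: I1; exact: IE.
have J3 : P.-integrable setT (EFin \o (fun w => W n w * (\1_A w * expR (- (v w / 2))))).
  rewrite (_ : (fun w => _) = (fun w => \1_A w * (W n w * expR (- (v w / 2))))); last first.
    by apply/funext => w; ring.
  by apply: I1; apply: IE => //; exact: sq_integrable1.
rewrite !fctE -RintegralD// -RintegralD//; last exact: integrable_addr.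
by apply: eq_Rintegral => w _; rewrite /W; ring.
Qed.

End stopped.

(** Removes the localization: on [v < m] the stopping level m is admissible, and since [v] is finite
    the rest has small probability, while the integrand is bounded by 2. *)
Theorem martingale_clt (theta : R) (v : T -> R) (A : set T) :
  measurable_fun setT v -> (forall w, 0 <= v w) ->
  {ae P, forall w, (fun n => n%:R^-1 * \sum_(k < n) D k w ^+ 2) @ \oo --> v w} ->
  measurable A ->
  (fun n => \int[P]_w (\1_A w * cos (theta + (Num.sqrt n%:R)^-1 * \sum_(k < n) D k w))) @ \oo -->
  \int[P]_w (\1_A w * (cos theta * expR (- (v w / 2)))).
Proof.
move=> mv v0 cv mA.
pose S n w := cos (theta + (Num.sqrt n%:R)^-1 * \sum_(k < n) D k w).
pose L w := cos theta * expR (- (v w / 2)).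
have mS n : measurable_fun setT (S n).
  apply: measurableT_comp; first exact: (continuous_measurable_fun (@continuous_cos R)).
  by apply: measurable_funD => //; apply: measurable_funM => //; exact: measurable_sum.
have mL : measurable_fun setT L.
  apply: measurable_funM => //; apply: measurableT_comp => //; apply: measurableT_comp => //.
  exact: measurable_funM.
have L1 w : `|L w| <= 1.
  rewrite normrM -[1]mulr1 ler_pM ?cos_max// ger0_norm ?expR_ge0//.
  by rewrite expR_le1 oppr_le0 divr_ge0.
have S1 n w : `|S n w| <= 1 by exact: cos_max.
have mI (B : set T) : measurable B -> measurable_fun setT (\1_B : T -> R) by exact: measurable_indic.
have I1 (B : set T) (w : T) : `|\1_B w : R| <= 1.
  by rewrite indicE; case: (_ \in _); rewrite ?normr1 ?normr0.
have SL2 n w : `|S n w - L w| <= 2.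
  by apply: (le_trans (ler_normB _ _)); have := S1 n w; have := L1 w; lra.
have ISL (B : set T) n : measurable B -> P.-integrable setT (EFin \o (fun w => \1_B w * (S n w - L w))).
  move=> mB; apply: (@bounded_integrable _ _ _ _ _ (1 * 2)).
    by apply: measurable_funM; [exact: mI|exact: measurable_funB].
  by move=> w; rewrite normrM ler_pM.
pose Bk (m : nat) := [set w | v w < m%:R].
have mB m : measurable (Bk m).
  rewrite (_ : Bk m = setT `&` (fun w => v w < (cst m%:R : T -> R) w) @^-1` [set true]).
    by apply: (measurable_fun_ltr mv (measurable_cst _)).
  by rewrite setTI.
have tail : (fun m => \int[P]_w \1_(~` Bk m) w) @ \oo --> 0.
  rewrite -[0](_ : \int[P]_w (fun=> 0) w = 0); last exact: Rintegral_bounded_cst.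
  apply: (@Rintegral_bounded_cvg _ _ _ _ _ _ 1).
  - by move=> m; apply: mI; exact: measurableC.
  - exact: measurable_cst.
  - apply: aeW => w; apply: cvg_near_cst; exists (Num.truncn (v w)).+1 => // m /= hm.
    rewrite indicE memNset//= /Bk /=; apply; rewrite (lt_le_trans (truncnS_gt _))// ler_nat//.
  - by move=> m w; exact: I1.
suff c0 : (fun n => \int[P]_w (\1_A w * (S n w - L w))) @ \oo --> 0.
  have IL : P.-integrable setT (EFin \o (fun w => \1_A w * L w)).
    apply: (@bounded_integrable _ _ _ _ _ (1 * 1)); first by apply: measurable_funM => //; exact: mI.
    by move=> w; rewrite normrM ler_pM.
  have H : (fun n => \int[P]_w (\1_A w * (S n w - L w)) + \int[P]_w (\1_A w * L w)) @ \oo -->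
      0 + \int[P]_w (\1_A w * L w) by apply: cvgD => //; exact: cvg_cst.
  rewrite add0r in H; apply: cvg_eqr H => n /=.
  rewrite -RintegralD//; last exact: ISL.
  by apply: eq_Rintegral => w _; rewrite /S; ring.
apply/cvgr0Pnorm_lt => e e0.
have e4 : 0 < e / 4 by lra.
move/cvgr0Pnorm_lt : tail => /(_ _ e4)[m _ /(_ m (leqnn m)) hm].
have /cvgr0Pnorm_lt := @martingale_clt_localized theta m%:R (ler0n _ _) v mv v0 cv (A `&` Bk m)
  (measurableI _ _ mA (mB m)) (fun w h => proj2 h).
have e2 : 0 < e / 2 by lra.
move=> /(_ _ e2); apply: filterS => n hn.
have -> : \int[P]_w (\1_A w * (S n w - L w)) =
   \int[P]_w (\1_(A `&` Bk m) w * (S n w - L w)) + \int[P]_w (\1_(A `&` ~` Bk m) w * (S n w - L w)).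
  rewrite -RintegralD//; [|by apply: ISL; exact: measurableI
     |by apply: ISL; apply: measurableI => //; exact: measurableC].
  apply: eq_Rintegral => w _; rewrite -mulrDl; congr (_ * _).
  rewrite !indicE !in_setI in_setC; case: (w \in A) => //=; last by rewrite addr0.
  by case: (w \in Bk m); rewrite /= ?addr0 ?add0r.
apply: (le_lt_trans (ler_normD _ _)).
have mAB : measurable (A `&` ~` Bk m) by apply: measurableI => //; exact: measurableC.
have : `|\int[P]_w (\1_(A `&` ~` Bk m) w * (S n w - L w))| <= 2 * \int[P]_w \1_(~` Bk m) w.
  apply: (le_trans (le_normr_Rintegral _ (ISL _ n mAB))) => //.
  have Ii : P.-integrable setT (EFin \o (\1_(~` Bk m) : T -> R)).
    by apply: (@bounded_integrable _ _ _ _ _ 1); [apply: mI; exact: measurableC|exact: I1].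
  rewrite -RintegralZl//; apply: le_Rintegral => //.
  - exact/integrable_norm/ISL.
  - exact: integrable_scaler.
  - move=> w _; rewrite normrM mulrC ler_pM//.
    rewrite !indicE in_setI; case: (w \in A) => //=; last by rewrite normr0.
    by case: (_ \in _); rewrite ?normr1 ?normr0.
have := le_lt_trans (ler_norm _) hm => /= h1 h2.
move: hn; rewrite -/(S n) /= => h3.
have : `|\int[P]_w (\1_(A `&` Bk m) w * (S n w - L w))| < e / 2 by exact: h3.
lra.
Qed.

End martingale_clt.

(** * Trigonometric polynomials and bumps on R^I *)

Section trigonometric_polynomials.
Context {I : Type} {R : realType}.
Implicit Types (f g h p : (I -> R) -> R) (y : I -> R).

(** The phase makes sines a special case, so the generators are exactly the functions whose limits
    the martingale theorem gives. Products need no constructor, by the product-to-sum formula. *)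
Inductive trig_poly : ((I -> R) -> R) -> Prop :=
| trig_cos (s : seq (I * R)) (theta : R) :
    trig_poly (fun y => cos (theta + \sum_(q <- s) q.2 * y q.1))
| trig_add f g : trig_poly f -> trig_poly g -> trig_poly (fun y => f y + g y)
| trig_scale c f : trig_poly f -> trig_poly (fun y => c * f y).

Lemma trig_cst c : trig_poly (fun=> c).
Proof.
have := trig_scale c (trig_cos [::] 0); congr trig_poly.
by apply/funext => y; rewrite big_nil addr0 cos0 mulr1.
Qed.

Lemma trig_mul f g : trig_poly f -> trig_poly g -> trig_poly (fun y => f y * g y).
Proof.
move=> hf hg; elim: hf => [s t|f1 f2 _ h1 _ h2|c f1 _ h1]; last 2 first.
- by have := trig_add h1 h2; congr trig_poly; apply/funext => y; rewrite mulrDl.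
- by have := trig_scale c h1; congr trig_poly; apply/funext => y; rewrite mulrA.
elim: hg => [s' t'|f1 f2 _ h1 _ h2|c f1 _ h1]; last 2 first.
- by have := trig_add h1 h2; congr trig_poly; apply/funext => y; rewrite mulrDr.
- by have := trig_scale c h1; congr trig_poly; apply/funext => y; rewrite mulrCA.
have := trig_scale (1 / 2) (trig_add (trig_cos (s ++ s') (t + t'))
  (trig_cos (s ++ [seq (q.1, - q.2) | q <- s']) (t - t'))).
congr trig_poly; apply/funext => y; rewrite !big_cat/= big_map/=.
set a := \sum_(q <- s) _; set b := \sum_(q <- s') _.
have -> : \sum_(q <- s') - q.2 * y q.1 = - b.
  by rewrite -sumrN; apply: eq_bigr => q _; rewrite mulNr.
have -> : t + t' + (a + b) = (t + a) + (t' + b) by ring.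
have -> : t - t' + (a - b) = (t + a) - (t' + b) by ring.
by rewrite cosD cosB; field.
Qed.

Lemma trig_sin (i : I) (c theta : R) : trig_poly (fun y => sin (theta + c * y i)).
Proof.
have := trig_cos [:: (i, c)] (theta - pi / 2); congr trig_poly; apply/funext => y.
by rewrite big_seq1 -[in RHS]cosBpihalf addrAC.
Qed.

Lemma trig_bounded f : trig_poly f -> exists B, forall y, `|f y| <= B.
Proof.
elim=> [s t|f1 f2 _ [B1 h1] _ [B2 h2]|c f1 _ [B h]].
- by exists 1 => y; exact: cos_max.
- by exists (B1 + B2) => y; rewrite (le_trans (ler_normD _ _))// lerD.
- by exists (`|c| * B) => y; rewrite normrM ler_wpM2l.
Qed.

(** Uniform closure on all of R^I. It is a lattice, by the absolute-value step of the
    Stone-Weierstrass theorem. *)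
Definition trig_limit f :=
  forall e : R, 0 < e -> exists2 p, trig_poly p & forall y, `|f y - p y| <= e.

Lemma trig_limit_poly f : trig_poly f -> trig_limit f.
Proof. by move=> hf e e0; exists f => // y; rewrite subrr normr0 ltW. Qed.

Lemma trig_limit_closed f :
  (forall e : R, 0 < e -> exists2 g, trig_limit g & forall y, `|f y - g y| <= e) ->
  trig_limit f.
Proof.
move=> h e e0; have e2 : 0 < e / 2 by lra.
have [g hg fg] := h _ e2; have [p hp gp] := hg _ e2.
exists p => // y; rewrite (_ : f y - p y = (f y - g y) + (g y - p y)); last by ring.
by rewrite (le_trans (ler_normD _ _))//; have := fg y; have := gp y; lra.
Qed.

Lemma trig_limit_add f g : trig_limit f -> trig_limit g -> trig_limit (fun y => f y + g y).
Proof.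
move=> hf hg e e0; have e2 : 0 < e / 2 by lra.
have [p hp fp] := hf _ e2; have [q hq gq] := hg _ e2.
exists (fun y => p y + q y); first exact: trig_add.
move=> y; rewrite (_ : _ - _ = (f y - p y) + (g y - q y)); last by ring.
by rewrite (le_trans (ler_normD _ _))//; have := fp y; have := gq y; lra.
Qed.

Lemma trig_limit_scale c f : trig_limit f -> trig_limit (fun y => c * f y).
Proof.
move=> hf e e0; have e2 : 0 < e / (`|c| + 1) by rewrite divr_gt0// ltr_wpDl.
have [p hp fp] := hf _ e2.
exists (fun y => c * p y); first exact: trig_scale.
move=> y; rewrite -mulrBr normrM.
apply: (@le_trans _ _ ((`|c| + 1) * (e / (`|c| + 1)))).
  by rewrite ler_pM// lerDl.
by rewrite mulrC divfK// gt_eqF// ltr_wpDl.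
Qed.

Lemma trig_limit_sub f g : trig_limit f -> trig_limit g -> trig_limit (fun y => f y - g y).
Proof.
move=> hf hg; have := trig_limit_add hf (trig_limit_scale (-1) hg).
by congr trig_limit; apply/funext => y; rewrite mulN1r.
Qed.

Lemma trig_limit_bounded f : trig_limit f -> exists B, forall y, `|f y| <= B.
Proof.
move=> /(_ 1 ltr01)[p /trig_bounded[B hB] fp]; exists (1 + B) => y.
rewrite -(subrK (p y) (f y)) (le_trans (ler_normD _ _))// lerD//.
Qed.

Lemma trig_limit_mul f g : trig_limit f -> trig_limit g -> trig_limit (fun y => f y * g y).
Proof.
move=> hf hg; apply: trig_limit_closed => e e0.
have [Bf hBf] := trig_limit_bounded hf.
have B0 : 0 <= Bf by apply: le_trans (hBf (fun=> 0)).
have e1 : 0 < e / 2 / (Bf + 1) by rewrite !divr_gt0//; lra.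
have [q hq gq] := hg _ e1.
have [Bq hBq] := trig_bounded hq.
have Bq0 : 0 <= Bq by apply: le_trans (hBq (fun=> 0)).
have e2 : 0 < e / 2 / (Bq + 1) by rewrite !divr_gt0//; lra.
have [p hp fp] := hf _ e2.
exists (fun y => p y * q y); first exact/trig_limit_poly/trig_mul.
move=> y; rewrite (_ : _ - _ = f y * (g y - q y) + (f y - p y) * q y); last by ring.
rewrite (le_trans (ler_normD _ _))// !normrM.
have h1 : `|f y| * `|g y - q y| <= (Bf + 1) * (e / 2 / (Bf + 1)).
  by rewrite ler_pM//; have := hBf y; lra.
have h2 : `|f y - p y| * `|q y| <= (e / 2 / (Bq + 1)) * (Bq + 1).
  by rewrite ler_pM//; have := hBq y; lra.
have E1 : (Bf + 1) * (e / 2 / (Bf + 1)) = e / 2 by field; lra.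
have E2 : (e / 2 / (Bq + 1)) * (Bq + 1) = e / 2 by field; lra.
move: h1 h2; rewrite E1 E2; lra.
Qed.

(* Newton-like iteration r + (x^2 - r^2)/2, increasing to |x| on [-1, 1]. *)
Fixpoint abs_iter (x : R) (n : nat) : R :=
  if n is k.+1 then abs_iter x k + (x ^+ 2 - abs_iter x k ^+ 2) / 2 else 0.

(** With a = |x| and e = a - r, the next error is e (1 - (a + r) / 2), at most e (1 - e / 2); errors
    obeying this recursion decay like 2 / n. *)
Lemma abs_iter_bound (x : R) n : `|x| <= 1 ->
  0 <= abs_iter x n <= `|x| /\ (`|x| - abs_iter x n) * n.+1%:R <= 2.
Proof.
move=> x1; have x0 := normr_ge0 x.
elim: n => [|n [/andP[ih0 ih1] ih2]].
  by rewrite /= lexx x0 subr0 mulr1; split => //; lra.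
rewrite /= -[x ^+ 2]real_normK ?num_real//.
have e2 : n.+2%:R = n.+1%:R + 1 :> R by rewrite natr1.
have c1 : 1 <= n.+1%:R :> R by rewrite ler1n.
rewrite e2; move: ih0 ih1 ih2 c1.
move: (abs_iter x n) (n.+1%:R : R) (`|x|) x0 x1 => r c a a0 a1 r0 ra ec c1.
have -> : r + (a ^+ 2 - r ^+ 2) / 2 = r + (a - r) * (a + r) / 2 by field.
split; first by apply/andP; split; nra.
set e := a - r in ec *; have e0 : 0 <= e by rewrite /e; lra.
have -> : (a - (r + e * (a + r) / 2)) * (c + 1) = e * (2 - (a + r)) * (c + 1) / 2.
  by rewrite /e; field.
have : e * (2 - (a + r)) <= e * (2 - e) by apply: ler_wpM2l => //; rewrite /e; lra.
have : e <= 1 by rewrite /e; lra.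
have : e * c * (2 - e) <= 2 * (2 - e) by apply: ler_wpM2r => //; rewrite /e; lra.
nra.
Qed.

Lemma trig_limit_abs f : trig_limit f -> trig_limit (fun y => `|f y|).
Proof.
move=> hf; have [B hB] := trig_limit_bounded hf.
have B0 : 0 <= B by apply: le_trans (hB (fun=> 0)).
pose M := B + 1; have M0 : 0 < M by rewrite /M; lra.
have Mi : 0 <= M^-1 by rewrite invr_ge0 ltW.
pose u y := M^-1 * f y.
have hu : trig_limit u by exact: trig_limit_scale.
have u1 y : `|u y| <= 1.
  rewrite /u normrM ger0_norm// mulrC ler_pdivrMr// mul1r /M.
  by have := hB y; lra.
have hit n : trig_limit (fun y => abs_iter (u y) n).
  elim: n => [|n ih]; first exact/trig_limit_poly/trig_cst.
  have := trig_limit_add ih (trig_limit_scale (1 / 2)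
    (trig_limit_sub (trig_limit_mul hu hu) (trig_limit_mul ih ih))).
  by congr trig_limit; apply/funext => y /=; field.
suff : trig_limit (fun y => `|u y|).
  move/(trig_limit_scale M); congr trig_limit; apply/funext => y.
  rewrite /u normrM (ger0_norm Mi).
  by rewrite mulVKf// gt_eqF.
apply: trig_limit_closed => e e0.
pose n := (Num.truncn (2 / e)).+1.
have hn : 2 / e < n%:R by exact: truncnS_gt.
exists (fun y => abs_iter (u y) n) => // y.
have [/andP[h0 h1] h2] := abs_iter_bound n (u1 y).
rewrite ger0_norm; last by rewrite subr_ge0.
have nn : 0 < n.+1%:R :> R by rewrite ltr0n.
rewrite -(ler_pM2r nn); apply: (le_trans h2).
rewrite -ler_pdivrMl// mulrC; apply: (le_trans (ltW hn)).
by rewrite ler_nat.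
Qed.

Lemma min_absE (a b : R) : Num.min a b = (a + b - `|a - b|) / 2.
Proof.
by have [h|h] := lerP a b; lra.
Qed.

Lemma max_absE (a b : R) : Num.max a b = (a + b + `|a - b|) / 2.
Proof.
by have [h|h] := lerP a b; lra.
Qed.

Lemma trig_limit_min f g : trig_limit f -> trig_limit g ->
  trig_limit (fun y => Num.min (f y) (g y)).
Proof.
move=> hf hg; have := trig_limit_scale (1 / 2) (trig_limit_sub (trig_limit_add hf hg)
  (trig_limit_abs (trig_limit_sub hf hg))).
by congr trig_limit; apply/funext => y; rewrite min_absE; field.
Qed.

(* Boundedly approximable on finite-dimensional boxes: unlike [trig_limit], this class contains
   functions that are not almost periodic. *)
Definition box_limit h (B : R) (F : seq I) :=
  (forall y, `|h y| <= B) /\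
  forall e L : R, 0 < e -> 0 < L -> exists p, [/\ trig_limit p, forall y, `|p y| <= B &
    forall y, (forall i, List.In i F -> `|y i| <= L) -> `|h y - p y| <= e].

Definition box_approximable h := exists B F, box_limit h B F.

Lemma box_approximable_cst c : box_approximable (fun=> c).
Proof.
exists `|c|, [::]; split => // e L e0 L0; exists (fun=> c); split => //.
  exact/trig_limit_poly/trig_cst.
by move=> y _; rewrite subrr normr0 ltW.
Qed.

Lemma box_approximable_add f g : box_approximable f -> box_approximable g ->
  box_approximable (fun y => f y + g y).
Proof.
move=> [B [F [fB hf]]] [B' [F' [gB hg]]]; exists (B + B'), (F ++ F'); split.
  by move=> y; rewrite (le_trans (ler_normD _ _))// lerD.
move=> e L e0 L0; have e2 : 0 < e / 2 by lra.
have [p [hp pB fp]] := hf _ _ e2 L0; have [q [hq qB gq]] := hg _ _ e2 L0.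
exists (fun y => p y + q y); split; first exact: trig_limit_add.
  by move=> y; rewrite (le_trans (ler_normD _ _))// lerD.
move=> y yL; rewrite (_ : _ - _ = (f y - p y) + (g y - q y)); last by ring.
rewrite (le_trans (ler_normD _ _))//.
have h1 : `|f y - p y| <= e / 2.
  by apply: fp => i iF; apply: yL; apply: List.in_or_app; left.
have h2 : `|g y - q y| <= e / 2.
  by apply: gq => i iF; apply: yL; apply: List.in_or_app; right.
lra.
Qed.

Lemma box_approximable_scale c f : box_approximable f -> box_approximable (fun y => c * f y).
Proof.
move=> [B [F [fB hf]]]; exists (`|c| * B), F; split.
  by move=> y; rewrite normrM ler_wpM2l.
move=> e L e0 L0; have e2 : 0 < e / (`|c| + 1) by rewrite divr_gt0// ltr_wpDl.
have [p [hp pB fp]] := hf _ _ e2 L0.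
exists (fun y => c * p y); split; first exact: trig_limit_scale.
  by move=> y; rewrite normrM ler_wpM2l.
move=> y yL; rewrite -mulrBr normrM.
apply: (@le_trans _ _ ((`|c| + 1) * (e / (`|c| + 1)))).
  by rewrite ler_pM// ?lerDl//; exact: fp.
by rewrite mulrC divfK// gt_eqF// ltr_wpDl.
Qed.

Lemma box_approximable_abs f : box_approximable f -> box_approximable (fun y => `|f y|).
Proof.
move=> [B [F [fB hf]]]; exists B, F; split; first by move=> y; rewrite normr_id.
move=> e L e0 L0; have [p [hp pB fp]] := hf _ _ e0 L0.
exists (fun y => `|p y|); split; first exact: trig_limit_abs.
  by move=> y; rewrite normr_id.
by move=> y yL; rewrite (le_trans (ler_dist_dist _ _))//; exact: fp.
Qed.

Lemma box_approximable_max f g : box_approximable f -> box_approximable g ->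
  box_approximable (fun y => Num.max (f y) (g y)).
Proof.
move=> hf hg; have := box_approximable_scale (1 / 2) (box_approximable_add
  (box_approximable_add hf hg) (box_approximable_abs (box_approximable_add hf
  (box_approximable_scale (-1) hg)))).
by congr box_approximable; apply/funext => y; rewrite max_absE mulN1r; field.
Qed.

(** On a box, t is close to [K * sin (t / K)] for large [K]; the minimum with 1 keeps the
    approximant bounded by 1 off the box, uniformly in [K]. *)
Lemma box_approximable_dist (i : I) (q : R) :
  box_approximable (fun y => Num.min 1 `|y i - q|).
Proof.
have min1 (t : R) : `|Num.min 1 `|t| | <= 1.
  by rewrite ger0_norm ?le_min ?ler01 ?normr_ge0// ge_min lexx.
exists 1, [:: i]; split=> [y//|e L e0 L0].
pose U := L + `|q|; have U0 : 0 < U by rewrite ltr_wpDr.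
(* The cubic error on the box is at most [U ^+ 3 / (2 * K ^+ 2)]; this value gives [U ^+ 3 <= e * K]
   with [K >= 1]. *)
pose K := 1 + U ^+ 3 / e.
have K1 : 1 <= K by rewrite lerDl divr_ge0 ?exprn_ge0// ltW.
have K0 : 0 < K by lra.
have KU : U ^+ 3 <= e * K.
  by rewrite /K mulrDr mulr1 [e * _]mulrC divfK ?gt_eqF// lerDr ltW.
exists (fun y => Num.min 1 `|K * sin (- q / K + K^-1 * y i)|); split.
- apply: trig_limit_min; first exact/trig_limit_poly/trig_cst.
  exact/trig_limit_abs/trig_limit_scale/trig_limit_poly/trig_sin.
- by move=> y.
- move=> y /(_ i (or_introl erefl)) yL.
  have -> : - q / K + K^-1 * y i = (y i - q) / K by field; lra.
  have uU : `|y i - q| <= U by rewrite (le_trans (ler_normB _ _))// lerD2r.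
  have minL (a b : R) : `|Num.min 1 `|a| - Num.min 1 `|b| | <= `|b - a|.
    rewrite (distrC b); have := ler_dist_dist a b; move: (`|a - b|) => D.
    rewrite !ler_norml => /andP[h1 h2]; apply/andP.
    move: h1 h2; set u := Num.norm a; set v := Num.norm b => h1 h2.
    by have [ha|ha] := leP 1 u; have [hb|hb] := leP 1 v; split; lra.
  apply: (le_trans (minL _ _)).
  set t := y i - q in uU *.
  have -> : K * sin (t / K) - t = K * (sin (t / K) - t / K) by field; lra.
  rewrite normrM (gtr0_norm K0).
  apply: (@le_trans _ _ (K * (`|t / K| ^+ 3 / 2))).
    by rewrite ler_wpM2l ?(ltW K0)//; exact: sin_cubic_bound.
  rewrite normrM normfV (gtr0_norm K0).
  rewrite (_ : K * ((`|t| / K) ^+ 3 / 2) = `|t| ^+ 3 / (2 * K ^+ 2)); last by field; lra.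
  have K2 : 0 < 2 * K ^+ 2 by rewrite mulr_gt0// exprn_gt0.
  rewrite ler_pdivrMr//; apply: (@le_trans _ _ (U ^+ 3)).
    by rewrite lerXn2r// nnegrE// ltW.
  apply: (le_trans KU); rewrite ler_wpM2l ?(ltW e0)//.
  by rewrite expr2; nra.
Qed.

(** A cone of height [c] and slope [K] around the point prescribed on the coordinates listed in [l],
    cut off at 0; distances are truncated at 1 to remain approximable on boxes. *)
Definition bump (l : seq (I * R)) (c K : R) y :=
  Num.max 0 (c - K * \sum_(q <- l) Num.min 1 `|y q.1 - q.2|).

Lemma box_approximable_bump l c K : box_approximable (bump l c K).
Proof.
apply: box_approximable_max; first exact: box_approximable_cst.
have hs : box_approximable (fun y => \sum_(q <- l) Num.min 1 `|y q.1 - q.2|).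
  elim: l => [|q l ih].
    by have := box_approximable_cst 0; congr box_approximable; apply/funext => y; rewrite big_nil.
  have := box_approximable_add (box_approximable_dist q.1 q.2) ih.
  by congr box_approximable; apply/funext => y; rewrite big_cons.
have := box_approximable_add (box_approximable_cst c) (box_approximable_scale (- K) hs).
by congr box_approximable; apply/funext => y; rewrite mulNr.
Qed.

End trigonometric_polynomials.

Section bump_approximation.
Context {I : countType} {R : realType}.
Variable g : {ptws I -> R} -> R.
Hypothesis cg : continuous g.

(** By contradiction along a sequence: points within [n.+1%:R^-1] of x on the coordinates of code
    below n converge to x in the product topology, while their images stay e away. This avoids
    describing neighbourhoods of the product by hand. *)
Lemma ptws_continuous_box (x : I -> R) (e : R) : 0 < e ->
  exists (F : seq I) (delta : R), 0 < delta /\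
    forall y, (forall i, i \in F -> `|y i - x i| < delta) -> `|g y - g x| < e.
Proof.
move=> e0; apply: contrapT => hn.
pose F n : seq I := pmap (fun k => unpickle k : option I) (iota 0 n).
have /choice[y hy] : forall n, exists y : I -> R,
    (forall i, i \in F n -> `|y i - x i| < n.+1%:R^-1) /\ e <= `|g y - g x|.
  move=> n.
  apply: contrapT => hy; apply: hn; exists (F n), n.+1%:R^-1; split; first by rewrite invr_gt0.
  move=> y hyx; rewrite ltNge; apply/negP => h; apply: hy; by exists y.
have yx : {ptws, y @ \oo --> x}.
  apply/cvg_sup => i A /=; rewrite (@nbhsE (initial_topology (fun f : I -> R => f i))) => -[_ [[C oC <-] /= Cx] sub].
  rewrite nbhs_filterE; apply: (filterS sub) => /=.
  suff yi : y ^~ i @ \oo --> x i by apply: (yi C); exact: open_nbhs_nbhs.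
  apply/cvgrPdist_lt => e' e'0.
  exists (maxn (pickle i).+1 (Num.truncn e'^-1).+1) => // n /= hn'.
  rewrite distrC; apply: (lt_trans (proj1 (hy n) i _)).
    rewrite mem_pmap; apply/mapP; exists (pickle i); last by rewrite pickleK.
    by rewrite mem_iota add0n (leq_trans _ hn')// leq_maxl.
  rewrite -[ltRHS]invrK ltf_pV2 ?posrE ?invr_gt0// (lt_le_trans (truncnS_gt _))//.
  by rewrite ler_nat ltnW// ltnS (leq_trans _ hn')// leq_maxr.
have := cvg_comp _ _ yx (cg (x := x)) => /cvgrPdist_lt/(_ _ e0)[N _ /(_ N (leqnn N))]/=.
by rewrite distrC ltNge => /negP; apply; exact: (proj2 (hy N)).
Qed.

Hypothesis g0 : forall y, 0 <= g y.

(* A nonnegative continuous function is the supremum of the countably many rational bumps below it. *)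
Lemma continuous_bump_sup : exists b : nat -> (I -> R) -> R,
  [/\ forall n, box_approximable (b n), forall n y, 0 <= b n y <= g y &
      forall y, (fun n => b n y) @ \oo --> g y] .
Proof.
pose par : Type := (seq (I * rat) * rat * nat)%type.
pose bp (u : par) : (I -> R) -> R :=
  bump [seq (q.1, ratr q.2) | q <- u.1.1] (ratr u.1.2) u.2%:R.
(* Rational parameters form a countable type. Codes of nothing, or of a bump exceeding [g]
   somewhere, are sent to 0, which is below [g] because [g] is nonnegative. *)
pose b0 n : (I -> R) -> R := if (unpickle n : option par) is Some u then
  (if `[< forall y, bp u y <= g y >] then bp u else fun=> 0) else fun=> 0.
have b0K n : box_approximable (b0 n).
  rewrite /b0; case: unpickle => [u|]; last exact: box_approximable_cst.
  by case: ifP => _; [exact: box_approximable_bump|exact: box_approximable_cst].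
have b0g n y : b0 n y <= g y.
  rewrite /b0; case: unpickle => [u|] //.
  by case: ifPn => // /asboolP.
pose fix b n : (I -> R) -> R :=
  if n is k.+1 then (fun y => Num.max (b k y) (b0 k y)) else fun=> 0.
have bK n : box_approximable (b n).
  by elim: n => [|n ih]; [exact: box_approximable_cst|exact: box_approximable_max].
have bg n y : 0 <= b n y <= g y.
  elim: n => [|n /andP[ih1 ih2]] /=; first by rewrite lexx g0.
  by rewrite le_max ih1 ge_max ih2 b0g.
exists b; split => // y.
have mono m n : (m <= n)%N -> b m y <= b n y.
  move=> mn; rewrite -(subnK mn); elim: (n - m)%N => // k ih.
  by rewrite addSn /= le_max ih.
apply/cvgrPdist_le => e e0.
suff [u [ug uy]] : exists u, (forall z, bp u z <= g z) /\ g y - e <= bp u y.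
  exists (pickle u).+1 => // n /= hn.
  have /andP[_ h1] := bg n y; rewrite ger0_norm ?subr_ge0//.
  rewrite lerBlDr -lerBlDl; apply: (le_trans uy).
  apply: le_trans (mono _ _ hn); rewrite /= le_max; apply/orP; right.
  by rewrite /b0 pickleK; case: ifPn => // /asboolPn.
have e4 : 0 < e / 4 by lra.
have [ge|ge] := leP (g y) e.
  exists ([::], 0, 0%N); split; last by rewrite /bp/bump/= le_max; apply/orP; left; lra.
  move=> z; rewrite /bp/bump/= big_nil mulr0 subr0 rmorph0.
  by rewrite ge_max g0.
have [F [de [de0 hF]]] := ptws_continuous_box y e4.
(* Choice of the bump: its height [c] is below [g] on the box of radius [de]; leaving the box costs
   at least [K * dl >= g y > c], so the bump is 0 there; the rational centre is within [eta] of y,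
   which costs at most e / 4 at y itself. *)
pose dl := Num.min 1 (de / 2).
have dl0 : 0 < dl by rewrite /dl lt_min ltr01 divr_gt0.
have [c /andP[c1 c2]] : exists c : rat, g y - e / 2 < ratr c < g y - e / 4.
  have hlt : g y - e / 2 < g y - e / 4 by lra.
  have [c] := rat_in_itvoo hlt.
  by rewrite in_itv/= => h; exists c.
pose K := (Num.truncn (g y / dl)).+1.
have Kdl : g y <= K%:R * dl by rewrite -ler_pdivrMr// ltW// truncnS_gt.
have sF : 0 < (size F).+1%:R :> R by rewrite ltr0n.
have K0 : 0 < K%:R :> R by rewrite ltr0n.
pose eta := Num.min (de / 2) (e / 4 / (K%:R * (size F).+1%:R)).
have eta0 : 0 < eta by rewrite /eta lt_min !divr_gt0// mulr_gt0.
have /choice[q hq] : forall i, exists q : rat, `|y i - ratr q| < eta.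
  move=> i.
  have hlt : y i - eta < y i + eta by lra.
  have [r] := rat_in_itvoo hlt.
  rewrite in_itv/= => /andP[h1 h2]; exists r; rewrite ltr_norml; apply/andP; split; lra.
exists ([seq (i, q i) | i <- F], c, K); split=> [z|]; rewrite /bp/bump/= !big_map/=; last first.
  have : K%:R * \sum_(i <- F) Num.min 1 `|y i - ratr (q i)| <= e / 4.
    have s1 : \sum_(i <- F) Num.min 1 `|y i - ratr (q i)| <= (size F)%:R * eta.
      elim: F {hF sF eta eta0 hq} (eta) hq => [|i F ih] eta hq; first by rewrite big_nil mul0r.
      rewrite big_cons/= -natr1 mulrDl mul1r addrC lerD ?ih// ge_min; apply/orP; right.
      exact/ltW/hq.
    have s2 : eta <= e / 4 / (K%:R * (size F).+1%:R) by rewrite /eta ge_min lexx orbT.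
    apply: (@le_trans _ _ (K%:R * ((size F).+1%:R * (e / 4 / (K%:R * (size F).+1%:R))))).
      rewrite ler_pM2l//; apply: (le_trans s1); rewrite ler_pM ?ler_nat ?(ltW eta0)//.
    by rewrite mulrA mulrC divfK// gt_eqF// mulr_gt0.
  by move=> h; rewrite le_max; apply/orP; right; lra.
rewrite ge_max g0/=.
have [hz|] := pselect (forall i, i \in F -> `|z i - y i| < de).
  have := hF z hz; rewrite ltr_norml => /andP[h _].
  have : 0 <= K%:R * \sum_(i <- F) Num.min 1 `|z i - ratr (q i)|.
    by rewrite mulr_ge0 ?(ltW K0)// sumr_ge0// => i _; rewrite le_min ler01 normr_ge0.
  lra.
move=> /existsNP[i /not_implyP[iF /negP]]; rewrite -leNgt => zi.
have : dl <= \sum_(i <- F) Num.min 1 `|z i - ratr (q i)|.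
  rewrite (big_rem i)//= -[leLHS]addr0 lerD//; last first.
    by apply: sumr_ge0 => j _; rewrite le_min ler01 normr_ge0.
  rewrite /dl le_min !ge_min lexx/=; apply/orP; right.
  have := ler_dist_dist (z i - y i) (z i - ratr (q i)).
  have -> : z i - y i - (z i - ratr (q i)) = - (y i - ratr (q i)) by ring.
  rewrite normrN; have := hq i; have : eta <= de / 2 by rewrite /eta ge_min lexx.
  have := ler_norm (`|z i - y i| - `|z i - ratr (q i)|); lra.
move=> h; have : g y <= K%:R * \sum_(i <- F) Num.min 1 `|z i - ratr (q i)|.
  by apply: (le_trans Kdl); rewrite ler_pM2l.
have := g0 z; lra.
Qed.

End bump_approximation.

(** * Stable convergence from trigonometric test functions *)

Section measurability_RI.
Context {I : Type} {R : realType}.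

Lemma measurable_coord (i : I) : measurable_fun setT (fun y : RI I R => y i).
Proof.
by move=> _ B mB; rewrite setTI; apply: sub_sigma_algebra; exists i, B.
Qed.

Lemma measurable_to_RI d (T : measurableType d) (Z : T -> RI I R) :
  (forall i, measurable_fun setT (fun w => Z w i)) -> measurable_fun setT Z.
Proof.
move=> mZ; apply: (@measurability _ _ T (RI I R) setT Z (@cylinders I R)) => // _ [_ [i [B [mB ->]]] <-].
exact: (mZ i measurableT B mB).
Qed.

Lemma measurable_lin (s : seq (I * R)) :
  measurable_fun setT (fun y : RI I R => \sum_(q <- s) q.2 * y q.1).
Proof.
by apply: measurable_sum => q; apply: measurable_funM => //; exact: measurable_coord.
Qed.

Lemma measurable_trig f : trig_poly f -> measurable_fun (setT : set (RI I R)) f.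
Proof.
elim=> [s t|f1 f2 _ h1 _ h2|c f1 _ h]; [|exact: measurable_funD|exact: measurable_funM].
apply: measurableT_comp; first exact: (continuous_measurable_fun (@continuous_cos R)).
by apply: measurable_funD => //; exact: measurable_lin.
Qed.

End measurability_RI.

Section stable_convergence.
Context d {T : measurableType d} {R : realType} (P : probability T R) {I : countType}.
Variables (A : set T) (Z : nat -> T -> I -> R) (beta : T -> probability (RI I R) R).
Hypothesis mA : measurable A.
Hypothesis Z_sq : forall i, exists C : R, forall n,
  sq_integrable P (fun w => Z n w i) /\ \int[P]_w (Z n w i) ^+ 2 <= C.
Hypothesis beta_trig : forall (s : seq (I * R)) (theta : R),
  measurable_fun setT (fun w => \int[beta w]_y cos (theta + \sum_(q <- s) q.2 * y q.1)) /\
  (fun n => \int[P]_w (\1_A w * cos (theta + \sum_(q <- s) q.2 * Z n w q.1))) @ \oo -->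
    \int[P]_w (\1_A w * \int[beta w]_y cos (theta + \sum_(q <- s) q.2 * y q.1)).

Implicit Types h p : (I -> R) -> R.

(** Measurability of the integral against [beta] is part of the property because [beta] is not
    assumed to be a kernel: it has to be carried along from the cosines. *)
Definition stable_test h := [/\ measurable_fun (setT : set (RI I R)) h,
  exists B : R, forall y, `|h y| <= B,
  measurable_fun setT (fun w => \int[beta w]_y h y) &
  (fun n => \int[P]_w (\1_A w * h (Z n w))) @ \oo -->
    \int[P]_w (\1_A w * \int[beta w]_y h y)].

Let mZ n i : measurable_fun setT (fun w => Z n w i).
Proof. by have [C /(_ n)[[]]] := Z_sq i. Qed.

Let mhZ n h : measurable_fun (setT : set (RI I R)) h -> measurable_fun setT (fun w => h (Z n w)).
Proof. by move=> mh; apply: (measurableT_comp mh); exact: measurable_to_RI. Qed.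

Let ind1 w : `|\1_A w : R| <= 1.
Proof. by rewrite indicE; case: (_ \in _); rewrite ?normr1 ?normr0. Qed.

Let mind : measurable_fun setT (\1_A : T -> R).
Proof. exact: measurable_indic. Qed.

Let I_ind (f : T -> R) (B : R) : measurable_fun setT f ->
  (forall w, `|f w| <= B) -> P.-integrable setT (EFin \o (fun w => \1_A w * f w)).
Proof.
move=> mf fB; apply: (@bounded_integrable _ _ _ _ _ (1 * B)).
  by apply: measurable_funM => //; exact: mind.
by move=> w; rewrite normrM ler_pM.
Qed.

Lemma stable_test_add f g : stable_test f -> stable_test g -> stable_test (fun y => f y + g y).
Proof.
move=> [mf [B fB] mbf cf] [mg [B' gB] mbg cg].
have bE w : \int[beta w]_y (f y + g y) = \int[beta w]_y f y + \int[beta w]_y g y.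
  by rewrite RintegralD//; [exact: (bounded_integrable _ mf fB)|exact: (bounded_integrable _ mg gB)].
split.
- exact: measurable_funD.
- by exists (B + B') => y; rewrite (le_trans (ler_normD _ _))// lerD.
- by under eq_fun do rewrite bE; exact: measurable_funD.
- under eq_Rintegral => w _ do rewrite bE mulrDr.
  rewrite RintegralD//; last 2 first.
  + by apply: (I_ind mbf (B := B)) => w; exact: Rintegral_norm_le.
  + by apply: (I_ind mbg (B := B')) => w; exact: Rintegral_norm_le.
  apply: (@cvg_eqr _ _ (fun n => \int[P]_w (\1_A w * f (Z n w)) + \int[P]_w (\1_A w * g (Z n w)))).
    move=> n; under eq_Rintegral => w _ do rewrite mulrDr.
    rewrite RintegralD//.
      by apply: (I_ind _ (B := B)) => //; exact: mhZ.
    by apply: (I_ind _ (B := B')) => //; exact: mhZ.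
  by apply: cvgD; [exact: cf|exact: cg].
Qed.

Lemma stable_test_scale c f : stable_test f -> stable_test (fun y => c * f y).
Proof.
move=> [mf [B fB] mbf cf].
have bE w : \int[beta w]_y (c * f y) = c * \int[beta w]_y f y.
  by rewrite RintegralZl//; exact: (bounded_integrable _ mf fB).
split.
- exact: measurable_funM.
- by exists (`|c| * B) => y; rewrite normrM ler_wpM2l.
- by under eq_fun do rewrite bE; exact: measurable_funM.
- under eq_Rintegral => w _ do rewrite bE mulrCA.
  rewrite RintegralZl//; last first.
    by apply: (I_ind mbf (B := B)) => w; exact: Rintegral_norm_le.
  apply: (@cvg_eqr _ _ (fun n => c * \int[P]_w (\1_A w * f (Z n w)))).
    move=> n; under eq_Rintegral => w _ do rewrite mulrCA.
    by rewrite RintegralZl//; apply: (I_ind _ (B := B)) => //; exact: mhZ.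
  by apply: cvgM; [exact: cvg_cst|exact: cf].
Qed.

Lemma stable_test_trig f : trig_poly f -> stable_test f.
Proof.
elim=> [s t|f1 f2 _ h1 _ h2|c f1 _ h]; [|exact: stable_test_add|exact: stable_test_scale].
have [m c] := beta_trig s t; split => //.
- exact: measurable_trig (trig_cos s t).
- by exists 1 => y; exact: cos_max.
Qed.

Lemma measurable_beta_limit (h_ : nat -> (I -> R) -> R) h (B : R) :
  (forall m, stable_test (h_ m)) -> (forall m y, `|h_ m y| <= B) ->
  (forall y, (fun m => h_ m y) @ \oo --> h y) ->
  [/\ measurable_fun (setT : set (RI I R)) h, measurable_fun setT (fun w => \int[beta w]_y h y) &
   (fun m => \int[P]_w (\1_A w * \int[beta w]_y h_ m y)) @ \oo -->
      \int[P]_w (\1_A w * \int[beta w]_y h y)].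
Proof.
move=> th hB hc.
have mh : measurable_fun (setT : set (RI I R)) h.
  apply: (@measurable_fun_cvg _ (RI I R) R setT h_ h) => [m|y _]; last exact: hc.
  by case: (th m).
have bc w : (fun m => \int[beta w]_y h_ m y) @ \oo --> \int[beta w]_y h y.
  apply: (@Rintegral_bounded_cvg _ _ _ _ _ _ B) => //; last exact: aeW.
  by move=> m; case: (th m).
have mbh : measurable_fun setT (fun w => \int[beta w]_y h y).
  apply: (@measurable_fun_cvg _ T R setT (fun m w => \int[beta w]_y h_ m y)) => [m|w _]; last exact: bc.
  by case: (th m).
split => //.
apply: (@Rintegral_bounded_cvg _ _ _ _ _ _ (1 * B)).
- by move=> m; apply: measurable_funM; [exact: mind|case: (th m)].
- by apply: measurable_funM => //; exact: mind.
- by apply: aeW => w; apply: cvgM; [exact: cvg_cst|exact: bc].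
- move=> m w; rewrite normrM ler_pM//; apply: Rintegral_norm_le => //.
  by case: (th m).
Qed.

(** The two sides need different closeness: under [beta], bounded pointwise convergence suffices,
    but along [Z] the L^1 error has to be small uniformly in n. *)
Lemma stable_test_limit (h_ : nat -> (I -> R) -> R) h (B : R) :
  (forall m, stable_test (h_ m)) -> (forall m y, `|h_ m y| <= B) -> (forall y, `|h y| <= B) ->
  (forall y, (fun m => h_ m y) @ \oo --> h y) ->
  (forall e : R, 0 < e -> exists m0, forall m, (m0 <= m)%N -> forall n,
     \int[P]_w `|h_ m (Z n w) - h (Z n w)| <= e) ->
  stable_test h.
Proof.
move=> th hmB hB hc hu.
have [mh mbh cA] := measurable_beta_limit th hmB hc.
split => //; first by exists B.
apply/cvgrPdist_le => e e0.
have e3 : 0 < e / 3 by lra.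
have [m0 hm0] := hu _ e3.
have /cvgrPdist_le/(_ _ e3)[m1 _ hm1] := cA.
pose m := maxn m0 m1.
have [mhm _ _ /cvgrPdist_le/(_ _ e3)] := th m.
apply: filterS => n hn.
have := hm1 m (leq_maxr _ _) => /= h1.
have h2 := hm0 m (leq_maxl _ _) n.
have h3 : `|\int[P]_w (\1_A w * h_ m (Z n w)) - \int[P]_w (\1_A w * h (Z n w))| <= e / 3.
  apply: le_trans h2.
  have Im := I_ind (mhZ n mhm) (fun w => hmB m (Z n w)).
  have Ih := I_ind (mhZ n mh) (fun w => hB (Z n w)).
  rewrite -RintegralB//; apply: (le_trans (le_normr_Rintegral _ _)) => //; first exact: integrable_subr.
  have IB : P.-integrable setT (EFin \o (fun w => h_ m (Z n w) - h (Z n w))).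
    apply: integrable_subr.
      exact: (bounded_integrable _ (mhZ n mhm) (fun w => hmB m (Z n w))).
    exact: (bounded_integrable _ (mhZ n mh) (fun w => hB (Z n w))).
  apply: le_Rintegral => //.
  - exact/integrable_norm/integrable_subr.
  - exact: integrable_norm.
  - by move=> w _; rewrite -mulrBr normrM ler_piMl.
move: h1 hn h3; set x := \int[P]_w _; set y := \int[P]_w _; set z := \int[P]_w _.
set u := \int[P]_w _.
rewrite !ler_norml => /andP[? ?] /andP[? ?] /andP[? ?]; apply/andP; split; lra.
Qed.

Lemma stable_test_trig_limit f : trig_limit f -> stable_test f.
Proof.
move=> hf; have [B fB] := trig_limit_bounded hf.
have /choice[p hp] : forall m : nat, exists p, trig_poly p /\ forall y, `|f y - p y| <= m.+1%:R^-1.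
  by move=> m; have [|p hp fp] := hf m.+1%:R^-1; [rewrite invr_gt0|exists p].
have pB m y : `|p m y| <= B + 1.
  rewrite (_ : p m y = f y - (f y - p m y)); last by ring.
  rewrite (le_trans (ler_normB _ _))// lerD// (le_trans (proj2 (hp m) y))//.
  by rewrite invf_le1// ler1n.
have small (e : R) : 0 < e -> exists m0, forall m, (m0 <= m)%N -> m.+1%:R^-1 <= e.
  move=> e0; exists (Num.truncn e^-1).+1 => m hm.
  rewrite -[leRHS]invrK lef_pV2 ?posrE ?invr_gt0//.
  by rewrite ltW// (lt_le_trans (truncnS_gt _))// ler_nat ltnW.
apply: (@stable_test_limit p f (B + 1)) => //.
- by move=> m; apply: stable_test_trig; case: (hp m).
- by move=> y; rewrite (le_trans (fB y))// lerDl.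
- move=> y; apply/cvgrPdist_le => e e0; have [m0 hm0] := small e e0.
  by exists m0 => // m /= /hm0; apply: le_trans; case: (hp m).
- move=> e e0; have [m0 hm0] := small e e0; exists m0 => m /hm0 hm n.
  apply: (le_trans (ler_norm _)); apply: Rintegral_norm_le => [|w].
    apply: measurableT_comp => //; apply: measurable_funB; apply: mhZ.
      by apply: measurable_trig; case: (hp m).
    apply: (@measurable_fun_cvg _ (RI I R) R setT p f) => [k|y _].
      by apply: measurable_trig; case: (hp k).
    apply/cvgrPdist_le => e' e'0; have [m1 hm1] := small e' e'0.
    by exists m1 => // k /= /hm1; apply: le_trans; case: (hp k).
  by rewrite normr_id distrC (le_trans (proj2 (hp m) _)).
Qed.

(** The uniform control along [Z] comes from the second moments in [Z_sq]; under [beta w] it is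
    replaced by the bounded pointwise convergence of the [p m] to [h]. *)
Lemma stable_test_box h : box_approximable h -> stable_test h.
Proof.
move=> [B [F [hB hp']]].
have B0 : 0 <= B by apply: le_trans (hB (fun=> 0)).
have /choice[p hp] : forall m : nat, exists p, [/\ trig_limit p, forall y, `|p y| <= B &
    forall y, (forall i, List.In i F -> `|y i| <= m.+1%:R) -> `|h y - p y| <= m.+1%:R^-1].
  by move=> m; apply: hp'; rewrite ?invr_gt0.
have tp m : stable_test (p m) by apply: stable_test_trig_limit; case: (hp m).
have small (e : R) : 0 < e -> exists m0, forall m, (m0 <= m)%N -> m.+1%:R^-1 <= e.
  move=> e0; exists (Num.truncn e^-1).+1 => m hm.
  rewrite -[leRHS]invrK lef_pV2 ?posrE ?invr_gt0//.
  by rewrite ltW// (lt_le_trans (truncnS_gt _))// ler_nat ltnW.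
(* Off the box some scaled coordinate exceeds 1 in modulus, so the sum is at least 1 and covers the
   trivial bound [2 * B]: Chebyshev's inequality before integration. *)
have bd m y : `|p m y - h y| <= m.+1%:R^-1 + 2 * B * \sum_(i <- F) (m.+1%:R^-1 * y i) ^+ 2.
  have m0 : 0 < m.+1%:R :> R by rewrite ltr0n.
  have s0 (G : seq I) : 0 <= \sum_(i <- G) (m.+1%:R^-1 * y i) ^+ 2.
    by apply: sumr_ge0 => i _; exact: sqr_ge0.
  have [hy|/existsNP[i /not_implyP[iF /negP]]] :=
      pselect (forall i, List.In i F -> `|y i| <= m.+1%:R).
    rewrite distrC (@le_trans _ _ m.+1%:R^-1)//; first by case: (hp m) => _ _; apply.
    by rewrite lerDl !mulr_ge0.
  rewrite -ltNge => yi.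
  have big : 1 <= \sum_(i <- F) (m.+1%:R^-1 * y i) ^+ 2.
    apply: (@le_trans _ _ ((m.+1%:R^-1 * y i) ^+ 2)).
      rewrite -real_normK ?num_real// exprn_ege1// normrM ger0_norm ?invr_ge0//.
      by rewrite mulrC ler_pdivlMr// mul1r ltW.
    elim: F iF {hp' hp} => // j F ih [->|iF]; rewrite big_cons; first by rewrite lerDl.
    by rewrite (le_trans (ih iF))// lerDr sqr_ge0.
  apply: (@le_trans _ _ (2 * B * 1)).
    rewrite mulr1 (le_trans (ler_normB _ _))//; have := hB y.
    have : `|p m y| <= B by case: (hp m).
    lra.
  by rewrite -[leLHS]add0r lerD ?invr_ge0// ler_wpM2l// mulr_ge0.
have [C hC] : exists C : R, forall n, \int[P]_w (\sum_(i <- F) (Z n w i) ^+ 2) <= C.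
  elim: F {hp' hp bd} => [|i F [C hC]].
    by exists 0 => n; under eq_Rintegral do rewrite big_nil; rewrite Rintegral_bounded_cst.
  have [C' hC'] := Z_sq i; exists (C' + C) => n.
  under eq_Rintegral do rewrite big_cons.
  rewrite RintegralD//; [|by have [[]] := hC' n|].
    by rewrite lerD//; have [] := hC' n.
  by apply: integrable_sumr => j; have [? /(_ n)[[]]] := Z_sq j.
have pc y : (fun m => p m y) @ \oo --> h y.
  apply/cvgrPdist_le => e e0.
  pose S := \sum_(i <- F) y i ^+ 2.
  have S0 : 0 <= S by apply: sumr_ge0 => i _; exact: sqr_ge0.
  have k0 : 0 < 1 + 2 * B * S by rewrite ltr_pwDl// !mulr_ge0.
  have [m0 hm0] := small (e / (1 + 2 * B * S)) (divr_gt0 e0 k0).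
  exists m0 => // m /= /hm0 hm; rewrite distrC (le_trans (bd m y))//.
  have -> : \sum_(i <- F) (m.+1%:R^-1 * y i) ^+ 2 = m.+1%:R^-1 * (m.+1%:R^-1 * S).
    by rewrite !mulr_sumr; apply: eq_bigr => i _; ring.
  have m1 : m.+1%:R^-1 <= 1 :> R by rewrite invf_le1// ler1n.
  have mi : 0 <= m.+1%:R^-1 :> R by rewrite invr_ge0.
  apply: (@le_trans _ _ (m.+1%:R^-1 * (1 + 2 * B * S))); last by rewrite -ler_pdivlMr.
  rewrite mulrDr mulr1 lerD2l mulrCA ler_wpM2l// ler_wpM2l ?mulr_ge0//.
  by rewrite ler_piMl.
have mh : measurable_fun (setT : set (RI I R)) h.
  by apply: (@measurable_fun_cvg _ (RI I R) R setT p h) => [k|y _]; [case: (tp k)|exact: pc].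
apply: (@stable_test_limit p h B) => //.
- by move=> m y; case: (hp m).
- move=> e e0.
  have C0 : 0 <= C by apply: le_trans (hC 0%N); apply: Rintegral_ge0 => w _; apply: sumr_ge0 => i _; exact: sqr_ge0.
  have k0 : 0 < 1 + 2 * B * C by rewrite ltr_pwDl// !mulr_ge0.
  have [m0 hm0] := small (e / (1 + 2 * B * C)) (divr_gt0 e0 k0).
  exists m0 => // m /hm0 hm n.
  have m1 : m.+1%:R^-1 <= 1 :> R by rewrite invf_le1// ler1n.
  have mi : 0 <= m.+1%:R^-1 :> R by rewrite invr_ge0.
  have IS : P.-integrable setT (EFin \o (fun w => \sum_(i <- F) Z n w i ^+ 2)).
    by apply: integrable_sumr => j; have [? /(_ n)[[]]] := Z_sq j.
  apply: (@le_trans _ _ (\int[P]_w (m.+1%:R^-1 + (2 * B * m.+1%:R^-1 ^+ 2) * \sum_(i <- F) Z n w i ^+ 2))).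
    apply: le_Rintegral => //.
    + apply: integrable_norm => //; apply: (@bounded_integrable _ _ _ _ _ (2 * B)).
        by apply: measurable_funB; apply: mhZ => //; case: (tp m).
      move=> w; rewrite (le_trans (ler_normB _ _))//; have := hB (Z n w).
      have : `|p m (Z n w)| <= B by case: (hp m).
      lra.
    + by apply: integrable_addr; [exact: cst_integrable|exact: integrable_scaler].
    + move=> w _; apply: (le_trans (bd m (Z n w))); rewrite lerD2l.
      rewrite -[leRHS]mulrA ler_wpM2l ?mulr_ge0//.
      by rewrite mulr_sumr le_eqVlt; apply/orP; left; apply/eqP; apply: eq_bigr => i _; ring.
  rewrite RintegralD//; [|exact: cst_integrable|exact: integrable_scaler].
  rewrite RintegralZl// Rintegral_bounded_cst.
  apply: (@le_trans _ _ (m.+1%:R^-1 * (1 + 2 * B * C))); last by rewrite -ler_pdivlMr.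
  rewrite mulrDr mulr1 lerD2l expr2.
  rewrite (_ : 2 * B * _ * _ = m.+1%:R^-1 * (2 * B * (m.+1%:R^-1 * \int[P]_w (\sum_(i <- F) Z n w i ^+ 2)))); last by ring.
  rewrite ler_wpM2l// ler_wpM2l ?mulr_ge0//.
  apply: le_trans (hC n); rewrite ler_piMl//.
  by apply: Rintegral_ge0 => w _; apply: sumr_ge0 => i _; exact: sqr_ge0.
Qed.

(* Portmanteau: it suffices to bound the lower limit from below, for g and for B - g. *)
Lemma stable_liminf (g : {ptws I -> R} -> R) (B : R) : continuous g ->
  (forall y, 0 <= g y <= B) ->
  [/\ measurable_fun (setT : set (RI I R)) g, measurable_fun setT (fun w => \int[beta w]_y g y) &
   forall e : R, 0 < e -> \forall n \near \oo,
    \int[P]_w (\1_A w * \int[beta w]_y g y) - e <= \int[P]_w (\1_A w * g (Z n w))].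
Proof.
move=> cg gB.
have [b [bK bg bc]] := continuous_bump_sup cg (fun y => proj1 (andP (gB y))).
have tb m : stable_test (b m) by exact: stable_test_box.
have bB m y : `|b m y| <= B.
  have /andP[h1 h2] := bg m y; have /andP[h3 h4] := gB y.
  by rewrite ger0_norm// (le_trans h2).
have [mg mbg cA] := measurable_beta_limit tb bB bc.
split => // e e0; have e2 : 0 < e / 2 by lra.
have /cvgrPdist_le/(_ _ e2)[m _ /(_ m (leqnn m))/= hm] := cA.
have [mbm _ _ /cvgrPdist_le/(_ _ e2)] := tb m.
apply: filterS => n hn.
have h : \int[P]_w (\1_A w * b m (Z n w)) <= \int[P]_w (\1_A w * g (Z n w)).
  apply: le_Rintegral => //.
  - exact: (I_ind (mhZ n mbm) (fun w => bB m (Z n w))).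
  - apply: (I_ind (mhZ n mg) (B := B)) => w; have /andP[h3 h4] := gB (Z n w).
    by rewrite ger0_norm.
  - move=> w _; apply: ler_wpM2l; first by rewrite indicE; case: (_ \in _).
    by have /andP[] := bg m (Z n w).
move: hm hn h; set x := \int[P]_w _; set y := \int[P]_w _; set z := \int[P]_w _; set u := \int[P]_w _.
rewrite !ler_norml => /andP[? ?] /andP[? ?] ?; lra.
Qed.

Lemma stable_limit_trig (g : {ptws I -> R} -> R) (B : R) : continuous g -> (forall y, `|g y| <= B) ->
  (fun n => \int[P]_(w in A) (g (Z n w))%:E)%E @ \oo -->
    (\int[P]_(w in A) (\int[beta w]_y (g y)%:E))%E.
Proof.
move=> cg gB.
have B0 : 0 <= B by apply: le_trans (gB (fun=> 0)).
pose g1 : {ptws I -> R} -> R := fun y => B + g y.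
pose g2 : {ptws I -> R} -> R := fun y => B - g y.
have cg1 : continuous g1.
  move=> y; apply: (@continuous_comp {ptws I -> R} R R g (fun t => B + t) y (cg y)).
  by apply: cvgD; [exact: cvg_cst|exact: cvg_id].
have cg2 : continuous g2.
  move=> y; apply: (@continuous_comp {ptws I -> R} R R g (fun t => B - t) y (cg y)).
  by apply: cvgB; [exact: cvg_cst|exact: cvg_id].
have b1 y : 0 <= g1 y <= 2 * B.
  by have := gB y; rewrite ler_norml /g1 => /andP[? ?]; apply/andP; split; lra.
have b2 y : 0 <= g2 y <= 2 * B.
  by have := gB y; rewrite ler_norml /g2 => /andP[? ?]; apply/andP; split; lra.
have [m1 mb1 h1] := stable_liminf cg1 b1.
have [m2 mb2 h2] := stable_liminf cg2 b2.
have mg : measurable_fun (setT : set (RI I R)) g.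
  rewrite (_ : g = fun y => g1 y - B); last by apply/funext => y; rewrite /g1; ring.
  exact: measurable_funB.
have Ig w : (beta w).-integrable setT (EFin \o g) by exact: (bounded_integrable _ mg gB).
have bE1 w : \int[beta w]_y g1 y = B + \int[beta w]_y g y.
  by rewrite (RintegralD measurableT (cst_integrable (beta w) B) (Ig w)) Rintegral_bounded_cst.
have bE2 w : \int[beta w]_y g2 y = B - \int[beta w]_y g y.
  by rewrite (RintegralB measurableT (cst_integrable (beta w) B) (Ig w)) Rintegral_bounded_cst.
have mbg : measurable_fun setT (fun w => \int[beta w]_y g y).
  rewrite (_ : (fun w => _) = fun w => \int[beta w]_y g1 y - B).
    exact: measurable_funB.
  by apply/funext => w; rewrite bE1; ring.
have bgB w : `|\int[beta w]_y g y| <= B by exact: Rintegral_norm_le.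
have IAB : P.-integrable setT (EFin \o (fun w => \1_A w * B)) by exact: (I_ind _ (fun=> lexx `|B|)).
have IAg n : P.-integrable setT (EFin \o (fun w => \1_A w * g (Z n w))).
  exact: (I_ind (mhZ n mg) (fun w => gB (Z n w))).
have IAb : P.-integrable setT (EFin \o (fun w => \1_A w * \int[beta w]_y g y)).
  exact: (I_ind mbg bgB).
have key : (fun n => \int[P]_w (\1_A w * g (Z n w))) @ \oo --> \int[P]_w (\1_A w * \int[beta w]_y g y).
  apply/cvgrPdist_le => e e0.
  apply: filterS2 (h1 e e0) (h2 e e0) => n.
  under eq_Rintegral => w _ do rewrite bE1 mulrDr.
  under [X in _ <= X -> _]eq_Rintegral => w _ do rewrite /g1 mulrDr.
  rewrite !RintegralD// => k1.
  under eq_Rintegral => w _ do rewrite bE2 mulrBr.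
  under [X in _ <= X -> _]eq_Rintegral => w _ do rewrite /g2 mulrBr.
  rewrite !RintegralB// => k2.
  by rewrite ler_norml; apply/andP; split; lra.
have E1 (f : T -> R) : P.-integrable setT (EFin \o (fun w => \1_A w * f w)) ->
    (\int[P]_(w in A) (f w)%:E)%E = (\int[P]_w (\1_A w * f w))%:E.
  move=> If; rewrite /Rintegral fineK; last exact: integrable_fin_num.
  rewrite [LHS]integral_mkcond; apply: eq_integral => w _.
  by rewrite patchE indicE; case: (_ \in _); rewrite /= ?mul1r ?mul0r.
have E2 w : (\int[beta w]_y (g y)%:E)%E = (\int[beta w]_y g y)%:E.
  by rewrite /Rintegral fineK//; exact: (integrable_fin_num measurableT (Ig w)).
under eq_integral => w _ do rewrite E2.
rewrite E1// (funext (fun n => E1 (fun w => g (Z n w)) (IAg n))).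
by apply: cvg_EFin => //; exact: nearW.
Qed.

End stable_convergence.

Lemma stably_converges_trig d (T : measurableType d) (R : realType) (P : probability T R)
    (I : countType) (Z : nat -> T -> I -> R) (beta : T -> probability (RI I R) R) :
  (forall i, exists C : R, forall n,
    sq_integrable P (fun w => Z n w i) /\ \int[P]_w (Z n w i) ^+ 2 <= C) ->
  (forall (s : seq (I * R)) (theta : R),
    measurable_fun setT (fun w => \int[beta w]_y cos (theta + \sum_(q <- s) q.2 * y q.1)) /\
    forall A, measurable A ->
      (fun n => \int[P]_w (\1_A w * cos (theta + \sum_(q <- s) q.2 * Z n w q.1))) @ \oo -->
      \int[P]_w (\1_A w * \int[beta w]_y cos (theta + \sum_(q <- s) q.2 * y q.1))) ->
  stably_converges P Z beta.
Proof.
move=> Z_sq beta_trig A g mA cg [B gB].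
apply: stable_limit_trig cg gB => // s theta.
by have [mb cb] := beta_trig s theta; split; last exact: cb.
Qed.

(** * Normal and uniform laws *)

Section density.
Local Open Scope ereal_scope.
Context d (T : measurableType d) (R : realType).
Variables (mu nu : {measure set T -> \bar R}) (phi : T -> R).
Hypothesis mphi : measurable_fun setT phi.
Hypothesis phi0 : forall x, (0 <= phi x)%R.
Hypothesis nuE : forall A, measurable A -> nu A = \int[mu]_(x in A) (phi x)%:E.
Import HBNNSimple.

Let mphiE : measurable_fun setT (EFin \o phi). Proof. exact/measurable_EFinP. Qed.

Let density_nnsfun (f : {nnsfun T >-> R}) :
  \int[nu]_x (f x)%:E = \int[mu]_x ((f x)%:E * (phi x)%:E).
Proof.
under [LHS]eq_integral do rewrite fimfunE -fsumEFin//.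
rewrite [LHS]ge0_integral_fsum//; last 2 first.
  - by move=> r; exact/measurable_EFinP/measurableT_comp.
  - by move=> n x _; rewrite EFinM nnfun_muleindic_ge0.
under [RHS]eq_integral.
  move=> x xD; rewrite fimfunE -fsumEFin// ge0_mule_fsuml; last first.
    by move=> r; rewrite EFinM nnfun_muleindic_ge0.
  over.
rewrite [RHS]ge0_integral_fsum//; last 2 first.
  - move=> r; apply: emeasurable_funM => //.
    by apply/measurable_EFinP; apply/measurableT_comp.
  - by move=> n x _; rewrite mule_ge0//; [rewrite EFinM nnfun_muleindic_ge0|rewrite lee_fin].
apply: eq_fsbigr => r; rewrite inE => -[t _ rE].
have r0 : (0 <= r)%R by rewrite -rE fun_ge0.
have mf : measurable (f @^-1` [set r]) by [].
under eq_integral do rewrite EFinM.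
rewrite ge0_integralZl//; last by apply/measurable_EFinP; exact: measurable_indic.
rewrite integral_indic// setIT nuE//.
under [RHS]eq_integral do rewrite EFinM -muleA.
rewrite [RHS]ge0_integralZl//; last first.
- by move=> x _; rewrite mule_ge0 ?lee_fin.
- by apply: emeasurable_funM => //; apply/measurable_EFinP; exact: measurable_indic.
rewrite integral_mkcond; congr (_ * _); apply: eq_integral => x _.
by rewrite epatch_indic/= muleC.
Qed.

(** Linearity extends [nuE] to simple functions, monotone convergence to all nonnegative ones;
    infinite integrals are allowed, so it can also be used to prove integrability. *)
Lemma ge0_integral_density (f : T -> \bar R) :
  measurable_fun setT f -> (forall x, 0 <= f x) ->
  \int[nu]_x f x = \int[mu]_x (f x * (phi x)%:E).
Proof.
move=> mf f0; pose f_ := nnsfun_approx measurableT mf.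
have fc x : (f_ n x)%:E @[n --> \oo] --> f x by exact: cvg_nnsfun_approx.
have mono x : {homo (fun n => (f_ n x)%:E) : n m / (n <= m)%N >-> n <= m}.
  by move=> n m nm; rewrite lee_fin; exact/lefP/nd_nnsfun_approx.
transitivity (limn (fun n => \int[nu]_x (f_ n x)%:E)).
  rewrite -monotone_convergence//=.
  - by apply: eq_integral => x _; apply/esym/cvg_lim.
  - by move=> n; exact/measurable_EFinP/measurable_funTS.
  - by move=> n x _; rewrite lee_fin.
transitivity (limn (fun n => \int[mu]_x ((f_ n x)%:E * (phi x)%:E))).
  by apply: congr_lim; apply/funext => n; exact: density_nnsfun.
rewrite -monotone_convergence//=.
- apply: eq_integral => x _; apply/cvg_lim => //.
  by apply: cvgeZr => //; exact: fc.
- by move=> n; apply: emeasurable_funM => //; exact/measurable_EFinP/measurable_funTS.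
- by move=> n x _; rewrite mule_ge0 ?lee_fin.
- by move=> x _ n m nm; apply: lee_wpmul2r; [rewrite lee_fin|exact: mono].
Qed.

End density.

Section normal_characteristic_function.
Context {R : realType}.
Variable sigma : R.
Hypothesis sigma0 : sigma != 0.
Local Notation mu := (@lebesgue_measure R).

Let k := normal_peak sigma.
Let c := (sigma ^+ 2 * 2)^-1.
Let p (x : R) := k * expR (- (c * x ^+ 2)).

Let s2 : 0 < sigma ^+ 2. Proof. by rewrite exprn_even_gt0. Qed.
Let c0 : 0 < c. Proof. by rewrite invr_gt0 mulr_gt0. Qed.
Let k0 : 0 < k. Proof. exact: normal_peak_gt0. Qed.
Let p0 x : 0 <= p x. Proof. by rewrite mulr_ge0 ?expR_ge0// ltW. Qed.

Lemma normal_pdf0E x : normal_pdf 0 sigma x = p x.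
Proof.
rewrite normal_pdfE// /normal_fun subr0 /p; congr (_ * expR _).
by rewrite mulNr -mulr_natr mulrC.
Qed.

Let mp : measurable_fun setT p.
Proof.
rewrite (_ : p = normal_pdf 0 sigma); first exact: measurable_normal_pdf.
by apply/funext => x; rewrite normal_pdf0E.
Qed.

Let Ip : mu.-integrable setT (EFin \o p).
Proof.
have := integrable_normal_pdf 0 sigma; congr (integrable _ _ _).
by apply/funext => x; rewrite /= normal_pdf0E.
Qed.

(** Half of the exponent absorbs the polynomial: with y = c x^2 / 2, [1 + x ^+ 2] is at most (1 + 2
    / c) e^y. The other half is, up to a constant, the normal density of deviation [s']. *)
Let Ip2 : mu.-integrable setT (EFin \o (fun x => (1 + x ^+ 2) * p x)).
Proof.
pose s' := Num.sqrt 2 * sigma.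
have s'0 : s' != 0 by rewrite mulf_neq0// gt_eqF// sqrtr_gt0.
have c'E : (s' ^+ 2 *+ 2)^-1 = c / 2.
  by rewrite /s' exprMn sqr_sqrtr// -mulr_natr /c; field.
have Ig : mu.-integrable setT (EFin \o (fun x => expR (- ((c / 2) * x ^+ 2)))).
  have := integrableZl measurableT (normal_peak s')^-1 (integrable_normal_pdf 0 s').
  congr (integrable _ _ _); apply/funext => x /=.
  rewrite -EFinM normal_pdfE//; congr EFin; rewrite mulKf ?gt_eqF ?normal_peak_gt0//.
  by rewrite /normal_fun subr0 mulNr c'E mulrC.
apply: (le_integrable measurableT _ _ (integrableZl measurableT (k * (1 + 2 / c)) Ig)).
  by apply/measurable_EFinP; apply: measurable_funM => //; apply: measurable_funD => //; exact: measurable_funX.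
move=> x _; rewrite /= lee_fin !ger0_norm; last 2 first.
- by rewrite mulr_ge0 ?expR_ge0// mulr_ge0 ?(ltW k0)// addr_ge0// divr_ge0// ltW.
- by rewrite mulr_ge0// addr_ge0// sqr_ge0.
rewrite /p mulrCA -[leRHS]mulrA ler_wpM2l ?(ltW k0)//.
have -> : expR (- (c * x ^+ 2)) = expR (- (c / 2 * x ^+ 2)) * expR (- (c / 2 * x ^+ 2)).
  by rewrite -expRD; congr expR; field.
rewrite mulrA ler_wpM2r ?expR_ge0//.
set y := c / 2 * x ^+ 2.
have y0 : 0 <= y by rewrite mulr_ge0 ?sqr_ge0// divr_ge0// ltW.
have -> : x ^+ 2 = 2 / c * y by rewrite /y; field; rewrite gt_eqF.
rewrite expRN ler_pdivrMr ?expR_gt0//.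
have c2 : 0 < 2 / c by rewrite divr_gt0.
apply: (@le_trans _ _ ((1 + 2 / c) * (1 + y))); first by move: c2; set z := 2 / c; nra.
by rewrite ler_wpM2l ?expR_ge1Dx// addr_ge0// ltW.
Qed.

Let Ixp : mu.-integrable setT (EFin \o (fun x => `|x| * p x)).
Proof.
apply: (le_integrable measurableT _ _ Ip2).
  by apply/measurable_EFinP; apply: measurable_funM => //; exact: measurableT_comp.
have h1 x : 0 <= (1 + x ^+ 2) * p x by rewrite mulr_ge0// addr_ge0// sqr_ge0.
move=> x _; rewrite /= lee_fin normrM normr_id (ger0_norm (h1 x)) (ger0_norm (p0 x)).
rewrite ler_wpM2r// -real_normK ?num_real//; have := normr_ge0 x; set y := `|x|.
have := sqr_ge0 (y - 1); nra.
Qed.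

Let p_deriv x : is_derive x (1:R) p (- (x / sigma ^+ 2) * p x).
Proof.
apply: trigger_derive; rewrite /GRing.scale/=.
by rewrite /p /c; field.
Qed.

Variable theta : R.
Let F (t : R) := \int[mu]_x (cos (theta + t * x) * p x).

Let mcos (t : R) : measurable_fun setT (fun x : R => cos (theta + t * x)).
Proof.
apply: measurableT_comp; first exact: (continuous_measurable_fun (@continuous_cos R)).
by apply: measurable_funD => //; exact: measurable_funM.
Qed.

Let msin (t : R) : measurable_fun setT (fun x : R => sin (theta + t * x)).
Proof.
apply: measurableT_comp; first exact: (continuous_measurable_fun (@continuous_sin R)).
by apply: measurable_funD => //; exact: measurable_funM.
Qed.

Let Icos t : mu.-integrable setT (EFin \o (fun x => cos (theta + t * x) * p x)).
Proof.
apply: (le_integrable measurableT _ _ Ip).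
  by apply/measurable_EFinP; apply: measurable_funM; [exact: mcos|exact: mp].
by move=> x _; rewrite /= lee_fin normrM ler_piMl// cos_max.
Qed.

Let Isin t : mu.-integrable setT (EFin \o (fun x => x * sin (theta + t * x) * p x)).
Proof.
apply: (le_integrable measurableT _ _ Ixp).
  apply/measurable_EFinP; apply: measurable_funM; last exact: mp.
  by apply: measurable_funM => //; exact: msin.
by move=> x _; rewrite /= lee_fin !normrM normr_id ler_wpM2r// ler_piMr// sin_max.
Qed.

(* Integration by parts against the density. *)
Let ibp t : \int[mu]_x (x * sin (theta + t * x) * p x) = sigma ^+ 2 * t * F t.
Proof.
pose f (x : R) : R := x * sin (theta + t * x) * p x - sigma ^+ 2 * t * (cos (theta + t * x) * p x).
(* A primitive of [f], because p' = - x p / sigma^2. It vanishes at both infinities, hence the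
   integral of [f] is 0. *)
pose G (x : R) : R := - sigma ^+ 2 * (p x * sin (theta + t * x)).
have Gd x : is_derive x (1:R) G (f x).
  have hp := p_deriv x.
  by apply: trigger_derive; rewrite /GRing.scale/= /f; field.
have If : mu.-integrable setT (EFin \o f).
  by apply: (integrableB measurableT (Isin t) (integrableZl measurableT _ (Icos t))).
have cG : continuous G.
  move=> z; apply/differentiable_continuous; rewrite -derivable1_diffP.
  exact: (@ex_derive _ _ _ _ _ _ _ (Gd z)).
have cf : continuous f.
  have cp : continuous p.
    move=> z; apply/differentiable_continuous; rewrite -derivable1_diffP.
    exact: (@ex_derive _ _ _ _ _ _ _ (p_deriv z)).
  have ct x : (fun x => theta + t * x) @ x --> theta + t * x.
    by apply: cvgD; [exact: cvg_cst|apply: cvgM; [exact: cvg_cst|exact: cvg_id]].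
  move=> x; apply: cvgB.
    apply: cvgM; last exact: cp.
    apply: cvgM; first exact: cvg_id.
    by apply: (continuous_cvg _ _ (ct x)); exact: continuous_sin.
  apply: cvgM; first exact: cvg_cst.
  apply: cvgM; last exact: cp.
  by apply: (continuous_cvg _ _ (ct x)); exact: continuous_cos.
have FTC (n : nat) : \int[mu]_(x in `[- n.+1%:R, n.+1%:R]) f x = G n.+1%:R - G (- n.+1%:R).
  rewrite /Rintegral (@continuous_FTC2 _ f G)//.
  - by rewrite -subr_gt0 opprK addr_gt0.
  - exact: continuous_subspaceT.
  - split; first by move=> z _; exact: (@ex_derive _ _ _ _ _ _ _ (Gd z)).
      by apply: cvg_at_right_filter; exact: cG.
    by apply: cvg_at_left_filter; exact: cG.
  - by move=> z _; rewrite derive1E (@derive_val _ _ _ _ _ _ _ (Gd z)).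
have G0 : (fun n : nat => G n.+1%:R - G (- n.+1%:R)) @ \oo --> (0 : R).
  have Gbd (x : R) : x != 0 -> `|G x| <= sigma ^+ 2 * k / c * (x ^+ 2)^-1.
    move=> x0; have x20 : 0 < x ^+ 2 by rewrite exprn_even_gt0.
    rewrite /G normrM normrN (ger0_norm (ltW s2)).
    rewrite -[leRHS]mulrA -invfM -[leRHS]mulrA.
    rewrite ler_wpM2l ?(ltW s2)//.
    rewrite normrM (ger0_norm (p0 x)); apply: (@le_trans _ _ (p x)).
      by rewrite ler_piMr// sin_max.
    have cx : 0 < c * x ^+ 2 by rewrite mulr_gt0.
    rewrite /p ler_wpM2l ?(ltW k0)// expRN lef_pV2 ?posrE ?expR_gt0 ?cx//.
    by apply: le_trans (expR_ge1Dx _); rewrite lerDr.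
  apply/cvgrPdist_le => e e0.
  pose K := sigma ^+ 2 * k / c; have K0 : 0 < K by rewrite divr_gt0// mulr_gt0.
  exists (Num.truncn (2 * K / e)).+1 => // n /= hn.
  have n1 : 0 < n.+1%:R :> R by rewrite ltr0n.
  have h : 2 * K / e <= n.+1%:R.
    by rewrite ltW// (lt_le_trans (truncnS_gt _))// ler_nat ltnW// ltnS.
  rewrite sub0r normrN; apply: (le_trans (ler_normB _ _)).
  have h1 : `|G n.+1%:R| <= K * (n.+1%:R ^+ 2)^-1 by apply: Gbd; rewrite gt_eqF.
  have h2 : `|G (- n.+1%:R)| <= K * (n.+1%:R ^+ 2)^-1.
    by rewrite -sqrrN; apply: Gbd; rewrite oppr_eq0 gt_eqF.
  apply: (@le_trans _ _ (2 * K * (n.+1%:R ^+ 2)^-1)).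
    by rewrite -mulrA; move: h1 h2; set u := K * _; lra.
  rewrite ler_pdivrMr ?exprn_gt0//.
  move: h; rewrite ler_pdivrMr// => h; apply: (le_trans h).
  rewrite mulrC ler_wpM2l ?(ltW e0)// expr2 ler_peMl ?(ltW n1)//.
  by rewrite ler1n.
have cvgf : (fun n : nat => \int[mu]_(x in `[- n.+1%:R, n.+1%:R]) f x) @ \oo --> \int[mu]_x f x.
  have mf : measurable_fun setT f by case/integrableP : If => /measurable_EFinP.
  have [| | | | |If' _ h] := @dominated_convergence _ _ R mu setT measurableT
    (fun n x => (f x * \1_(`[- n.+1%:R, n.+1%:R]%classic : set R) x)%:E) (EFin \o f) (fun x => `|f x|%:E).
  - by move=> n; apply/measurable_EFinP; apply: measurable_funM => //; exact: measurable_indic.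
  - exact/measurable_EFinP.
  - apply: aeW => x _; apply: cvg_EFin; first exact: nearW.
    apply: cvg_near_cst; exists (Num.truncn `|x|).+1 => // n /= hn.
    rewrite indicE mem_set ?mulr1//= in_itv/= -ler_norml ltW//.
    by rewrite (lt_le_trans (truncnS_gt _))// ler_nat ltnW// ltnS.
  - by have := integrable_abse If.
  - apply: aeW => x n _; rewrite /= lee_fin normrM ler_piMr// indicE.
    by case: (_ \in _); rewrite ?normr1 ?normr0.
  apply: fine_cvg => /=; rewrite fineK; last exact: (integrable_fin_num measurableT If).
  apply: cvg_trans h; apply: near_eq_cvg; apply: nearW => n /=.
  rewrite [RHS]integral_mkcond; apply: eq_integral => x _.
  by rewrite patchE indicE; case: (_ \in _); rewrite /= ?mulr1 ?mulr0.
have f0 : \int[mu]_x f x = 0.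
  rewrite -(cvg_lim (@Rhausdorff R) cvgf) (funext FTC).
  exact: (cvg_lim (@Rhausdorff R) G0).
apply/eqP; rewrite -subr_eq0 /F -RintegralZl// -RintegralB//.
  by rewrite -[X in X == _]/(\int[mu]_x f x) f0.
exact: (integrableZl measurableT _ (Icos t)).
Qed.

(** Differentiation under the integral, dominated by |x| p(x); integration by parts closes the
    differential equation. Keeping [theta] arbitrary spares a companion equation for the sine
    transform. *)
Let F_deriv t : is_derive t (1:R) F (- (sigma ^+ 2 * t * F t)).
Proof.
have d1 (s x : R) : is_derive s (1:R) (fun s => cos (theta + s * x) * p x) (- (x * sin (theta + s * x) * p x)).
  by apply: trigger_derive; rewrite /GRing.scale/=; ring.
have Ib s : s \in (`]t - 1, t + 1[%classic : set R) ->
    mu.-integrable setT (EFin \o (fun x => cos (theta + s * x) * p x)) by move=> _; exact: Icos.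
have ta : (`]t - 1, t + 1[%classic : set R) t by rewrite /= in_itv/=; apply/andP; split; lra.
have Gub s y : `|partial1of2 (fun s x => cos (theta + s * x) * p x) s y| <= `|y| * p y.
  rewrite partial1of2E (@derive_val _ _ _ _ _ _ _ (d1 s y)).
  by rewrite normrN normrM (ger0_norm (p0 y)) ler_wpM2r// normrM ler_piMr// sin_max.
have der (s x : R) : derivable (fun s : R => cos (theta + s * x) * p x) s 1.
  exact: (@ex_derive _ _ _ _ _ _ _ (d1 s x)).
have G0 y : 0 <= `|y| * p y by rewrite mulr_ge0.
have dF := @derivable_under_integral R _ _ mu (fun s x => cos (theta + s * x) * p x) setT measurableT
  t (t - 1) (t + 1) ta (fun s _ => Icos s) (fun s x _ _ => der s x) (fun y => `|y| * p y) G0 Ixp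
  (fun s y _ _ => Gub s y).
have dE := @differentiation_under_integral R _ _ mu (fun s x => cos (theta + s * x) * p x) setT measurableT
  t (t - 1) (t + 1) ta (fun s _ => Icos s) (fun s x _ _ => der s x) (fun y => `|y| * p y) G0 Ixp
  (fun s y _ _ => Gub s y).
apply: DeriveDef => //; rewrite -derive1E dE -ibp.
rewrite -[RHS]mulN1r -(RintegralZl (-1) measurableT (Isin t)).
apply: eq_Rintegral => x _.
by rewrite partial1of2E (@derive_val _ _ _ _ _ _ _ (d1 t x)) mulN1r.
Qed.

(** The linear equation is solved by checking that [F] times the inverse Gaussian factor has
    derivative 0. *)
Lemma normal_pdf_cos t :
  \int[mu]_x (cos (theta + t * x) * normal_pdf 0 sigma x) =
  cos theta * expR (- (sigma ^+ 2 * t ^+ 2 / 2)).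
Proof.
under eq_Rintegral do rewrite normal_pdf0E.
rewrite -/(F t).
pose H t := F t * expR (sigma ^+ 2 * t ^+ 2 / 2).
have Hd s : is_derive s (1:R) H 0.
  have := F_deriv s => hF.
  by apply: trigger_derive; rewrite /GRing.scale/=; field.
have HE : H t = H 0 by exact: is_derive_0_is_cst.
have F0 : F 0 = cos theta.
  rewrite /F; under eq_Rintegral do rewrite mul0r addr0.
  rewrite RintegralZl//; rewrite -[RHS]mulr1; congr (_ * _).
  rewrite /Rintegral; under eq_integral do rewrite -normal_pdf0E.
  by rewrite integral_normal_pdf.
move: HE; rewrite /H F0 expr0n/= mulr0 mul0r expR0 mulr1 => <-.
by rewrite -[RHS]mulrA expRxMexpNx_1 mulr1.
Qed.

Lemma normal_prob_sq_integrable : sq_integrable (normal_prob 0 sigma) (fun x : R => x).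
Proof.
split; first exact: measurable_id.
apply/integrableP; split; first by apply/measurable_EFinP; exact: measurable_funX.
rewrite (@ge0_integral_density _ _ _ mu _ (normal_pdf 0 sigma)) //.
- case/integrableP : Ip2 => _; apply: le_lt_trans; apply: ge0_le_integral => //.
  + by move=> x _; rewrite mule_ge0// lee_fin normal_pdf_ge0.
  + apply: emeasurable_funM; apply/measurable_EFinP; last exact: measurable_normal_pdf.
    by apply: measurableT_comp => //; exact: measurable_funX.
  + apply/measurable_EFinP; apply: measurableT_comp => //; apply: measurable_funM => //.
    by apply: measurable_funD => //; exact: measurable_funX.
  + move=> x _; rewrite /= -EFinM lee_fin normal_pdf0E !ger0_norm ?sqr_ge0//.
      by rewrite ler_wpM2r// lerDr.
    by rewrite mulr_ge0// addr_ge0// sqr_ge0.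
- exact: measurable_normal_pdf.
- by move=> x; exact: normal_pdf_ge0.
- by apply/measurable_EFinP; apply: measurableT_comp => //; exact: measurable_funX.
Qed.

Lemma normal_prob_cos t :
  \int[normal_prob 0 sigma]_x cos (theta + t * x) =
  cos theta * expR (- (sigma ^+ 2 * t ^+ 2 / 2)).
Proof.
(* The density formula is for nonnegative functions, so 1 is added to the cosine and its integral
   cancelled at the end. *)
have m1c : measurable_fun setT (fun x : R => 1 + cos (theta + t * x)) by exact: measurable_funD.
have c1 x : 0 <= 1 + cos (theta + t * x) by have := cos_geN1 (theta + t * x); lra.
have Ic : (normal_prob 0 sigma).-integrable setT (EFin \o (fun x => cos (theta + t * x))).
  by apply: (@bounded_integrable _ _ _ _ _ 1) => [|x]; [exact: mcos|exact: cos_max].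
have := @ge0_integral_density _ _ _ mu (normal_prob 0 sigma) (normal_pdf 0 sigma)
  (measurable_normal_pdf 0 sigma) (normal_pdf_ge0 0 sigma) (fun _ _ => erefl)
  (fun x => (1 + cos (theta + t * x))%:E).
move=> /(_ _ _)/(congr1 fine) h.
have {h} : \int[normal_prob 0 sigma]_x (1 + cos (theta + t * x)) =
   \int[mu]_x ((1 + cos (theta + t * x)) * normal_pdf 0 sigma x).
  by apply: h => //; exact/measurable_EFinP.
rewrite (RintegralD measurableT (cst_integrable _ 1) Ic) Rintegral_bounded_cst.
under [X in _ = X -> _]eq_Rintegral do rewrite mulrDl mul1r.
rewrite [X in _ = X -> _]RintegralD//.
- rewrite normal_pdf_cos (_ : \int[mu]_x normal_pdf 0 sigma x = 1); first by move/addrI.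
  by rewrite /Rintegral integral_normal_pdf.
- exact: integrable_normal_pdf.
- by have := Icos t; congr (integrable _ _ _); apply/funext => x /=; rewrite normal_pdf0E.
Qed.

End normal_characteristic_function.

Section laws.
Context d d' {T : measurableType d} {T' : measurableType d'} {R : realType}.
Variables (P : probability T R) (f : T -> T').
Hypothesis mf : measurable_fun setT f.

Definition mfun_of : {mfun T >-> T'} :=
  MeasurableFun.Pack (MeasurableFun.Class (isMeasurableFun.Build _ _ _ _ f mf)).

Definition law : probability T' R := distribution P mfun_of.

Lemma lawE A : law A = P (f @^-1` A). Proof. by []. Qed.

Lemma Rintegral_law (g : T' -> R) (B : R) : measurable_fun setT g -> (forall y, `|g y| <= B) ->
  \int[law]_y g y = \int[P]_w g (f w).
Proof.
move=> mg gB; rewrite /Rintegral /law integral_distribution//; first exact/measurable_EFinP.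
by apply: (@bounded_integrable _ _ _ P (g \o f) B) => [|w]; [exact: measurableT_comp|exact: gB].
Qed.

End laws.

Section half_lines.
Context {R : realType}.

Definition half_line (x : R) : set R := `]-oo, x]%classic.

Lemma measurable_half_line x : measurable (half_line x).
Proof. exact: measurable_itv. Qed.

Lemma measurable_half_lineE : @measurable _ R = <<s range half_line >>.
Proof.
rewrite eqEsubset; split; last first.
  apply: smallest_sub; first exact: sigma_algebra_measurable.
  by move=> _ [x _ <-]; exact: measurable_half_line.
have -> : @measurable _ R = <<s @RGenOInfty.G R >> by exact: RGenOInfty.measurableE.
apply: smallest_sub; first exact: smallest_sigma_algebra.
move=> _ [x ->].
rewrite -[`]x, +oo[%classic]setCK.
have [_ sC _] := @smallest_sigma_algebra _ setT (range half_line).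
rewrite -setTD; apply: sC; apply: sub_sigma_algebra; exists x => //.
by rewrite setCitvr.
Qed.

Lemma measurable_fun_half_line d (T : measurableType d) (f : T -> R) :
  (forall x, measurable (f @^-1` half_line x)) -> measurable_fun setT f.
Proof.
move=> h; apply: (@measurability _ _ T R setT f (range half_line)) => //.
  exact: measurable_half_lineE.
by move=> _ [_ [x _ <-] <-]; rewrite setTI.
Qed.

Lemma measure_unique_half_lines (m1 m2 : {measure set R -> \bar R}) :
  (m1 setT < +oo)%E -> (forall x, m1 (half_line x) = m2 (half_line x)) ->
  forall A, measurable A -> m1 A = m2 A.
Proof.
move=> m1oo h; apply: (measure_unique (range half_line) (fun n : nat => half_line n%:R)).
- exact: measurable_half_lineE.
- move=> _ _ [x _ <-] [y _ <-]; exists (Num.min x y) => //.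
  by apply/seteqP; split=> z; rewrite /half_line/= !in_itv/= le_min => /andP.
- by move=> n; exists n%:R.
- rewrite -subTset => x _; exists (Num.truncn `|x|).+1 => //.
  rewrite /half_line/= in_itv/= (le_trans (ler_norm _))// ltW//.
  exact: truncnS_gt.
- by move=> _ [x _ <-].
- move=> n; apply: le_lt_trans m1oo; apply: le_measure; rewrite ?inE//.
  exact: measurable_half_line.
Qed.

End half_lines.

(** * Independent uniform variables from binary digits *)

Section uniform_digits.
Context {R : realType}.

Lemma measurable_id_TypeR : measurable_fun setT (id : measurableTypeR R -> R).
Proof. by move=> _ A mA; rewrite setTI. Qed.

(* [R] and [measurableTypeR R] carry the same sigma-algebra under different displays. *)
Definition unif : probability R R :=
  law (uniform_prob (@ltr01 R)) measurable_id_TypeR.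


(** The distribution function of the uniform law on [0, 1]. *)
Definition clip (s : R) : R := Num.max 0 (Num.min s 1).

Lemma unifE A :
  unif A = (\int[lebesgue_measure]_(x in (A `&` `[0%R, 1%R])%classic) (uniform_pdf 0 1 x)%:E)%E.
Proof. by rewrite /unif lawE; exact: integral_uniform_pdf. Qed.

Lemma unif_half_line s : unif (half_line s) = (clip s)%:E.
Proof.
rewrite unifE.
have pdf1 x : (x \in `[0, 1]) -> uniform_pdf 0 1 x = 1 :> R.
  by rewrite in_itv/= /uniform_pdf => ->; rewrite subr0 invr1.
have -> : half_line s `&` `[0, 1] = [set` `[0, Num.min s 1]] :> set R.
  apply/seteqP; split=> x; rewrite /half_line/= !in_itv/= le_min.
    by move=> [-> /andP[-> ->]].
  by move=> /andP[-> /andP[-> ->]].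
rewrite (eq_integral (cst 1%E)); last first.
  move=> x; rewrite inE/= in_itv/= le_min => /and3P[x0 _ x1].
  by rewrite pdf1// in_itv/= x0.
rewrite integral_cst//= mul1e lebesgue_measure_itv/= lte_fin /clip.
have [h|h] := ltP 0 (Num.min s 1); first by rewrite oppr0 adde0.
by [].
Qed.

(** The digit and quantile identities hold only strictly between 0 and 1; the endpoints and the
    outside are null. *)
Lemma unif_eq (A B : set R) : measurable A -> measurable B ->
  (forall x, 0 < x < 1 -> A x <-> B x) -> unif A = unif B.
Proof.
have D0 : unif (~` `]0, 1[%classic) = 0%E.
  rewrite unifE.
  have -> : ~` `]0, 1[%classic `&` `[0, 1] = [set 0; 1] :> set R.
    apply/seteqP; split=> x /=; rewrite !in_itv/=.
      move=> [/negP + /andP[]]; rewrite negb_and -!leNgt => /orP[h1 h2 h3|h1 h2 h3].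
        by left; apply/eqP; rewrite eq_le h1.
      by right; apply/eqP; rewrite eq_le h3.
    by move=> [->|->]; rewrite ?lexx ?ler01 ?ltxx ?andbF.
  apply: null_set_integral; first by apply: measurableU.
    by apply: measurable_funTS; apply/measurable_EFinP; exact: measurable_uniform_pdf.
  by apply: countable_lebesgue_measure0; apply/finite_set_countable/finite_set2.
have h C : measurable C -> unif C = unif (C `&` `]0, 1[%classic).
  move=> mC; rewrite -[in LHS](setIT C) -(setUv `]0, 1[%classic) setIUr measureU//.
  - rewrite [X in (_ + X)%E](_ : _ = 0%E) ?adde0//.
    apply/eqP; rewrite eq_le measure_ge0 andbT -D0.
    by apply: le_measure; rewrite ?inE//; [apply: measurableI => //|]; exact: measurableC.
  - exact: measurableI.
  - by apply: measurableI => //; exact: measurableC.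
  - by rewrite setIACA setICr setI0.
move=> mA mB AB; rewrite h// [RHS]h//; congr (unif _).
apply/seteqP; split=> x /= [+ x01]; have := x01; rewrite in_itv/= => x01' ?;
  by split => //; apply/(AB x x01').
Qed.

(** Prepends the binary digit [i] to the expansion of y; an inverse branch of the doubling map. *)
Definition branch (i : R) (y : R) : R := (y + i) / 2.

Lemma measurable_branch i : measurable_fun setT (branch i).
Proof. by apply: measurable_funM => //; exact: measurable_funD. Qed.

Let inv2_ge0 : 0 <= 2^-1 :> R. Proof. by rewrite invr_ge0. Qed.

Let half : {nonneg R} := NngNum inv2_ge0.

(* The first binary digit of a uniform variable is fair and independent of the others, which form a
   uniform variable again. *)
Lemma unif_branch (C : set R) : measurable C ->
  (unif C = 2^-1%:E * unif (branch 0 @^-1` C) + 2^-1%:E * unif (branch 1 @^-1` C))%E.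
Proof.
move=> mC.
pose m2 := measure_add (mscale half (law unif (measurable_branch 0)))
                       (mscale half (law unif (measurable_branch 1))).
have E (A : set R) : m2 A = (2^-1%:E * unif (branch 0 @^-1` A) + 2^-1%:E * unif (branch 1 @^-1` A))%E.
  by rewrite /m2 measure_addE.
rewrite -E; apply: (@measure_unique_half_lines _ unif m2) => //.
  exact: le_lt_trans (probability_le1 unif measurableT) (ltry 1).
move=> x; apply: etrans (esym (E (half_line x))).
have bE (i : R) : branch i @^-1` (half_line x) = half_line (2 * x - i).
  apply/seteqP; split=> y; rewrite /half_line/branch/= !in_itv/= ler_pdivrMr// mulrC;
    by rewrite lerBrDr.
apply: etrans (unif_half_line x) _.
rewrite !bE !unif_half_line -!EFinM -EFinD subr0; congr EFin; rewrite /clip.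
have [x0|x0] := leP x 0.
  rewrite !(@max_l _ _ 0)//; [lra|..]; rewrite ge_min; apply/orP; left; lra.
have [x1|x1] := leP 1 x.
  by rewrite !(@min_r _ _ _ 1) ?(@max_r _ _ 0 1)//; lra.
have [x2|x2] := leP (2 * x) 1.
  rewrite (@min_l _ _ (2 * x - 1)); last by lra.
  rewrite (@max_l _ _ 0 (2 * x - 1)); last by lra.
  by rewrite !max_r; lra.
rewrite (@min_l _ _ (2 * x - 1)); last by lra.
by rewrite !max_r; lra.
Qed.

Definition digit (x : R) : R := (2^-1 <= x)%R%:R.
Definition doubling (x : R) : R := 2 * x - digit x.

Lemma measurable_digit : measurable_fun setT digit.
Proof.
rewrite (_ : digit = fun x => if 2^-1 <= x then 1 else 0).
  by apply: measurable_fun_ifT => //; exact: measurable_fun_ler.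
by apply/funext => x; rewrite /digit; case: (_ <= _).
Qed.

Lemma measurable_doubling : measurable_fun setT doubling.
Proof. by apply: measurable_funB; [exact: measurable_funM|exact: measurable_digit]. Qed.

Lemma digit_bound x : 0 <= digit x <= 1.
Proof. by rewrite /digit; case: (2^-1 <= x); rewrite /= ?lexx ?ler01. Qed.

Lemma digit_branch (b : bool) (y : R) : 0 < y < 1 ->
  digit (branch b%:R y) = b%:R /\ doubling (branch b%:R y) = y.
Proof.
move=> /andP[y0 y1]; suff E : digit (branch b%:R y) = b%:R.
  by split => //; rewrite /doubling E /branch mulrC divfK ?pnatr_eq0// addrK.
rewrite /digit /branch; case: b => /=.
  suff -> : (2^-1 <= (y + 1) / 2) by [].
  by rewrite ler_pdivlMr// mulVf ?pnatr_eq0//; lra.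
suff -> : (2^-1 <= (y + 0) / 2) = false by [].
by apply/negbTE; rewrite -ltNge ltr_pdivrMr// mulVf ?pnatr_eq0//; lra.
Qed.

(* The number whose binary digits are those of x of even rank, counted from 0. *)
Fixpoint even_approx (n : nat) (x : R) : R :=
  if n is m.+1 then (digit x + even_approx m (doubling (doubling x))) / 2 else 0.

Lemma even_approx_bound n x : 0 <= even_approx n x <= 1.
Proof.
elim: n x => [|n ih] x /=; first by rewrite lexx ler01.
have /andP[h1 h2] := ih (doubling (doubling x)); have /andP[h3 h4] := digit_bound x.
by apply/andP; split; lra.
Qed.

Lemma even_approx_nd x : nondecreasing_seq (even_approx ^~ x).
Proof.
apply/nondecreasing_seqP => n; elim: n x => [|n ih] x.
  by have /andP[] := even_approx_bound 1 x.
by rewrite /= ler_pM2r ?invr_gt0// lerD2l; exact: ih.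
Qed.

Definition even_part (x : R) : R := lim (even_approx ^~ x @ \oo).
Definition odd_part (x : R) : R := even_part (doubling x).

Lemma even_part_cvg x : even_approx ^~ x @ \oo --> even_part x.
Proof.
apply: nondecreasing_is_cvgn; first exact: even_approx_nd.
by exists 1 => _ [n _ <-]; have /andP[] := even_approx_bound n x.
Qed.

Lemma even_part_bound x : 0 <= even_part x <= 1.
Proof.
have cv : cvgn (even_approx ^~ x) by apply/cvg_ex; exists (even_part x); exact: even_part_cvg.
apply/andP; split.
  by apply: limr_ge => //; apply: nearW => n; have /andP[] := even_approx_bound n x.
by apply: limr_le => //; apply: nearW => n; have /andP[] := even_approx_bound n x.
Qed.

(** Removing one digit exchanges the two ranks: after [doubling], the former odd part is the even
    part, and the rest of the former even part is the odd part. *)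
Lemma even_partE x : even_part x = (digit x + odd_part (doubling x)) / 2.
Proof.
have h1 : (fun n => even_approx n.+1 x) @ \oo --> even_part x.
  by rewrite (cvg_shiftS (even_approx ^~ x)); exact: even_part_cvg.
have h2 : (fun n => even_approx n.+1 x) @ \oo --> (digit x + odd_part (doubling x)) / 2.
  apply: cvgM; last exact: cvg_cst.
  by apply: cvgD; [exact: cvg_cst|exact: even_part_cvg].
by rewrite -(cvg_lim (@Rhausdorff R) h1) (cvg_lim (@Rhausdorff R) h2).
Qed.

Lemma measurable_even_part : measurable_fun setT even_part.
Proof.
apply: (@measurable_fun_cvg _ R R setT even_approx) => [n|x _]; last exact: even_part_cvg.
elim: n => [|n ih]; first exact: measurable_cst.
apply: measurable_funM => //; apply: measurable_funD; first exact: measurable_digit.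
exact: (measurableT_comp (measurableT_comp ih measurable_doubling) measurable_doubling).
Qed.

Lemma measurable_odd_part : measurable_fun setT odd_part.
Proof. exact: (measurableT_comp measurable_even_part measurable_doubling). Qed.

Let quadrant (s t : R) : set R := even_part @^-1` half_line s `&` odd_part @^-1` half_line t.

Let measurable_quadrant s t : measurable (quadrant s t).
Proof.
apply: measurableI; rewrite -[X in measurable X]setTI.
  exact: measurable_even_part measurableT _ (measurable_half_line s).
exact: measurable_odd_part measurableT _ (measurable_half_line t).
Qed.

(** Joint distribution function of the two digit parts. *)
Let H s t : R := fine (unif (quadrant s t)).

Let HE s t : unif (quadrant s t) = (H s t)%:E.
Proof. by rewrite /H fineK// fin_num_measure. Qed.

Let H01 s t : 0 <= H s t <= 1.
Proof. by rewrite -!lee_fin -HE measure_ge0 probability_le1. Qed.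

(* The product [clip s * clip t] satisfies the same recursion, so that its distance to H is halved at
   each step and vanishes. *)
Let H_rec s t : H s t = (H t (2 * s) + H t (2 * s - 1)) / 2.
Proof.
apply: EFin_inj; rewrite -HE (unif_branch (measurable_quadrant s t)).
have E (b : bool) : unif (branch b%:R @^-1` quadrant s t) = unif (quadrant t (2 * s - b%:R)).
  apply: unif_eq => //.
    by rewrite -[X in measurable X]setTI; apply: measurable_branch => //; exact: measurable_quadrant.
  move=> y y01; have [h1 h2] := digit_branch b y01.
  rewrite /quadrant /half_line /= !in_itv/= even_partE h1 {1}/odd_part h2.
  have -> : odd_part (branch b%:R y) = even_part y by rewrite /odd_part h2.
  by rewrite ler_pdivrMr// lerBrDl [s * 2]mulrC; split=> -[].
have := E false; have := E true; rewrite /= => -> ->.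
rewrite !HE -!EFinM -EFinD subr0; congr EFin.
by rewrite -mulrDr mulrC.
Qed.

Let clip_rec s : clip s = (clip (2 * s) + clip (2 * s - 1)) / 2.
Proof.
apply: EFin_inj; rewrite -unif_half_line (unif_branch (measurable_half_line s)).
have bE (i : R) : branch i @^-1` (half_line s) = half_line (2 * s - i).
  by apply/seteqP; split=> y; rewrite /half_line/branch/= !in_itv/= ler_pdivrMr// mulrC lerBrDr.
rewrite !bE !unif_half_line -!EFinM -EFinD subr0; congr EFin.
by rewrite -mulrDr mulrC.
Qed.

Let clip0 s : s < 0 -> clip s = 0.
Proof. by move=> s0; rewrite /clip max_l// ge_min ltW. Qed.

Let clip1 s : 1 <= s -> clip s = 1.
Proof. by move=> s1; rewrite /clip min_r// max_r. Qed.

Let clip01 s : 0 <= clip s <= 1.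
Proof. by rewrite /clip le_max lexx ge_max ler01 ge_min lexx orbT. Qed.

Let Hneg s t : s < 0 \/ t < 0 -> H s t = 0.
Proof.
move=> st; rewrite /H; suff -> : quadrant s t = set0 by rewrite measure0.
apply/seteqP; split=> x //; rewrite /quadrant/half_line/= !in_itv/= => -[h1 h2].
have /andP[a0 _] := even_part_bound x; have /andP[b0 _] := even_part_bound (doubling x).
by rewrite /odd_part in h2; case: st => h; lra.
Qed.

Let Hs1 s s' t : 1 <= s -> 1 <= s' -> H s t = H s' t.
Proof.
move=> h h'; rewrite /H; congr (fine (unif _)).
apply/seteqP; split=> x; rewrite /quadrant/half_line/= !in_itv/= => -[h1 h2]; split => //;
  have /andP[_ a1] := even_part_bound x; lra.
Qed.

Let Ht1 s t t' : 1 <= t -> 1 <= t' -> H s t = H s t'.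
Proof.
move=> h h'; rewrite /H; congr (fine (unif _)).
apply/seteqP; split=> x; rewrite /quadrant/half_line/= !in_itv/= => -[h1 h2]; split => //;
  have /andP[_ a1] := even_part_bound (doubling x); rewrite /odd_part; lra.
Qed.

Let H11 s t : 1 <= s -> 1 <= t -> H s t = 1.
Proof.
move=> hs ht; rewrite /H (_ : quadrant s t = setT) ?probability_setT//.
apply/seteqP; split=> x // _; rewrite /quadrant/half_line/= !in_itv/=.
by have /andP[_ a1] := even_part_bound x; have /andP[_ b1] := even_part_bound (doubling x);
  rewrite /odd_part; split; lra.
Qed.

Let small_eq0 (x : R) : (forall n, `|x| <= 2^-1 ^+ n) -> x = 0.
Proof.
move=> h; apply/eqP; rewrite -normr_le0; apply/ler_addgt0Pl => e e0; rewrite addr0.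
have : (fun n => 2^-1 ^+ n : R) @ \oo --> (0 : R).
  by apply: cvg_expr; rewrite ger0_norm ?invr_ge0// invf_lt1// ltr1n.
move/cvgrPdist_le => /(_ _ e0)[n _ /(_ n (leqnn n))]/=.
by rewrite sub0r normrN ger0_norm ?exprn_ge0 ?invr_ge0//; apply: le_trans.
Qed.

(** The argument 2 stands for infinity, since the parts never exceed 1. For t in [0, 1[ one of the
    two terms of the recursion is trivial, 0 when 2 t < 1 and 1 otherwise, so the difference is half
    of another difference of the same kind. *)
Let H_even t : H t 2 = clip t.
Proof.
apply/eqP; rewrite -subr_eq0; apply/eqP; apply: small_eq0 => n.
elim: n t => [|n ih] t.
  have /andP[? ?] := H01 t 2; have /andP[? ?] := clip01 t.
  by rewrite expr0 ler_norml; apply/andP; split; lra.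
have n0 : 0 <= 2^-1 ^+ n :> R by rewrite exprn_ge0// invr_ge0.
have HH u : H 2 u = H u 2.
  by rewrite H_rec (@Ht1 u (2 * 2) 2) ?(@Ht1 u (2 * 2 - 1) 2); lra.
rewrite exprS; have [t0|t0] := ltP t 0.
  by rewrite Hneg; [rewrite clip0// subrr normr0 mulr_ge0|left].
have [t1|t1] := leP 1 t.
  by rewrite H11 ?clip1// ?subrr ?normr0 ?mulr_ge0//; lra.
rewrite H_rec clip_rec !HH.
have [t2|t2] := ltP (2 * t) 1.
  rewrite (@Hneg (2 * t - 1)); last by left; lra.
  rewrite (@clip0 (2 * t - 1)); last by lra.
  rewrite !addr0 -mulrBl normrM [X in _ * X]ger0_norm ?invr_ge0// mulrC.
  by rewrite ler_pM2l ?invr_gt0.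
rewrite (@H11 (2 * t))//; last by lra.
rewrite (clip1 t2) (_ : _ - _ = 2^-1 * (H (2 * t - 1) 2 - clip (2 * t - 1))); last by field.
by rewrite normrM ger0_norm ?invr_ge0// ler_pM2l ?invr_gt0.
Qed.

Let H_odd t : H 2 t = clip t.
Proof. by rewrite H_rec (@Ht1 t (2 * 2) 2) ?(@Ht1 t (2 * 2 - 1) 2) ?H_even; lra. Qed.

(** Same halving as for the marginals, which have to be known first: when 2 s >= 1, one term of the
    recursion is the marginal [H t 2]. *)
Let H_prod s t : H s t = clip s * clip t.
Proof.
apply/eqP; rewrite -subr_eq0; apply/eqP; apply: small_eq0 => n.
elim: n s t => [|n ih] s t.
  have /andP[? ?] := H01 s t; have /andP[? ?] := clip01 s; have /andP[? ?] := clip01 t.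
  by rewrite expr0 ler_norml; apply/andP; split; nra.
have n0 : 0 <= 2^-1 ^+ n :> R by rewrite exprn_ge0// invr_ge0.
have i2 : 0 <= 2^-1 :> R by rewrite invr_ge0.
rewrite exprS; have [s0|s0] := ltP s 0.
  by rewrite Hneg; [rewrite clip0// mul0r subrr normr0 mulr_ge0|left].
have [t0|t0] := ltP t 0.
  by rewrite Hneg; [rewrite (clip0 t0) mulr0 subrr normr0 mulr_ge0|right].
have [s1|s1] := leP 1 s.
  by rewrite (@Hs1 s 2) ?H_odd ?(clip1 s1) ?mul1r ?subrr ?normr0 ?mulr_ge0//; lra.
have [t1|t1] := leP 1 t.
  by rewrite (@Ht1 s t 2) ?H_even ?(clip1 t1) ?mulr1 ?subrr ?normr0 ?mulr_ge0//; lra.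
rewrite H_rec (clip_rec s).
have [s2|s2] := ltP (2 * s) 1.
  rewrite (@Hneg t (2 * s - 1)); last by right; lra.
  rewrite (@clip0 (2 * s - 1)); last by lra.
  rewrite !addr0 (_ : _ - _ = 2^-1 * (H t (2 * s) - clip t * clip (2 * s))); last by field.
  by rewrite normrM ger0_norm// ler_pM2l ?invr_gt0.
rewrite (@Ht1 t (2 * s) 2)// ?H_even; last by lra.
rewrite (clip1 s2) (_ : _ - _ = 2^-1 * (H t (2 * s - 1) - clip t * clip (2 * s - 1))); last by field.
by rewrite normrM ger0_norm// ler_pM2l ?invr_gt0.
Qed.

(** Uniqueness of finite measures on half-lines is used twice: first in [A] with a half-line in
    place of [B], then in [B]. Full sets show that each part is again uniform. *)
Lemma unif_even_odd_independent (A B : set R) : measurable A -> measurable B ->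
  (unif (even_part @^-1` A `&` odd_part @^-1` B) = unif A * unif B)%E.
Proof.
move=> mA mB.
have mpre (f : R -> R) C : measurable_fun setT f -> measurable C -> measurable (f @^-1` C).
  by move=> mf mC; rewrite -[X in measurable X]setTI; exact: mf.
have step t : (unif (even_part @^-1` A `&` odd_part @^-1` half_line t) = unif A * unif (half_line t))%E.
  have mO : measurable (odd_part @^-1` half_line t).
    by apply: mpre; [exact: measurable_odd_part|exact: measurable_half_line].
  have c0 : 0 <= clip t by have /andP[] := clip01 t.
  pose m1 := pushforward (mrestr unif mO) (mfun_of measurable_even_part).
  pose m2 := mscale (NngNum c0) unif.
  have E1 C : m1 C = unif (even_part @^-1` C `&` odd_part @^-1` half_line t) by [].
  have E2 C : m2 C = (unif C * unif (half_line t))%E by rewrite /m2/mscale/= unif_half_line muleC.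
  rewrite -E1 -E2; apply: (@measure_unique_half_lines _ m1 m2) => //.
    apply: (@le_lt_trans _ _ 1%E); [|exact: ltry]; apply: (@probability_le1 _ _ _ unif).
    by apply: measurableI => //; apply: mpre => //; exact: measurable_even_part.
  move=> s; apply: etrans (E1 _) _; apply: etrans (esym (E2 _)).
  by rewrite !unif_half_line -EFinM -H_prod -HE.
have mE : measurable (even_part @^-1` A) by apply: mpre => //; exact: measurable_even_part.
have p0 : 0 <= fine (unif A) by rewrite fine_ge0// measure_ge0.
pose m1 := pushforward (mrestr unif mE) (mfun_of measurable_odd_part).
pose m2 := mscale (NngNum p0) unif.
have E1 C : m1 C = unif (odd_part @^-1` C `&` even_part @^-1` A) by [].
have E2 C : m2 C = (unif A * unif C)%E by rewrite /m2/mscale/= fineK// fin_num_measure.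
rewrite setIC -E1 -E2; apply: measure_unique_half_lines => //.
  apply: (@le_lt_trans _ _ 1%E); [|exact: ltry]; apply: (@probability_le1 _ _ _ unif).
  by apply: measurableI => //; apply: mpre => //; exact: measurable_odd_part.
by move=> t; apply: etrans (E1 _) _; apply: etrans (esym (E2 _)); rewrite setIC step.
Qed.

End uniform_digits.

Section independent_pair.
Context d d1 d2 {T : measurableType d} {T1 : measurableType d1} {T2 : measurableType d2}
  {R : realType}.
Variables (P : probability T R) (m1 : probability T1 R) (m2 : probability T2 R).
Variables (f : T -> T1) (g : T -> T2).
Hypotheses (mf : measurable_fun setT f) (mg : measurable_fun setT g).
Hypothesis fg_indep : forall A B, measurable A -> measurable B ->
  P (f @^-1` A `&` g @^-1` B) = (m1 A * m2 B)%E.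

(** By [fg_indep] the law of the pair agrees with the product measure on rectangles, hence
    everywhere; Fubini's theorem does the rest. *)
Lemma Rintegral_independent_pair (h : T1 * T2 -> R) (C : R) :
  measurable_fun setT h -> (forall z, `|h z| <= C) ->
  \int[P]_w h (f w, g w) = \int[m1]_x \int[m2]_y h (x, y).
Proof.
move=> mh hC.
have mfg : measurable_fun setT (fun w => (f w, g w)) by exact: measurable_fun_pair.
rewrite -(@Rintegral_law _ _ _ _ _ P _ mfg h C)//.
have E (A : set (T1 * T2)) : measurable A -> law P mfg A = (m1 \x m2)%E A.
  move=> mA; apply: esym; apply: (@product_measure_unique _ _ _ _ _ m1 m2 (law P mfg)) ; last exact: mA.
  by move=> A1 A2; exact: fg_indep.
have /integrableP[_ ifin] := @bounded_integrable _ _ _ (law P mfg) h C mh hC.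
have ih : (m1 \x m2)%E.-integrable setT (EFin \o h).
  apply/integrableP; split; first exact/measurable_EFinP.
  by rewrite -(@eq_measure_integral _ _ _ _ _ (law P mfg)) => [|A mA _]; [exact: ifin|exact: E].
rewrite [in LHS]/Rintegral (@eq_measure_integral _ _ _ _ (m1 \x m2)%E); last first.
  by move=> A mA _; exact: E.
rewrite -integral12_prod_meas1// /Rintegral; congr fine; apply: eq_integral => x _.
rewrite /fubini_F fineK//; apply: integrable_fin_num => //.
apply: (@bounded_integrable _ _ _ m2 (fun y => h (x, y)) C) => [|y]; last exact: hC.
exact: measurableT_comp mh (pair1_measurable x).
Qed.

End independent_pair.

(** * Quantile transform *)

Section quantile.
Context {R : realType}.
Variable nu : probability R R.

(** Generalized inverse of the distribution function of [nu]. The value 0 outside ]0, 1[ is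
    arbitrary: [unif] gives no mass there. *)
Definition quantile (u : R) : R :=
  if 0 < u < 1 then inf [set x | (u%:E <= nu (half_line x))%E] else 0.

Let id_rv : {mfun R >-> R} := mfun_of (@measurable_id _ R setT).

Let cdfE x : nu (half_line x) = cdf (id_rv : {RV nu >-> R}) x.
Proof. by []. Qed.

Lemma nu_half_line_nd x y : x <= y -> (nu (half_line x) <= nu (half_line y))%E.
Proof. by rewrite !cdfE; exact: cdf_nondecreasing. Qed.

Let nu_fin x : (fine (nu (half_line x)))%:E = nu (half_line x).
Proof. by rewrite fineK// fin_num_measure//; exact: measurable_half_line. Qed.

(** Right continuity of the distribution function makes the infimum a minimum; the limits at both
    infinities make the set nonempty and bounded below. *)
Lemma quantile_le u x : 0 < u < 1 -> (quantile u <= x) = (u%:E <= nu (half_line x))%E.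
Proof.
move=> u01; have /andP[u0 u1] := u01; rewrite /quantile u01.
set S := [set x | _].
have S0 : S !=set0.
  have [x' hx'] := filter_ex (cvgr_gt _ (fine_cvg (cvg_cdfy1 (id_rv : {RV nu >-> R}))) _ u1).
  by exists x'; rewrite /S /= -(nu_fin x') lee_fin ltW.
have Slb : has_lbound S.
  have [x' hx'] := filter_ex (cvgr_lt _ (fine_cvg (cvg_cdfNy0 (id_rv : {RV nu >-> R}))) _ u0).
  exists x' => y Sy; rewrite leNgt; apply/negP => yx'.
  have := le_trans Sy (nu_half_line_nd (ltW yx')); rewrite -nu_fin lee_fin leNgt.
  by move=> /negP; apply.
have Sup a b : S a -> a <= b -> S b.
  by move=> Sa ab; exact: le_trans Sa (nu_half_line_nd ab).
apply/idP/idP => [h|h]; last exact: ge_inf.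
have hy y : x < y -> (u%:E <= cdf (id_rv : {RV nu >-> R}) y)%E.
  move=> xy; have [z Sz zy] := inf_lt S0 (le_lt_trans h xy).
  by apply: Sup Sz (ltW zy).
rewrite cdfE.
apply: (@cvge_ge _ _ (at_right_proper_filter x) _ _ _ _ _
  (@cdf_right_continuous _ _ _ _ (id_rv : {RV nu >-> R}) x)).
by near=> y; apply: hy; near: y; exact: nbhs_right_gt.
Unshelve. all: by end_near. Qed.

Lemma measurable_quantile : measurable_fun setT quantile.
Proof.
apply: measurable_fun_half_line => x.
have -> : quantile @^-1` half_line x =
    (`]0, 1[ `&` [set u | (u%:E <= nu (half_line x))%E]) `|` (~` `]0, 1[ `&` [set u | 0 <= x]).
  apply/seteqP; split => u /=; rewrite /half_line /= !in_itv/=.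
    case: (boolP (0 < u < 1)) => u01; first by rewrite quantile_le//; left.
    by rewrite /quantile (negbTE u01) => ?; right.
  by case=> -[u01]; [rewrite quantile_le|move/negP: u01 => u01; rewrite /quantile (negbTE u01)].
have E : [set u | (u%:E <= nu (half_line x))%E] = half_line (fine (nu (half_line x))).
  apply/seteqP; split => u; rewrite /half_line /= in_itv/= -lee_fin fineK// fin_num_measure//;
    exact: measurable_half_line.
apply: measurableU; apply: measurableI.
- exact: measurable_itv.
- by rewrite E; exact: measurable_half_line.
- by apply: measurableC; exact: measurable_itv.
- by case: (0 <= x); [rewrite (_ : [set u | _] = setT)//|rewrite (_ : [set u | _] = set0)//];
    apply/seteqP; split.
Qed.

Lemma quantile_law A : measurable A -> unif (quantile @^-1` A) = nu A.
Proof.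
move=> mA; rewrite -(lawE unif measurable_quantile).
apply: (@measure_unique_half_lines _ (law unif measurable_quantile) nu) => //.
  exact: le_lt_trans (probability_le1 _ measurableT) (ltry 1).
move=> x; have nf : nu (half_line x) \is a fin_num.
  by rewrite fin_num_measure//; exact: measurable_half_line.
have /andP[n0 n1] : 0 <= fine (nu (half_line x)) <= 1.
  rewrite -!lee_fin fineK// measure_ge0 probability_le1//; exact: measurable_half_line.
apply: (@etrans _ _ (unif (half_line (fine (nu (half_line x)))))).
  apply: unif_eq; [|exact: measurable_half_line|].
    by rewrite -[X in measurable X]setTI; exact: measurable_quantile measurableT _ (measurable_half_line x).
  by move=> u u01; rewrite /half_line /= !in_itv/= quantile_le// -lee_fin fineK.
by rewrite unif_half_line /clip min_l// max_r// fineK.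
Qed.

End quantile.

Section centered_normal_laws.
Context {R : realType}.

Lemma Rintegral_eq_measure d (T : measurableType d) (m1 m2 : {measure set T -> \bar R}) (f : T -> R) :
  (forall A, measurable A -> m1 A = m2 A) -> \int[m1]_x f x = \int[m2]_x f x.
Proof.
by move=> h; rewrite /Rintegral (@eq_measure_integral _ _ _ _ m2)// => A mA _; exact: h.
Qed.

Lemma measurable_cos d (T : measurableType d) (f : T -> R) :
  measurable_fun setT f -> measurable_fun setT (fun x => cos (f x)).
Proof. exact: measurableT_comp (continuous_measurable_fun (@continuous_cos R)). Qed.

Lemma measurable_cos_affine d (T : measurableType d) (theta t : R) (f : T -> R) :
  measurable_fun setT f -> measurable_fun setT (fun x => cos (theta + t * f x)).
Proof.
by move=> mf; apply: measurable_cos; apply: measurable_funD => //; exact: measurable_funM.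
Qed.

(** Besides the law and its transform, a finite second moment is recorded, because the uniqueness
    theorem asks for it. Variance 0 is the point mass at 0. *)
Lemma centered_normal_law (v : R) : 0 <= v ->
  exists m : probability R R,
  [/\ forall B, measurable B -> m B = centered_normal v B,
      sq_integrable m (fun y => y) &
      forall theta t, \int[m]_y cos (theta + t * y) = cos theta * expR (- (v * t ^+ 2 / 2))].
Proof.
move=> v0; rewrite /centered_normal; case: eqVneq => [->|vN0].
  exists (\d_(0 : R)); split => //.
    split; first exact: measurable_id.
    have mx2 : measurable_fun setT (EFin \o (fun y : R => y ^+ 2)).
      by apply/measurable_EFinP; exact: measurable_funX.
    apply/integrableP; split => //; rewrite integral_dirac//; last exact: measurableT_comp.
    by rewrite diracT mul1e /= expr0n /= normr0 ltry.
  move=> theta t; rewrite /Rintegral integral_dirac//; last first.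
    by apply/measurable_EFinP; exact: measurable_cos_affine.
  by rewrite diracT mul1e /= mulr0 addr0 !mul0r oppr0 expR0 mulr1.
have s0 : Num.sqrt v != 0 by rewrite sqrtr_eq0 -ltNge lt_neqAle eq_sym vN0.
exists (law (normal_prob 0 (Num.sqrt v)) measurable_id_TypeR); split => //.
  have [m i] := normal_prob_sq_integrable s0.
  split; first exact: measurable_id.
  apply/integrableP; split; first by apply/measurable_EFinP; exact: measurable_funX.
  have /integrableP[_] := i; rewrite (@ge0_integral_distribution _ _ _ _ _ _ (mfun_of measurable_id_TypeR))//.
  by apply: measurableT_comp => //; apply/measurable_EFinP; exact: measurable_funX.
move=> theta t; rewrite (@Rintegral_law _ _ _ _ _ _ _ _ _ 1)//; last 2 first.
- exact: measurable_cos_affine.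
- by move=> y; exact: cos_max.
by rewrite normal_prob_cos// sqr_sqrtr.
Qed.

(** Iterating [odd_part] peels off a fresh independent uniform variable at each step. In the
    induction the even part carries the first variable and the odd part carries all the others,
    shifted by one. *)
Lemma normal_variables :
  exists X : nat -> R -> R, (forall k, measurable_fun setT (X k)) /\
  forall n (c : nat -> R) theta, \int[unif]_u cos (theta + \sum_(k < n) c k * X k u) =
    cos theta * expR (- ((\sum_(k < n) c k ^+ 2) / 2)).
Proof.
have [m [_ _ m_cos]] := centered_normal_law (@ler01 R).
pose X k u := quantile m (even_part (iter k odd_part u)).
have mX k : measurable_fun setT (X k).
  apply: (measurableT_comp (measurable_quantile m)).
  apply: (measurableT_comp measurable_even_part).
  elim: k => [|k ih]; first exact: measurable_id.
  exact: measurableT_comp measurable_odd_part ih.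
exists X; split => // n; elim: n => [|n ih] c theta.
  by rewrite (@eq_Rintegral _ _ _ _ _ (cst (cos theta))) => [|u _];
    rewrite !big_ord0 ?addr0// Rintegral_bounded_cst mul0r oppr0 expR0 mulr1.
pose h (z : R * R) := cos (theta + c 0%N * quantile m z.1 + \sum_(k < n) c (k : nat).+1 * X k z.2).
have mh : measurable_fun setT h.
  apply: measurable_cos; apply: measurable_funD.
    apply: measurable_funD => //; apply: measurable_funM => //.
    by apply: (measurableT_comp (measurable_quantile m)).
  apply: measurable_sum => k; apply: measurable_funM => //.
  exact: measurableT_comp (mX k) _.
transitivity (\int[unif]_u h (even_part u, odd_part u)).
  apply: eq_Rintegral => u _; rewrite /h /= big_ord_recl /= addrA; congr (cos (_ + _)).
  by apply: eq_bigr => k _; rewrite /X iterSr.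
rewrite (@Rintegral_independent_pair _ _ _ _ _ _ _ _ unif unif _ _
  measurable_even_part measurable_odd_part unif_even_odd_independent h 1 mh) => [|z]; last exact: cos_max.
under eq_Rintegral => x _ do rewrite /h /= (ih (fun k => c k.+1)).
have mq := measurable_cos_affine theta (c 0%N) (measurable_quantile m).
rewrite RintegralZr//; last by apply: (@bounded_integrable _ _ _ _ _ 1) => // x; exact: cos_max.
rewrite -(@Rintegral_law _ _ _ _ _ unif _ (measurable_quantile m) (fun y => cos (theta + c 0%N * y)) 1); last 2 first.
- exact: measurable_cos_affine.
- by move=> y; exact: cos_max.
rewrite (@Rintegral_eq_measure _ _ _ m); last by move=> A mA; exact: quantile_law.
rewrite m_cos big_ord_recl /= -(mulrA (cos theta)) -expRD; congr (_ * expR _).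
by field.
Qed.

End centered_normal_laws.

(** * Uniqueness of cosine transforms *)

Section cosine_transform.
Context {R : realType}.

Let point_fun (y : R) : RI unit R := fun _ => y.

Let measurable_point_fun : measurable_fun setT point_fun.
Proof. by apply: measurable_to_RI => i; exact: measurable_id. Qed.

(** The criterion for stable convergence applied to a constant sequence on R^unit, the identity
    under [m1], with [m2] as constant random measure: a constant sequence of integrals equals its
    limit. Second moments are asked of [m1] as it plays the role of the sequence. *)
Lemma cosine_transform_Rintegral (m1 m2 : probability R R) (phi : R -> R) (B : R) :
  sq_integrable m1 (fun y => y) ->
  (forall theta t, \int[m1]_y cos (theta + t * y) = \int[m2]_y cos (theta + t * y)) ->
  continuous phi -> (forall y, `|phi y| <= B) -> \int[m1]_y phi y = \int[m2]_y phi y.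
Proof.
move=> m1sq m12 cphi phiB.
have mphi := continuous_measurable_fun cphi.
have meval : measurable_fun setT (fun y : RI unit R => y tt) by exact: measurable_coord.
have sq i : exists C : R, forall n : nat,
    sq_integrable m1 (fun y => point_fun y i) /\ \int[m1]_y (point_fun y i) ^+ 2 <= C.
  by exists (\int[m1]_y (y ^+ 2)).
have trig (s : seq (unit * R)) (theta : R) :
    measurable_fun setT (fun _ : R => \int[law m2 measurable_point_fun]_y
      cos (theta + \sum_(q <- s) q.2 * y q.1)) /\
    (fun _ : nat => \int[m1]_w (\1_setT w * cos (theta + \sum_(q <- s) q.2 * point_fun w q.1))) @ \oo -->
    \int[m1]_w (\1_setT w * \int[law m2 measurable_point_fun]_y
      cos (theta + \sum_(q <- s) q.2 * y q.1)).
  split; first exact: measurable_cst.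
  have lin (y : R) : \sum_(q <- s) q.2 * point_fun y q.1 = (\sum_(q <- s) q.2) * y.
    by rewrite mulr_suml.
  apply: (@cvg_eqr _ _ (fun=> \int[m1]_w (\1_setT w * \int[law m2 measurable_point_fun]_y
      cos (theta + \sum_(q <- s) q.2 * y q.1)))); last exact: cvg_cst.
  move=> _; under eq_Rintegral do rewrite indicT mul1r lin.
  rewrite m12; under [RHS]eq_Rintegral do rewrite indicT mul1r.
  rewrite Rintegral_bounded_cst.
  rewrite (@Rintegral_law _ _ _ _ _ _ _ _ (fun y : RI unit R => cos (theta + \sum_(q <- s) q.2 * y q.1)) 1).
  - by apply: eq_Rintegral => y _; rewrite lin.
  - by apply: measurable_cos; apply: measurable_funD => //; exact: measurable_lin.
  - by move=> y; exact: cos_max.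
have cev : continuous (fun x : {ptws unit -> R} => phi (x tt)).
  move=> x; apply: (@continuous_comp {ptws unit -> R} R R (fun x => x tt) phi x); last exact: cphi.
  exact: (@proj_continuous unit (fun _ => R) tt).
have := @stable_limit_trig _ _ _ m1 unit setT (fun _ y => point_fun y)
  (fun _ => law m2 measurable_point_fun) measurableT sq trig _ B cev (fun y => phiB (y tt)).
move=> /(cvg_lim (@ereal_hausdorff R)); rewrite lim_cst//.
have -> : (\int[law m2 measurable_point_fun]_y (phi (y tt))%:E = \int[m2]_y (phi y)%:E)%E.
  rewrite /law integral_distribution//.
    by apply/measurable_EFinP; exact: (measurableT_comp mphi meval).
  exact: (bounded_integrable _ mphi phiB).
set c := (\int[m2]_y (phi y)%:E)%E; rewrite (integral_cst _ _ c)// => E.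
rewrite /Rintegral -/c; congr fine; apply: etrans E _.
by rewrite [X in (_ * X)%E](@probability_setT _ _ _ m1) mule1.
Qed.

Lemma cosine_transform_unique (m1 m2 : probability R R) :
  sq_integrable m1 (fun y => y) ->
  (forall theta t, \int[m1]_y cos (theta + t * y) = \int[m2]_y cos (theta + t * y)) ->
  forall A, measurable A -> m1 A = m2 A.
Proof.
move=> m1sq m12; apply: measure_unique_half_lines.
  exact: le_lt_trans (probability_le1 _ measurableT) (ltry 1).
(* Continuous ramps equal to 1 on the half-line and, for n > 0, falling to 0 over a length 1 / n to
   its right. *)
move=> x; pose phi (n : nat) (y : R) : R := clip (1 - n%:R * (y - x)).
have phi01 n y : `|phi n y| <= 1.
  by rewrite ger0_norm /phi /clip ?le_max ?lexx// ge_max ler01 ge_min lexx orbT.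
have cphi n : continuous (phi n).
  move=> y; apply: (@continuous_max R R (cst 0) (fun y => Num.min (1 - n%:R * (y - x)) 1)).
    exact: cvg_cst.
  apply: (@continuous_min R R (fun y => 1 - n%:R * (y - x)) (cst 1)); last exact: cvg_cst.
  apply: cvgB; first exact: cvg_cst.
  by apply: cvgM; [exact: cvg_cst|apply: cvgB; [exact: cvg_id|exact: cvg_cst]].
have phi_cvg y : phi ^~ y @ \oo --> (\1_(half_line x) y : R).
  rewrite indicE; have [yx|xy] := leP y x.
    rewrite mem_set ?/half_line/= ?in_itv//=.
    apply: (@cvg_eqr _ _ (fun=> 1)); last exact: cvg_cst.
    move=> n; rewrite /phi /clip min_r ?max_r//.
    by rewrite lerBrDl gerDr mulr_ge0_le0 ?subr_le0.
  rewrite memNset; last by rewrite /half_line/= in_itv/=; apply/negP; rewrite -ltNge.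
  apply: cvg_near_cst; exists (Num.truncn (y - x)^-1).+1 => // n /= hn.
  rewrite /phi /clip max_l// ge_min; apply/orP; left.
  rewrite subr_le0 -ler_pdivrMr ?subr_gt0// mul1r.
  by rewrite ltW// (lt_le_trans (truncnS_gt _))// ler_nat.
have half_lim (m : probability R R) :
    (fun n => \int[m]_y phi n y) @ \oo --> fine (m (half_line x)).
  have mH := @measurable_half_line R x.
  have -> : fine (m (half_line x)) = \int[m]_y \1_(half_line x) y.
    by rewrite /Rintegral integral_indic// setIT.
  apply: (@Rintegral_bounded_cvg _ _ _ _ _ _ 1) => //.
  - by move=> n; exact: continuous_measurable_fun.
  - exact: aeW.
have mfin (m : probability R R) : (fine (m (half_line x)))%:E = m (half_line x).
  by rewrite fineK// fin_num_measure//; exact: measurable_half_line.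
apply: etrans (esym (mfin m1)) _; apply: etrans (mfin m2); congr EFin.
rewrite -(cvg_lim (@Rhausdorff R) (half_lim m1)) -(cvg_lim (@Rhausdorff R) (half_lim m2)).
congr (lim (_ @ \oo)); apply/funext => n.
exact: cosine_transform_Rintegral m1sq m12 (cphi n) (phi01 n).
Qed.

End cosine_transform.

(** * Gaussian measures on R^I *)

Section gram.
Context {R : rcfType} {I : countType}.
Implicit Types (S : I -> I -> R) (i j : I).

Definition quadratic_form S (s : seq (I * R)) : R :=
  \sum_(p <- s) \sum_(q <- s) p.2 * q.2 * S p.1 q.1.

Definition positive_form S := (forall i j, S i j = S j i) /\ forall s, 0 <= quadratic_form S s.

(** A column of the Cholesky factor. A zero pivot makes the quotient 0, so that the step then
    changes nothing. *)
Definition pivot_column S i0 i : R := S i i0 / Num.sqrt (S i0 i0).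
Definition schur_complement S i0 i j : R := S i j - pivot_column S i0 i * pivot_column S i0 j.

Lemma quadratic_form_cons S i t s : (forall i j, S i j = S j i) ->
  quadratic_form S ((i, t) :: s) =
  t ^+ 2 * S i i + 2 * t * (\sum_(p <- s) p.2 * S p.1 i) + quadratic_form S s.
Proof.
move=> symS; rewrite /quadratic_form big_cons big_cons /=.
under [X in _ + X = _]eq_bigr do rewrite big_cons /=.
rewrite big_split /= expr2.
have -> : \sum_(q <- s) t * q.2 * S i q.1 = t * \sum_(p <- s) p.2 * S p.1 i.
  by rewrite mulr_sumr; apply: eq_bigr => p _; rewrite symS mulrA.
have -> : \sum_(q <- s) q.2 * t * S q.1 i = t * \sum_(p <- s) p.2 * S p.1 i.
  by rewrite mulr_sumr; apply: eq_bigr => p _; rewrite (mulrC _ t) mulrA.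
by ring.
Qed.

Section step.
Variables (S : I -> I -> R) (i0 : I).
Hypothesis posS : positive_form S.
Let symS := proj1 posS.

Lemma positive_form_diag : 0 <= S i0 i0.
Proof.
have := proj2 posS [:: (i0, 1)]; rewrite quadratic_form_cons// big_nil.
by rewrite /quadratic_form big_nil !addr0 expr1n mul1r mulr0 addr0.
Qed.

Lemma positive_form_null i : S i0 i0 = 0 -> S i i0 = 0.
Proof.
move=> S0; apply/eqP/negPn/negP => Si.
(* With a zero pivot the form at [(t, 1)] is affine in t; this t gives it the value -1. *)
pose t := - (S i i + 1) / (2 * S i i0).
have := proj2 posS [:: (i0, t); (i, 1)]; rewrite !quadratic_form_cons// big_cons !big_nil.
rewrite /quadratic_form big_nil S0 /= !addr0 mulr0 expr1n !mul1r mulr0 add0r addr0.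
rewrite (_ : 2 * t * S i i0 = - (S i i + 1)); last by rewrite /t; field.
lra.
Qed.

Lemma schur_complement_pivot i : schur_complement S i0 i i0 = 0.
Proof.
rewrite /schur_complement /pivot_column.
have := positive_form_diag; rewrite le_eqVlt => /predU1P[/esym S0|S0].
  by rewrite (positive_form_null i S0) mul0r mul0r subr0.
by rewrite mulrACA -invfM -expr2 sqr_sqrtr ?ltW// mulfK ?gt_eqF// subrr.
Qed.

Lemma schur_complement_null i j : (forall i, S i j = 0) -> schur_complement S i0 i j = 0.
Proof. by move=> S0; rewrite /schur_complement /pivot_column S0 (symS j) S0 mul0r mulr0 subr0. Qed.

Lemma schur_complement_positive : positive_form (schur_complement S i0).
Proof.
split=> [i j|s]; first by rewrite /schur_complement symS mulrC.
have := positive_form_diag; rewrite le_eqVlt => /predU1P[/esym S0|S0].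
  rewrite (_ : schur_complement S i0 = S); first by case: posS.
  by apply/funext => i; apply/funext => j;
    rewrite /schur_complement /pivot_column S0 sqrtr0 invr0 !mulr0 subr0.
pose L := \sum_(p <- s) p.2 * S p.1 i0.
have -> : quadratic_form (schur_complement S i0) s = quadratic_form S s - L ^+ 2 / S i0 i0.
  rewrite /quadratic_form /L expr2 mulr_suml mulr_suml -sumrB; apply: eq_bigr => p _.
  rewrite mulr_sumr mulr_suml -sumrB; apply: eq_bigr => q _.
  rewrite /schur_complement /pivot_column mulrACA -invfM -expr2 sqr_sqrtr ?ltW//.
  by field; rewrite gt_eqF.
(* Completing the square: this coefficient minimizes the form over the coordinate [i0], and the
   minimum is the form of the Schur complement. *)
have := proj2 posS ((i0, - L / S i0 i0) :: s); rewrite quadratic_form_cons// -/L.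
rewrite (_ : _ + _ = quadratic_form S s - L ^+ 2 / S i0 i0)//.
by field; rewrite gt_eqF.
Qed.

End step.

(* Gaussian elimination along the enumeration of I. *)
Fixpoint eliminate S (n : nat) : I -> I -> R :=
  if n is k.+1 then
    if unpickle k is Some i0 then schur_complement (eliminate S k) i0 else eliminate S k
  else S.

Definition gram_factor S i (k : nat) : R :=
  if unpickle k is Some i0 then pivot_column (eliminate S k) i0 i else 0.

Lemma eliminate_positive S n : positive_form S -> positive_form (eliminate S n).
Proof.
move=> posS; elim: n => //= k ih; case: unpickle => // i0.
exact: schur_complement_positive.
Qed.

Lemma eliminateE S n i j :
  eliminate S n i j = S i j - \sum_(k < n) gram_factor S i k * gram_factor S j k.
Proof.
elim: n => [|n ih] /=; first by rewrite big_ord0 subr0.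
rewrite big_ord_recr /= opprD addrA -ih /gram_factor; case: unpickle => [i0|] //.
by rewrite mulr0 subr0.
Qed.

(** The step at the code of j clears its column, and later steps keep a null column null. *)
Lemma eliminate_null S n i j : positive_form S -> (pickle j < n)%N -> eliminate S n i j = 0.
Proof.
move=> posS; elim: n i => // n ih i; rewrite ltnS leq_eqVlt => /predU1P[<-|jn] /=.
  by rewrite pickleK schur_complement_pivot//; exact: eliminate_positive.
case: unpickle => [i0|]; last exact: ih.
apply: schur_complement_null; first exact: eliminate_positive.
by move=> i'; exact: ih.
Qed.

(** The factor is triangular along the enumeration, so even for infinite [I] every coordinate of the
    Gaussian vector is a finite sum. *)
Lemma gram_factor_null S i k : positive_form S -> (pickle i < k)%N -> gram_factor S i k = 0.
Proof.
move=> posS ik; rewrite /gram_factor; case: unpickle => // i0.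
have [sym _] := eliminate_positive k posS.
by rewrite /pivot_column sym eliminate_null// mul0r.
Qed.

Lemma gram_factorE S n i j : positive_form S -> (pickle j < n)%N ->
  S i j = \sum_(k < n) gram_factor S i k * gram_factor S j k.
Proof. by move=> posS jn; apply/eqP; rewrite -subr_eq0 -eliminateE eliminate_null. Qed.

End gram.

Lemma sum_ord_widen_null (V : nmodType) (F : nat -> V) (m n : nat) :
  (forall k, (m <= k)%N -> F k = 0) -> (m <= n)%N -> \sum_(k < n) F k = \sum_(k < m) F k.
Proof.
move=> F0 mn; rewrite (big_ord_widen n F mn) [RHS]big_mkcond; apply: eq_bigr => k _.
by case: ltnP => // /F0.
Qed.

Section gaussian_measures.
Context {R : realType} {I : countType}.
Implicit Types Sigma : I -> I -> R.

(** A finite linear combination of the coordinates is one of finitely many normal variables; its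
    cosine transform is explicit and identifies its law by uniqueness. *)
Lemma gaussian_exists Sigma : positive_form Sigma ->
  exists mu : probability (RI I R) R, centered_gaussian Sigma mu.
Proof.
move=> posS; have [X [mX Xcos]] := @normal_variables R.
pose a := gram_factor Sigma.
pose Y u : RI I R := fun i => \sum_(k < (pickle i).+1) a i k * X k u.
have mY : measurable_fun setT Y.
  by apply: measurable_to_RI => i; apply: measurable_sum => k; exact: measurable_funM.
exists (law unif mY) => s v; split; first exact: (proj2 posS s).
(* A common length for the sums of all coordinates in [s]; the added terms are 0 by
   triangularity. *)
have [N hN] : exists N, forall q, q \in s -> (pickle q.1 < N)%N.
  exists (\max_(q <- s) (pickle q.1).+1) => q qs; exact: leq_bigmax_seq.
pose c k := \sum_(q <- s) q.2 * a q.1 k.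
have linY u : \sum_(q <- s) q.2 * Y u q.1 = \sum_(k < N) c k * X k u.
  under [RHS]eq_bigr do rewrite mulr_suml.
  rewrite exchange_big /=; apply: eq_big_seq => q qs.
  rewrite /Y -(@sum_ord_widen_null _ (fun k => a q.1 k * X k u) _ N); last exact: hN.
    by rewrite mulr_sumr; apply: eq_bigr => k _; rewrite mulrA.
  by move=> k hk; rewrite /a gram_factor_null ?mul0r.
have vE : v = \sum_(k < N) c k ^+ 2.
  rewrite /v; under [RHS]eq_bigr do rewrite expr2 mulr_suml.
  rewrite [RHS]exchange_big /=; apply: eq_big_seq => p ps.
  under [RHS]eq_bigr do rewrite mulr_sumr.
  rewrite [RHS]exchange_big /=; apply: eq_big_seq => q qs.
  rewrite (gram_factorE _ posS (hN q qs)) mulr_sumr; apply: eq_bigr => k _.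
  by rewrite -/a; ring.
have v0 : 0 <= v by exact: (proj2 posS s).
have [m [mE msq mcos]] := centered_normal_law v0.
have mlin := @measurable_lin I R s.
move=> B mB; rewrite -mE//.
have mlY := measurableT_comp mlin mY.
apply/esym; apply: (@cosine_transform_unique _ m (law unif mlY)) => // theta t.
rewrite mcos (@Rintegral_law _ _ _ _ _ _ _ _ (fun y => cos (theta + t * y)) 1); last 2 first.
- exact: measurable_cos_affine.
- by move=> y; exact: cos_max.
rewrite vE; transitivity (\int[unif]_u cos (theta + \sum_(k < N) (t * c k) * X k u)).
  rewrite (Xcos N (fun k => t * c k)); congr (_ * expR (- (_ / 2))).
  by rewrite mulr_suml; apply: eq_bigr => k _; rewrite exprMn mulrC.
apply: eq_Rintegral => u _ /=; congr (cos (_ + _)); rewrite linY mulr_sumr.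
by apply: eq_bigr => k _; rewrite mulrA.
Qed.

Lemma centered_gaussian_cos Sigma (mu : probability (RI I R) R) (s : seq (I * R)) theta :
  centered_gaussian Sigma mu ->
  \int[mu]_y cos (theta + \sum_(q <- s) q.2 * y q.1) =
  cos theta * expR (- (quadratic_form Sigma s / 2)).
Proof.
move=> /(_ s)[v0 hB]; have [m [mE _ mcos]] := centered_normal_law v0.
have mlin := @measurable_lin I R s.
have mc : measurable_fun setT (fun y : R => cos (theta + 1 * y)) by exact: measurable_cos_affine.
transitivity (\int[law mu mlin]_y cos (theta + 1 * y)).
  rewrite (@Rintegral_law _ _ _ _ _ _ _ _ _ 1 mc) => [|y]; last exact: cos_max.
  by apply: eq_Rintegral => y _; rewrite mul1r.
rewrite (@Rintegral_eq_measure _ _ _ _ m) => [|A mA]; last exact: etrans (hB A mA) (esym (mE A mA)).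
by rewrite mcos expr1n mulr1.
Qed.

End gaussian_measures.

(** * Partially c.i.d. arrays *)

Section partially_cid_arrays.
Context d (T : measurableType d) (R : realType) (P : probability T R) (I : countType).
Variables (G : nat -> set (set T)) (X : nat -> I -> T -> R) (M : nat -> I -> T -> R)
  (Sigma : I -> I -> T -> R).
Hypothesis hG : forall n, sub_sigma_field (G n).
Hypothesis G_incr : forall n, G n `<=` G n.+1.
Hypothesis X_cid : partially_cid P G X.
Hypothesis X_sq : forall n i, (1 <= n)%N -> sq_integrable P (X n i).
Hypothesis M_cond : forall n i, cond_exp_version P (G n) (X n.+1 i) (M n i).

Let Stilde n i w := Num.sqrt n%:R * ((n%:R)^-1 * \sum_(1 <= k < n.+1) X k i w - M n i w).
Let V n i w := (X n i w - M n.-1 i w) - n%:R * (M n i w - M n.-1 i w).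

Hypothesis S_bound : forall i, exists C : R, forall n, (1 <= n)%N ->
  (\int[P]_w ((Stilde n i w) ^+ 2)%:E <= C%:E)%E.

Let G_measurable n A : G n A -> measurable A.
Proof. by have [_] := hG n; exact. Qed.

Let X_integrable n i : P.-integrable setT (EFin \o X n.+1 i).
Proof. exact/sq_integrable1/X_sq. Qed.

Let M_integrable n i : P.-integrable setT (EFin \o M n i).
Proof. by case: (M_cond n i). Qed.

Let M_X n i A : G n A -> \int[P]_(w in A) M n i w = \int[P]_(w in A) X n.+1 i w.
Proof. by case: (M_cond n i) => _ _ h /h E; rewrite /Rintegral E. Qed.

Let Rintegral_indic A (f : T -> R) : \int[P]_(w in A) f w = \int[P]_w (\1_A w * f w).
Proof. by rewrite Rintegral_mkcond patch_indic; apply: eq_Rintegral => w _ /=; rewrite mulrC. Qed.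

Let trunc (m : nat) (x : R) : R := Num.max (- m%:R) (Num.min x m%:R).

Let trunc_bound m x : `|trunc m x| <= m%:R.
Proof.
have m0 : 0 <= m%:R :> R by [].
rewrite ler_norml /trunc le_max lexx /= ge_max ge_min lexx orbT andbT; lra.
Qed.

Let trunc_le m x : `|trunc m x| <= `|x|.
Proof.
have m0 : 0 <= m%:R :> R by [].
rewrite /trunc; have [x0|x0] := lerP x m%:R; last first.
  by rewrite max_r ?(le_trans _ m0)// ?oppr_le0// !ger0_norm ?(ltW (le_lt_trans m0 x0))// ltW.
have [x1|//] := lerP x (- m%:R).
have x0' : x <= 0 by rewrite (le_trans x1)// oppr_le0.
by rewrite normrN ger0_norm// ler0_norm// lerNr.
Qed.

Let trunc_cvg x : trunc ^~ x @ \oo --> x.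
Proof.
apply: cvg_near_cst; exists (Num.truncn `|x|).+1 => // m /= hm.
have : `|x| <= m%:R by rewrite ltW// (lt_le_trans (truncnS_gt _))// ler_nat.
by rewrite ler_norml => /andP[h1 h2]; rewrite /trunc min_l// max_r.
Qed.

Let measurable_trunc m : measurable_fun setT (trunc m).
Proof. by apply: measurable_maxr => //; exact: measurable_minr. Qed.

(* The c.i.d. property concerns bounded functions only; truncations extend it to X itself. *)
Let X_step n i A : G n A -> \int[P]_(w in A) X n.+1 i w = \int[P]_(w in A) X n.+2 i w.
Proof.
move=> GA; have mA := G_measurable GA.
have [_ hcid] := X_cid.
have E m : \int[P]_w (\1_A w * trunc m (X n.+1 i w)) = \int[P]_w (\1_A w * trunc m (X n.+2 i w)).
  have [|Y [[_ _ h1] [_ _ h2]]] := hcid i 2%N n (trunc m) isT (measurable_trunc m).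
    by exists m%:R; exact: trunc_bound.
  have GjA : Gnj G X n i A by apply: sub_sigma_algebra; left.
  have := h2 A GjA; rewrite h1// addn2 => E'.
  by rewrite -!Rintegral_indic /Rintegral; congr fine.
have lim k : (fun m => \int[P]_w (\1_A w * trunc m (X k.+1 i w))) @ \oo -->
    \int[P]_(w in A) X k.+1 i w.
  have mX : measurable_fun setT (X k.+1 i) by exact: integrable_measurable (X_integrable k i).
  have mI : measurable_fun setT (\1_A : T -> R) by exact: measurable_indic.
  rewrite Rintegral_indic.
  apply: (@Rintegral_dominated_cvg _ _ _ P _ _ (fun w => `|X k.+1 i w|)).
  - by move=> m; apply: measurable_funM => //; exact: (measurableT_comp (measurable_trunc m)).
  - exact: measurable_funM.
  - exact: integrable_norm.
  - by apply: aeW => w; apply: cvgM; [exact: cvg_cst|exact: trunc_cvg].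
  - move=> m w; rewrite normrM -[leRHS]mul1r ler_pM//.
    by rewrite indicE; case: (_ \in _); rewrite /= ?normr1 ?normr0.
rewrite -(cvg_lim (@Rhausdorff R) (lim n)) -(cvg_lim (@Rhausdorff R) (lim n.+1)).
by congr (limn _); apply/funext.
Qed.

Let M_step n i A : G n A -> \int[P]_(w in A) M n.+1 i w = \int[P]_(w in A) M n i w.
Proof. by move=> GA; rewrite M_X ?M_X// -?X_step//; exact: G_incr. Qed.

Let Stilde0 i w : Stilde 0 i w = 0.
Proof. by rewrite /Stilde sqrtr0 mul0r. Qed.

Let sum_X n i w : \sum_(1 <= k < n.+1) X k i w = \sum_(k < n) X k.+1 i w.
Proof. by rewrite big_add1 big_mkord. Qed.

Let mM n i : measurable_fun setT (M n i).
Proof. exact: integrable_measurable. Qed.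

Let Stilde_sq n i : sq_integrable P (Stilde n i).
Proof.
have mS : measurable_fun setT (Stilde n i).
  apply: measurable_funM => //; apply: measurable_funB => //; apply: measurable_funM => //.
  under eq_fun do rewrite sum_X.
  by apply: measurable_sum => k; exact: integrable_measurable (X_integrable k i).
split => //; case: n mS => [|n] mS.
  rewrite (_ : EFin \o _ = EFin \o (fun=> 0)); first exact: cst_integrable.
  by apply/funext => w; rewrite /= Stilde0 expr0n.
have [C hC] := S_bound i; apply/integrableP; split.
  by apply/measurable_EFinP; exact: measurable_funX.
apply: le_lt_trans (ltry C); apply: le_trans (hC n.+1 isT).
rewrite le_eqVlt; apply/orP; left; apply/eqP; apply: eq_integral => w _ /=.
by rewrite ger0_norm// sqr_ge0.
Qed.

Let Stilde_bound i : exists C : R, forall n, \int[P]_w (Stilde n i w) ^+ 2 <= C.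
Proof.
have [C hC] := S_bound i; exists (Num.max C 0) => -[|n].
  by under eq_Rintegral do rewrite Stilde0 expr0n; rewrite Rintegral_bounded_cst le_max lexx orbT.
rewrite le_max -lee_fin /Rintegral fineK ?hC//.
by apply: (integrable_fin_num measurableT); case: (Stilde_sq n.+1 i).
Qed.

(** Solving the definition of [Stilde] for [M] replaces the conditional Jensen inequality. *)
Let M_sq n i : sq_integrable P (M n.+1 i).
Proof.
have -> : M n.+1 i = fun w => (n.+1%:R)^-1 * (\sum_(k < n.+1) X k.+1 i w)
                              - (Num.sqrt n.+1%:R)^-1 * Stilde n.+1 i w.
  apply/funext => w; rewrite /Stilde sum_X mulKf; first by ring.
  by rewrite sqrtr_eq0 -ltNge ltr0n.
apply: sq_integrableB; apply: sq_integrableZ => //.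
by apply: sq_integrable_sum => k; exact: X_sq.
Qed.

(** The form in which the sum telescopes. *)
Let VE k i w : V k.+1 i w = X k.+1 i w + k%:R * M k i w - k.+1%:R * M k.+1 i w.
Proof. by rewrite /V /= -[k.+1%:R]natr1; ring. Qed.

Let V_sq k i : sq_integrable P (V k.+1 i).
Proof.
rewrite (funext (VE k i)); apply: sq_integrableB; last exact: sq_integrableZ.
apply: sq_integrableD; first exact: X_sq.
(* [M_sq] says nothing of [M 0], as [Stilde 0] is 0 by convention; but the coefficient of [M 0] in
   [V 1] is 0. *)
case: k => [|k]; last exact: sq_integrableZ.
by apply: (@sq_integrable_bounded _ _ _ _ _ 0) => [|w]; [exact: measurable_funM|rewrite mul0r normr0].
Qed.

Let V_centered k i A : G k A -> \int[P]_(w in A) V k.+1 i w = 0.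
Proof.
move=> GA; have mA := G_measurable GA.
have res f : P.-integrable setT (EFin \o f) -> P.-integrable A (EFin \o f).
  by move=> h; exact: integrableS h.
have IX := X_integrable k i; have IM := M_integrable k i; have IM' := M_integrable k.+1 i.
rewrite /V /= RintegralB//; last 2 first.
- by apply: res; exact: integrable_subr.
- by apply: res; apply: integrable_scaler; exact: integrable_subr.
rewrite RintegralZl//; last by apply: res; exact: integrable_subr.
rewrite !RintegralB//; try exact: res.
by rewrite M_step// M_X// !subrr mulr0 subrr.
Qed.

Let V_adapted k i : H_measurable (G k.+1) (V k.+1 i).
Proof.
have [sG _] := hG k.+1; have [X_adapted _] := X_cid.
have mX : measurable_fun (setT : set (g_sigma_algebraType (G k.+1))) (X k.+1 i).
  by apply/H_measurableP => //; exact: X_adapted.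
have mM0 : measurable_fun (setT : set (g_sigma_algebraType (G k.+1))) (M k i).
  by apply/H_measurableP => //; apply: (H_measurable_sub (@G_incr k)); case: (M_cond k i).
have mM1 : measurable_fun (setT : set (g_sigma_algebraType (G k.+1))) (M k.+1 i).
  by apply/H_measurableP => //; case: (M_cond k.+1 i).
apply/H_measurableP => //; apply: measurable_funB; first exact: measurable_funB.
by apply: measurable_funM => //; exact: measurable_funB.
Qed.

Let sum_V n i w : (Num.sqrt n%:R)^-1 * \sum_(k < n) V k.+1 i w = Stilde n i w.
Proof.
have -> : \sum_(k < n) V k.+1 i w = \sum_(k < n) X k.+1 i w - n%:R * M n i w.
  elim: n => [|n ih]; first by rewrite !big_ord0 mul0r subr0.
  by rewrite !big_ord_recr /= ih VE; ring.
case: n => [|n]; first by rewrite Stilde0 sqrtr0 invr0 mul0r.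
have n0 : 0 < n.+1%:R :> R by rewrite ltr0n.
have s0 : Num.sqrt n.+1%:R != 0 :> R by rewrite sqrtr_eq0 -ltNge.
rewrite /Stilde sum_X -{2 4}(sqr_sqrtr (ltW n0)).
by field.
Qed.

(** Shifted by one: [D s k] is the increment between times k and k + 1, as in [martingale_clt]. *)
Let D (s : seq (I * R)) k w := \sum_(p <- s) p.2 * V k.+1 p.1 w.

Let D_sq s k : sq_integrable P (D s k).
Proof. by apply: sq_integrable_sum => p; exact: sq_integrableZ. Qed.

Let D_adapted s k : H_measurable (G k.+1) (D s k).
Proof.
have [sG _] := hG k.+1; apply/H_measurableP => //.
apply: measurable_sum => p; apply: measurable_funM => //.
by apply/H_measurableP => //; exact: V_adapted.
Qed.

Let D_centered s k A : G k A -> \int[P]_(w in A) D s k w = 0.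
Proof.
move=> GA; have mA := G_measurable GA.
have IV i : P.-integrable setT (EFin \o V k.+1 i) by exact: sq_integrable1.
have mI : measurable_fun setT (\1_A : T -> R) by exact: measurable_indic.
rewrite Rintegral_indic /D; under eq_Rintegral do rewrite mulr_sumr.
rewrite Rintegral_sum; last first.
  move=> p; apply: (@integrable_mul_bounded _ _ _ _ _ _ 1) => //; last exact: integrable_scaler.
  by move=> w; rewrite indicE; case: (_ \in _); rewrite /= ?normr1 ?normr0.
rewrite big1// => p _; rewrite -Rintegral_indic RintegralZl//.
  by rewrite V_centered// mulr0.
exact: integrableS (IV p.1).
Qed.

Let sum_D s n w : (Num.sqrt n%:R)^-1 * \sum_(k < n) D s k w = \sum_(p <- s) p.2 * Stilde n p.1 w.
Proof.
rewrite /D exchange_big /= mulr_sumr; apply: eq_bigr => p _.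
by rewrite -mulr_sumr mulrCA sum_V.
Qed.

Let linear_Stilde_bound s : exists2 C : R, 0 <= C &
  forall n, \int[P]_w (\sum_(p <- s) p.2 * Stilde n p.1 w) ^+ 2 <= C.
Proof.
elim: s => [|p s [C C0 hC]].
  exists 0 => // n; under eq_Rintegral do rewrite big_nil expr0n.
  by rewrite Rintegral_bounded_cst.
have [C' hC'] := Stilde_bound p.1.
have C'0 : 0 <= C' by apply: le_trans (hC' 0%N); apply: Rintegral_ge0 => w _; exact: sqr_ge0.
exists (2 * p.2 ^+ 2 * C' + 2 * C); first by have := sqr_ge0 p.2; nra.
move=> n; have h1 := Stilde_sq n p.1.
have h2 : sq_integrable P (fun w => \sum_(p <- s) p.2 * Stilde n p.1 w).
  by apply: sq_integrable_sum => q; exact: sq_integrableZ.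
have I1 := integrable_scaler (2 * p.2 ^+ 2) (proj2 h1).
have I2 := integrable_scaler 2 (proj2 h2).
have [_ I3] := sq_integrableD (sq_integrableZ p.2 h1) h2.
apply: (@le_trans _ _ (\int[P]_w (2 * p.2 ^+ 2 * Stilde n p.1 w ^+ 2 +
    2 * (\sum_(p <- s) p.2 * Stilde n p.1 w) ^+ 2))).
  under eq_Rintegral do rewrite big_cons.
  apply: le_Rintegral => //; first exact: integrable_addr.
  move=> w _; set a := Stilde _ _ _; set b := \sum_(_ <- _) _.
  have := sqr_ge0 (p.2 * a - b); nra.
rewrite RintegralD// !RintegralZl//; [|exact: (proj2 h2)|exact: (proj2 h1)].
by rewrite lerD// ler_wpM2l// mulr_ge0// sqr_ge0.
Qed.

Let sum_D_bound s : exists2 C : R, 0 <= C &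
  forall n, \int[P]_w (\sum_(k < n) D s k w) ^+ 2 <= n%:R * C.
Proof.
have [C C0 hC] := linear_Stilde_bound s; exists C => // n.
case: n => [|n].
  under eq_Rintegral do rewrite big_ord0 expr0n.
  by rewrite Rintegral_bounded_cst mul0r.
have n0 : 0 < n.+1%:R :> R by rewrite ltr0n.
rewrite mulrC -ler_pdivrMr// mulrC -RintegralZl//; last first.
  by have [] := sq_integrable_sum (index_enum 'I_n.+1) (fun k => D_sq s k).
apply: le_trans (hC n.+1); rewrite le_eqVlt; apply/orP; left; apply/eqP.
by apply: eq_Rintegral => w _; rewrite -sum_D exprMn exprVn sqr_sqrtr.
Qed.

Lemma partially_cid_cos s theta (v : T -> R) A :
  measurable_fun setT v -> (forall w, 0 <= v w) ->
  {ae P, forall w, (fun n => n%:R^-1 * \sum_(k < n) (\sum_(p <- s) p.2 * V k.+1 p.1 w) ^+ 2) @ \oo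
    --> v w} ->
  measurable A ->
  (fun n => \int[P]_w (\1_A w * cos (theta + \sum_(p <- s) p.2 * Stilde n p.1 w))) @ \oo -->
  \int[P]_w (\1_A w * (cos theta * expR (- (v w / 2)))).
Proof.
move=> mv v0 cv mA; have [C C0 hC] := sum_D_bound s.
have := @martingale_clt _ _ _ P G (D s) hG G_incr (D_adapted s) (D_sq s) (@D_centered s) C C0 hC
  theta v A mv v0 cv mA.
by under eq_fun do under eq_Rintegral do rewrite sum_D.
Qed.

Hypothesis mSigma : forall i j, measurable_fun setT (Sigma i j).
Hypothesis V_cvg : forall i j, {ae P, forall w,
  (fun n => (n%:R)^-1 * \sum_(1 <= k < n.+1) V k i w * V k j w) @ \oo --> Sigma i j w}.

Let good w := forall i j,
  (fun n => (n%:R)^-1 * \sum_(k < n) V k.+1 i w * V k.+1 j w) @ \oo --> Sigma i j w.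

(** There are countably many pairs of indices, run through by their codes, so one null set serves
    for all. *)
Let good_ae : {ae P, forall w, good w}.
Proof.
have h (n m : nat) : {ae P, forall w, forall i j, unpickle n = Some i -> unpickle m = Some j ->
    (fun n => (n%:R)^-1 * \sum_(k < n) V k.+1 i w * V k.+1 j w) @ \oo --> Sigma i j w}.
  case E1 : (unpickle n) => [i|]; last by apply: aeW.
  case E2 : (unpickle m) => [j|]; last by apply: aeW.
  apply: filterS (V_cvg i j) => w h _ _ [<-] [<-].
  by apply: (cvg_eqr _ h) => t; rewrite big_add1 big_mkord.
have : {ae P, forall w (n m : nat) i j, unpickle n = Some i -> unpickle m = Some j ->
    (fun n => (n%:R)^-1 * \sum_(k < n) V k.+1 i w * V k.+1 j w) @ \oo --> Sigma i j w}.
  by apply: ae_foralln => n; apply: ae_foralln => m; exact: h.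
apply: filterS => w hw i j.
by apply: (hw (pickle i) (pickle j)); rewrite pickleK.
Qed.

Let quadratic_cvg w s : good w ->
  (fun n => n%:R^-1 * \sum_(k < n) (\sum_(p <- s) p.2 * V k.+1 p.1 w) ^+ 2) @ \oo -->
  quadratic_form (fun i j => Sigma i j w) s.
Proof.
move=> gw; apply: (@cvg_eqr _ _ (fun n => \sum_(p <- s) \sum_(q <- s) p.2 * q.2 *
    (n%:R^-1 * \sum_(k < n) V k.+1 p.1 w * V k.+1 q.1 w))).
  move=> n; under eq_bigr do rewrite expr2 mulr_suml.
  rewrite exchange_big mulr_sumr; apply: eq_bigr => p _ /=.
  under eq_bigr do rewrite mulr_sumr.
  rewrite exchange_big mulr_sumr; apply: eq_bigr => q _ /=.
  rewrite !mulr_sumr; apply: eq_bigr => k _; ring.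
have cvs (J : Type) (t : seq J) (f : nat -> J -> R) (l : J -> R) :
    (forall j, f ^~ j @ \oo --> l j) ->
    (fun n => \sum_(j <- t) f n j) @ \oo --> \sum_(j <- t) l j.
  move=> h; elim: t => [|j t ih].
    by rewrite big_nil; apply: (@cvg_eqr _ _ (fun=> 0)) => [n|]; [rewrite big_nil|exact: cvg_cst].
  rewrite big_cons; apply: (@cvg_eqr _ _ (fun n => f n j + \sum_(j <- t) f n j)) => [n|].
    by rewrite big_cons.
  exact: cvgD (h j) ih.
by apply: (cvs) => p; apply: (cvs) => q; apply: cvgM; [exact: cvg_cst|exact: gw].
Qed.

(** The quadratic form is a limit of means of squares, and symmetry passes to the limit; neither is
    assumed of [Sigma]. *)
Let good_positive w : good w -> positive_form (fun i j => Sigma i j w).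
Proof.
move=> gw; split=> [i j|s].
  apply: (cvg_unique (@Rhausdorff R) (gw i j)).
  by apply: (cvg_eqr _ (gw j i)) => n; congr (_ * _); apply: eq_bigr => k _; rewrite mulrC.
have cv := @quadratic_cvg w s gw.
rewrite -(cvg_lim (@Rhausdorff R) cv); apply: limr_ge; first by apply/cvg_ex; eexists; exact: cv.
apply: nearW => n; apply: mulr_ge0; first by rewrite invr_ge0.
by apply: sumr_ge0 => k _; exact: sqr_ge0.
Qed.

Lemma partially_cid_clt : exists beta : T -> probability (RI I R) R,
  {ae P, forall w, centered_gaussian (fun i j => Sigma i j w) (beta w)} /\
  stably_converges P (fun n w i => Stilde n i w) beta.
Proof.
have [N [mN PN badN]] := good_ae.
have goodN w : ~ N w -> good w by move=> Nw; apply: contrapT => /badN.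
(* Set to 0 on the exceptional set, so that a Gaussian measure exists for every w; [N] is
   measurable, which preserves measurability. *)
pose Sigma' w i j := \1_(~` N) w * Sigma i j w.
have SigmaN w : ~ N w -> Sigma' w = fun i j => Sigma i j w.
  move=> Nw; apply/funext => i; apply/funext => j.
  by rewrite /Sigma' indicE mem_set// mul1r.
have posS w : positive_form (Sigma' w).
  have [Nw|Nw] := pselect (N w); last by rewrite SigmaN//; exact/good_positive/goodN.
  have S0 i j : Sigma' w i j = 0 by rewrite /Sigma' indicE memNset ?mul0r//; apply/negP.
  split=> [i j|s]; first by rewrite !S0.
  by rewrite /quadratic_form big1// => p _; rewrite big1// => q _; rewrite S0 mulr0.
(* A pointwise choice carries no measurability in w; [bE] below recovers it for the cosine
   integrals, by expressing them through [v]. *)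
have /choice[beta hbeta] : forall w, exists mu : probability (RI I R) R, centered_gaussian (Sigma' w) mu.
  by move=> w; exact: gaussian_exists.
exists beta; split.
  exists N; split => // w /= h; apply: contrapT => Nw; apply: h.
  by rewrite -SigmaN.
pose v s w := quadratic_form (Sigma' w) s.
have mv s : measurable_fun setT (v s).
  apply: measurable_sum => p; apply: measurable_sum => q; apply: measurable_funM => //.
  apply: measurable_funM => //; apply: measurable_indic; exact: measurableC.
have v0 s w : 0 <= v s w by exact: (proj2 (posS w) s).
apply: stably_converges_trig => [i|s theta].
  by have [C hC] := Stilde_bound i; exists C => n; split => //; exact: hC.
have bE w : \int[beta w]_y cos (theta + \sum_(q <- s) q.2 * y q.1) =
    cos theta * expR (- (v s w / 2)) by exact: centered_gaussian_cos.
split.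
  under eq_fun do rewrite bE.
  apply: measurable_funM => //; apply: (measurableT_comp (@measurable_expR R)).
  by apply: measurableT_comp => //; exact: measurable_funM.
move=> A mA; under eq_Rintegral do rewrite bE.
apply: partially_cid_cos => //.
exists N; split => // w /= h; apply: contrapT => Nw; apply: h.
by rewrite /v SigmaN//; exact/quadratic_cvg/goodN.
Qed.

End partially_cid_arrays.

Theorem mainTheorem15 (d : measure_display) (T : measurableType d) (R : realType)
  (P : probability T R) (I : countType)
  (G : nat -> set (set T)) (X : nat -> I -> T -> R)
  (M : nat -> I -> T -> R) (Sigma : I -> I -> T -> R) :
  (forall n, sub_sigma_field (G n)) ->
  (forall n, G n `<=` G n.+1) ->
  partially_cid P G X ->
  (forall n i, (1 <= n)%N -> measurable_fun setT (X n i) /\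
     P.-integrable setT (fun w => (X n i w ^+ 2)%:E)) ->
  (* M n i is (a version of) E[X_{n+1,i} | G_n] *)
  (forall n i, cond_exp_version P (G n) (X n.+1 i) (M n i)) ->
  let Stilde n i w :=
    Num.sqrt n%:R * ((n%:R)^-1 * \sum_(1 <= k < n.+1) X k i w - M n i w) in
  let V n i w :=
    (X n i w - M n.-1 i w) - n%:R * (M n i w - M n.-1 i w) in
  (forall i, exists C : R, forall n, (1 <= n)%N ->
     (\int[P]_w ((Stilde n i w) ^+ 2)%:E <= C%:E)%E) ->
  (forall i j, measurable_fun setT (Sigma i j)) ->
  (forall i j, {ae P, forall w,
     (fun n => (n%:R)^-1 * \sum_(1 <= k < n.+1) V k i w * V k j w) @ \oo
       --> Sigma i j w}) ->
  exists beta : T -> probability (RI I R) R,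
    {ae P, forall w, centered_gaussian (fun i j => Sigma i j w) (beta w)} /\
    stably_converges P (fun n w i => Stilde n i w) beta.
Proof.
move=> hG G_incr X_cid X_sq M_cond Stilde V S_bound mSigma V_cvg.
exact: partially_cid_clt hG G_incr X_cid X_sq M_cond S_bound mSigma V_cvg.
Qed.
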